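(* Let $\zeta$ be a functional satisfying properties P1, P2, P3, P4 and P5 (stated in the context). Then for every $\lambda>0$ the limit $$\rho(\lambda):=\lim_{s\to\infty}\frac{\mathbb E[\zeta(\mathcal H_{\lambda,s})]}{\lambda s^d}$$ exists in $\mathbb R$. Moreover, if $n r_n^d\to t$ as $n\to\infty$ for some $t\in(0,\infty)$, then as $n\to\infty$, both $$n^{-1}\zeta_{r_n}(\mathcal X_n)\to\int_{\mathbb R^d}\rho(t f_\mu(x))f_\mu(x)\,dx\quad\text{and}\quad n^{-1}\zeta_{r_n}(\mathcal P_n)\to\int_{\mathbb R^d}\rho(t f_\mu(x))f_\mu(x)\,dx,$$ where in each case the convergence holds both completely and in $L^2$.
   Context: Fix $d\in\mathbb N$. Let $\mu$ be a diffuse probability measure on $\mathbb R^d$ (i.e. $\mu(\{x\})=0$ for all $x$). Let $X_1,X_2,\dots$ be i.i.d. random vectors with distribution $\mu$; $\mathcal X_n:=\{X_1,\dots,X_n\}$. For $t>0$ let $N_t$ be Poisson with mean $t$, independent of $(X_i)_{i\ge1}$, and $\mathcal P_t:=\{X_1,\dots,X_{N_t}\}$. $(r_n)_{n\ge1}$ is a sequence of positive reals. $f_\mu$ is the Lebesgue density of the absolutely continuous part of $\mu$ in its Lebesgue decomposition ($\mu$ may have a singular part). The integrand $\rho(tf_\mu(x))f_\mu(x)$ is taken to be $0$ where $f_\mu(x)=0$. $\mathcal H_\lambda$ is a homogeneous Poisson point process of intensity $\lambda$ on $\mathbb R^d$, $Q_s:=[-s/2,s/2)^d$ and $\mathcal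 H_{\lambda,s}:=\mathcal H_\lambda\cap Q_s$. $B_r(x)$ is the closed Euclidean ball; $o$ is the origin; $|\mathcal X|$ is the cardinality of $\mathcal X$. $\xi_n\to c$ completely means $\sum_{n}\mathbb P[|\xi_n-c|>\varepsilon]<\infty$ for all $\varepsilon>0$; $\xi_n\to c$ in $L^2$ means $\mathbb E[(\xi_n-c)^2]\to0$. $\zeta$ is a non-negative real-valued function on the finite subsets of $\mathbb R^d$ with $\zeta(\emptyset)=0$, and $\zeta_r(\mathcal X):=\zeta(r^{-1}\mathcal X)$ for $r>0$. Properties: P1: for each $k\in\mathbb N$, $(x_1,\dots,x_k)\mapsto\zeta(\{x_1,\dots,x_k\})$ is measurable on the set of $k$-tuples of distinct points of $\mathbb R^d$. P2: $\zeta(x+\mathcal X)=\zeta(\mathcal X)$ for all finite $\mathcal X\subset\mathbb R^d$, $x\in\mathbb R^d$. P3: there is $c_1\in[0,\infty)$ with $\zeta(\mathcal Y\cup\mathcal Z)\le\zeta(\mathcal Y)+\zeta(\mathcal Z)+c_1$ for all disjoint finite $\mathcal Y,\mathcal Z\subset\mathbb R^d$. P4: there is $c_2\in[0,\infty)$ such that for every ordered pair $(\mathcal Y,\mathcal Z)$ of disjoint finite subsets of $\mathbb R^d$, $\zeta(\mathcal Y\cup\mathcal Z)\ge\zeta(\mathcal Y)+\zeta(\mathcal Z)-c_2|\partial_{\mathcal Z}(\mathcal Y)|$, where $\partial_{\mathcal Z}(\mathcal Y)$ is the set of points of $\mathcal Y$ at Euclidean distance at most $1$ from $\mathcal Z$.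 P5: $\lim_{\delta\downarrow0}\sup\{\zeta(\mathcal X)/|\mathcal X|:\mathcal X\subset B_\delta(o),\ \delta^{-1}\le|\mathcal X|<\infty\}=0$. *)

(* Defs.v *)
From HB Require Import structures.
From mathcomp Require Import all_boot all_order all_algebra finmap.
From mathcomp Require Import all_classical all_reals all_analysis.

Set Implicit Arguments.
Unset Strict Implicit.
Unset Printing Implicit Defensive.

Import Order.TTheory GRing.Theory Num.Theory.
Import numFieldNormedType.Exports.

Local Open Scope classical_set_scope.
Local Open Scope ring_scope.

Definition measure_rV_display : measure_display -> measure_display.
Proof. exact. Qed.

(* R^n carries the sigma-algebra generated by the coordinate maps, i.e. the
   Borel one, as the library does for n.-tuple. *)
Section measurable_rV.
Context {d} {T : measurableType d}.
Variable n : nat.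

Let coors : 'I_n -> 'rV[T]_n -> T := fun i x => x ord0 i.

Let rV_set0 : g_sigma_preimage coors set0.
Proof. exact: sigma_algebra0. Qed.

Let rV_setC A : g_sigma_preimage coors A -> g_sigma_preimage coors (~` A).
Proof. exact: sigma_algebraC. Qed.

Let rV_bigcup (F : _^nat) : (forall i, g_sigma_preimage coors (F i)) ->
  g_sigma_preimage coors (\bigcup_i (F i)).
Proof. exact: sigma_algebra_bigcup. Qed.

HB.instance Definition _ := @isMeasurable.Build (measure_rV_display d)
  'rV[T]_n (g_sigma_preimage coors) rV_set0 rV_setC rV_bigcup.

Lemma measurable_coord (i : 'I_n) :
  measurable_fun [set: 'rV[T]_n] (fun x : 'rV[T]_n => x ord0 i).
Proof.
move=> _ Y mY; rewrite setTI; apply: sub_sigma_algebra => /=.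
rewrite -bigcup_seq/=; exists i => /=; first by rewrite mem_index_enum.
by exists Y => //; rewrite setTI.
Qed.

Lemma measurable_fun_rVP d1 (T1 : measurableType d1) (f : T1 -> 'rV[T]_n) :
  (forall i, measurable_fun [set: T1] (fun x => f x ord0 i)) ->
  measurable_fun [set: T1] f.
Proof.
move=> mf _ A mA; rewrite setTI.
have h : g_sigma_preimage coors `<=` [set A | measurable (f @^-1` A)].
  apply: smallest_sub; last first.
    rewrite -bigcup_seq/= => B [i _ [C mC <-]] /=; rewrite setTI.
    by rewrite -[X in measurable X]setTI; exact: mf.
  split => /=.
  - by rewrite preimage_set0; exact: measurable0.
  - by move=> B mB; rewrite setTD preimage_setC; exact: measurableC.
  - by move=> F mF; rewrite preimage_bigcup; exact: bigcup_measurable.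
exact: h.
Qed.

End measurable_rV.

Lemma sigma_finite_prod d1 d2 (T1 : measurableType d1) (T2 : measurableType d2)
  (R : realType) (m1 : {sigma_finite_measure set T1 -> \bar R})
  (m2 : {sigma_finite_measure set T2 -> \bar R}) :
  sigma_finite setT (m1 \x m2)%E.
Proof.
have /sigma_finiteP[F [TF ndF Foo]] := sigma_finiteT m1.
have /sigma_finiteP[G [TG ndG Goo]] := sigma_finiteT m2.
exists (fun n => F n `*` G n).
  rewrite -setXTT TF TG predeqE => -[x y]; split.
    move=> [/= [n _ Fnx] [k _ Gky]]; exists (maxn n k) => //; split.
    - by move: x Fnx; exact/subsetPset/ndF/leq_maxl.
    - by move: y Gky; exact/subsetPset/ndG/leq_maxr.
  by move=> [n _ []/= ? ?]; split; exists n.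
move=> k; have [? ?] := Foo k; have [? ?] := Goo k.
split; first exact: measurableX.
by rewrite product_measure1E// lte_mul_pinfty// ge0_fin_numE.
Qed.

Section lebesgue_rV.
Context {R : realType}.

Definition rV_cons n (p : measurableTypeR R * 'rV[R]_n) : 'rV[R]_n.+1 :=
  \row_i (if unlift ord0 i is Some j then p.2 ord0 j else p.1).

Definition rV_uncons n (x : 'rV[R]_n.+1) : measurableTypeR R * 'rV[R]_n :=
  (x ord0 ord0, \row_j x ord0 (lift ord0 j)).

Lemma rV_consK n : cancel (@rV_cons n) (@rV_uncons n).
Proof.
move=> [a v]; rewrite /rV_uncons /rV_cons !mxE unlift_none /=; congr pair.
by apply/rowP => j; rewrite !mxE liftK.
Qed.

Lemma rV_unconsK n : cancel (@rV_uncons n) (@rV_cons n).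
Proof.
move=> x; apply/rowP => i; rewrite !mxE.
by case: unliftP => [j ->|->] //=; rewrite mxE.
Qed.

Lemma measurable_rV_cons n : measurable_fun setT (@rV_cons n).
Proof.
apply: measurable_fun_rVP => i; rewrite /rV_cons.
case: (unliftP ord0 i) => [j ij|i0].
- rewrite (_ : (fun _ => _) = (fun v : 'rV[R]_n => v ord0 j) \o snd).
    by apply: measurableT_comp; [exact: measurable_coord|exact: measurable_snd].
  by apply/funext => p /=; rewrite mxE ij liftK.
- rewrite (_ : (fun _ => _) = fst); first exact: measurable_fst.
  by apply/funext => p; rewrite mxE i0 unlift_none.
Qed.

Lemma measurable_rV_uncons n : measurable_fun setT (@rV_uncons n).
Proof.
apply: measurable_fun_pair; first exact: measurable_coord.
apply: measurable_fun_rVP => i.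
rewrite (_ : (fun _ => _) = (fun v : 'rV[R]_n.+1 => v ord0 (lift ord0 i))).
  exact: measurable_coord.
by apply/funext => p; rewrite mxE.
Qed.

Section step.
Variables (n : nat) (m : {sigma_finite_measure set 'rV[R]_n -> \bar R}).

Definition lebesgue_rV_step : set 'rV[R]_n.+1 -> \bar R :=
  pushforward (@lebesgue_measure R \x m)%E (@rV_cons n).

Let step0 : lebesgue_rV_step set0 = 0%E.
Proof. by rewrite /lebesgue_rV_step /pushforward preimage_set0 measure0. Qed.

Let step_ge0 A : (0 <= lebesgue_rV_step A)%E.
Proof. by rewrite /lebesgue_rV_step /pushforward; apply: measure_ge0. Qed.

Let step_sigma_additive : semi_sigma_additive lebesgue_rV_step.
Proof.
have := @measure_semi_sigma_additive _ _ _ (pushforward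
  (@lebesgue_measure R \x m)%E (@rV_cons n) : {measure set _ -> \bar R}).
by apply; exact: measurable_rV_cons.
Qed.

HB.instance Definition _ := isMeasure.Build _ _ _ lebesgue_rV_step
  step0 step_ge0 step_sigma_additive.

Let step_sigma_finite : sigma_finite setT lebesgue_rV_step.
Proof.
have [F FT Foo] : sigma_finite setT (@lebesgue_measure R \x m)%E.
  exact: (sigma_finite_prod lebesgue_measure m).
exists (fun k => @rV_uncons n @^-1` F k).
  by rewrite -preimage_bigcup -FT preimage_setT.
move=> k; have [mF Fk] := Foo k; split.
  by rewrite -[X in measurable X]setTI; exact: measurable_rV_uncons.
rewrite /lebesgue_rV_step /pushforward -comp_preimage.
rewrite (_ : _ \o _ = id); first by rewrite preimage_id.
by apply/funext => p; exact: rV_consK.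
Qed.

HB.instance Definition _ := Measure_isSigmaFinite.Build _ _ _ lebesgue_rV_step
  step_sigma_finite.

End step.

(* d-dimensional Lebesgue measure, as the d-fold product of the
   one-dimensional one; its value on boxes is lebesgue_rV_box. *)
Fixpoint lebesgue_rV n : {sigma_finite_measure set 'rV[R]_n -> \bar R} :=
  match n with
  | 0 => dirac (0 : 'rV[R]_0)
  | n'.+1 => lebesgue_rV_step (lebesgue_rV n')
  end.

Lemma lebesgue_rV_box n (a b : 'rV[R]_n) :
  (forall i, a ord0 i <= b ord0 i) ->
  lebesgue_rV n [set x | forall i, a ord0 i <= x ord0 i < b ord0 i] =
  (\prod_(i < n) (b ord0 i - a ord0 i))%:E.
Proof.
elim: n a b => [|n IHn] a b ab.
  rewrite big_ord0 /= diracE mem_set//=; by case.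
rewrite big_ord_recl /= /lebesgue_rV_step /pushforward.
pose tl (x : 'rV[R]_n.+1) : 'rV[R]_n := \row_j x ord0 (lift ord0 j).
set S := (X in (_ \x _)%E X).
have -> : S =
   ([set` `[a ord0 ord0, b ord0 ord0[] : set (measurableTypeR R)) `*`
   [set x : 'rV[R]_n | forall i, tl a ord0 i <= x ord0 i < tl b ord0 i].
  rewrite /S; apply/seteqP; split=> [[x v] /= h|[x v] /= [h1 h2] i].
    split; first by have := h ord0; rewrite in_itv /= /rV_cons mxE unlift_none.
    by move=> i; have := h (lift ord0 i); rewrite /rV_cons !mxE liftK.
  rewrite /rV_cons mxE; case: unliftP => [j ->|->].
    by have := h2 j; rewrite !mxE.
  by move: h1; rewrite in_itv.
rewrite product_measure1E //; last first.
  rewrite (_ : mkset _ = \bigcap_(i in [set: 'I_n])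
     ((fun x : 'rV[R]_n => x ord0 i) @^-1`
       [set` `[tl a ord0 i, tl b ord0 i[])); last first.
    apply/seteqP; split => x /= h i.
      by move=> _; rewrite /= in_itv /= h.
    by have := h i I; rewrite /= in_itv.
  apply: fin_bigcap_measurable => // i _.
  by rewrite -[X in measurable X]setTI; apply: measurable_coord.
rewrite IHn; last by move=> i; rewrite !mxE.
rewrite EFinM; under [in LHS]eq_bigr do rewrite /tl !mxE.
congr (_ * _)%E; rewrite [LHS]lebesgue_measure_itv /= lte_fin.
case: ltP => [_|ba]; first by rewrite EFinB.
have -> : b ord0 ord0 = a ord0 ord0 by apply/eqP; rewrite eq_le ba ab.
by rewrite subrr.
Qed.

End lebesgue_rV.

Section independence.
Context {dO} {Omega : measurableType dO} {R : realType}.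
Variable P : probability Omega R.

Definition sigma_of dT (T : measurableType dT) (Y : Omega -> T)
  : set (set Omega) := preimage_set_system setT Y measurable.

Definition mutually_independent (I : choiceType)
    (F : I -> set (set Omega)) : Prop :=
  forall (J : {fset I}) (A : I -> set Omega),
    (forall i, i \in J -> F i (A i)) ->
    P (\bigcap_(i in [set` J]) A i) = (\prod_(i <- J) P (A i))%E.

Definition independent_systems (F G : set (set Omega)) : Prop :=
  forall A B, F A -> G B -> P (A `&` B) = (P A * P B)%E.

Definition sigma_of_seq dT (T : measurableType dT) (Y : nat -> Omega -> T)
  : set (set Omega) := <<s \bigcup_i sigma_of (Y i) >>.

Definition iid_from dT (T : measurableType dT) (Y : nat -> Omega -> T)
    (mu : probability T R) : Prop :=
  [/\ forall i, measurable_fun setT (Y i),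
      forall i A, measurable A -> P (Y i @^-1` A) = mu A &
      mutually_independent (fun i => sigma_of (Y i))].

(* The mean a may be 0, where the library's poisson_pmf is constantly 1;
   here 0 ^+ 0 = 1 gives the Dirac mass at 0. *)
Definition has_poisson_law (N : Omega -> nat) (a : R) : Prop :=
  measurable_fun setT N /\
  forall k, P (N @^-1` [set k]) = (expR (- a) * a ^+ k / k`!%:R)%:E.

Definition converges_completely (xi : nat -> Omega -> R) (c : R) : Prop :=
  forall e, 0 < e ->
    (\sum_(1 <= n <oo) P [set w | (e < `|xi n w - c|)%R] < +oo)%E.

Definition converges_L2 (xi : nat -> Omega -> R) (c : R) : Prop :=
  ('E_P[fun w => ((xi n w - c) ^+ 2)%R])%E @[n --> \oo] --> 0%E.

End independence.

Section point_processes.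
Context {R : realType} {d : nat}.
Local Notation point := 'rV[R]_d.

Definition euclid_dist (x y : point) : R :=
  Num.sqrt (\sum_i (x ord0 i - y ord0 i) ^+ 2).

Definition cube (s : R) : set point :=
  [set x | forall i, - (s / 2) <= x ord0 i < s / 2].

Definition diffuse (mu : probability point R) : Prop :=
  forall x, mu [set x] = 0%E.

(* f is a version of the density of the absolutely continuous part in the
   Lebesgue decomposition mu = f dx + nu, where nu is singular. *)
Definition is_ac_density (mu : probability point R) (f : point -> R) : Prop :=
  [/\ measurable_fun setT f, forall x, 0 <= f x &
      exists nu : {measure set point -> \bar R},
        (exists S, [/\ measurable S, lebesgue_rV d S = 0%E &
                       nu (~` S) = 0%E]) /\
        forall A, measurable A ->
          mu A = (\int[lebesgue_rV d]_(x in A) (f x)%:E + nu A)%E].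

(* Only meant for B with H w `&` B finite: fset_set is empty otherwise. *)
Definition npoints {T : Type} (H : T -> set point) (B : set point) (w : T)
  : nat := #|` fset_set (H w `&` B)|.

Definition is_homogeneous_poisson dO (Omega : measurableType dO)
    (P : probability Omega R) (lambda : R) (H : Omega -> set point) : Prop :=
  [/\ forall w (B : set point), bounded_set B -> finite_set (H w `&` B),
      forall B : set point, measurable B -> bounded_set B ->
        has_poisson_law P (npoints H B) (lambda * fine (lebesgue_rV d B)) &
      forall m (B : 'I_m -> set point),
        (forall i, measurable (B i) /\ bounded_set (B i)) ->
        trivIset setT B ->
        mutually_independent P (fun i => sigma_of (npoints H (B i)))].

(* {X_1, ..., X_n}, with X_(i+1) encoded as X i. *)
Definition sample {T : Type} (X : nat -> T -> point) (n : nat) (w : T)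
  : {fset point} := [fset X i w | i in iota 0 n]%fset.

End point_processes.

Section functionals.
Context {R : realType} {d : nat}.
Local Notation point := 'rV[R]_d.
Variable zeta : {fset point} -> R.

Definition rescaled (r : R) (X : {fset point}) : R :=
  zeta [fset (r^-1 *: x)%R | x in X]%fset.

Definition tuple_measurable : Prop := forall k : nat,
  measurable_fun [set x : k.-tuple point | uniq x]
    (fun x : k.-tuple point => zeta [fset y in (x : seq point)]%fset).

Definition translation_invariant : Prop :=
  forall (X : {fset point}) (x : point),
  zeta [fset (x + y)%R | y in X]%fset = zeta X.

Definition almost_subadditive : Prop := exists2 c1 : R, 0 <= c1 &
  forall Y Z : {fset point}, [disjoint Y & Z]%fset ->
    zeta (Y `|` Z)%fset <= zeta Y + zeta Z + c1.

Definition boundary_points (Z Y : {fset point}) : {fset point} :=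
  [fset y in Y | has (fun z => (euclid_dist y z <= 1)%R) Z]%fset.

Definition almost_superadditive : Prop := exists2 c2 : R, 0 <= c2 &
  forall Y Z : {fset point}, [disjoint Y & Z]%fset ->
    zeta Y + zeta Z - c2 * #|` boundary_points Z Y|%:R <= zeta (Y `|` Z)%fset.

Definition vanishing_concentration : Prop :=
  ereal_sup [set (zeta X / #|` X|%:R)%:E | X in
      [set X : {fset point} |
        (forall x, x \in X -> euclid_dist x 0 <= delta) /\ delta^-1 <= #|` X|%:R]]
    @[delta --> (0 : R)^'+] --> 0%E.

End functionals.

(* Main.v *)
Require Import Defs.
From HB Require Import structures.
From mathcomp Require Import zify.
From mathcomp Require Import all_boot all_order all_algebra finmap.
From mathcomp Require Import all_classical all_reals all_analysis.
From mathcomp Require Import measurable_realfun ring lra.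

Set Implicit Arguments.
Unset Strict Implicit.
Unset Printing Implicit Defensive.

Import Order.TTheory GRing.Theory Num.Theory.
Import numFieldNormedType.Exports.

Local Open Scope classical_set_scope.
Local Open Scope ring_scope.

(** Write [mean_sample p m n F] for the mean of F over n points, each present with
probability p and then distributed as m. By P3 and P4, adding one point changes
zeta by at most a constant C, so (exponential moments, one point at a time)
[zeta (X_n)] concentrates around its mean exponentially fast, and replacing
[X_n] by the Poisson sample costs at most [C |N_n - n|]; only the limit of
[n^-1 E zeta_r (X_n)] is left. Cut space into cubes of side [s r]. By P3 and P4
zeta is a sum of contributions of cubes, up to one constant per cube and C times
the number of points near the cube boundaries. Where mu is close to [b dx] on a
cube, the sample restricted to it is compared, by exchanging the points one by
one, with n uniform points kept with probability [b (s r)^d], and the binomial to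
Poisson limit gives the mean of zeta over a Poisson process in a cube of side s.
The same decomposition applied to uniform points yields an almost subadditivity
in s, hence rho. The density is approximated in L^1 by a dyadic step function,
while the singular part lives, up to a small mass, on a finite union of dyadic
cubes of small volume: this union is covered by few cubes of side [delta r], on
which P5 bounds zeta by a small multiple of the number of points. *)

(** Two features of the setting shape the proof. The number of cells grows like [n], so errors
    cannot be bounded by a constant per cell. They are carried by one additive error measure [th]: a
    cell costs a constant times [n] times its [th]-mass, which sums to [n] times the total mass
    however fine the cutting. The exchange of points yields exactly this, because one exchange only
    tests increments of zeta, which are bounded by C, whereas zeta is not. The second feature is
    that a homogeneous Poisson process is known only through its counts in disjoint bounded sets, on
    an arbitrary probability space. The law of the configuration in a cube, and even the
    measurability of zeta of it, has to be derived: all orderings of the configuration are counted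
    together, rectangles with disjoint sides reduce to counts, and a monotone class argument does
    the rest. Throughout, zeta is read as a function of lists and a mean is an iterated one-point
    integral. The limit is carried by [lambda * rho lambda], which is Lipschitz on the non-negative
    reals and vanishes at 0. *)

Fixpoint all_measurable {d1 d2} {S : measurableType d1} {T : measurableType d2}
    (ys : seq (S -> T)) : Prop :=
  if ys is y :: ys' then measurable_fun setT y /\ all_measurable ys' else True.

Lemma all_measurable_cat {d1 d2} {S : measurableType d1} {T : measurableType d2}
    (s1 s2 : seq (S -> T)) :
  all_measurable (s1 ++ s2) <-> all_measurable s1 /\ all_measurable s2.
Proof. by elim: s1 => [|y s IH] /=; tauto. Qed.

Lemma all_measurable_comp {d1 d2 d3 d4} {S : measurableType d1}
    {T : measurableType d2} {U : measurableType d3} {V : measurableType d4}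
    (g : T -> U) (h : V -> S)
    (s : seq (S -> T)) : measurable_fun setT g -> measurable_fun setT h ->
  all_measurable s -> all_measurable [seq g \o (y \o h) | y <- s].
Proof.
move=> mg mh; elim: s => [//|y s IH] /= [my /IH ?]; split=> //.
exact: (measurableT_comp mg (measurableT_comp my mh)).
Qed.

(** * Functionals of finite lists: joint measurability and boundedness *)

Section seq_measurable.
Context {R : realType} {d} {T : measurableType d}.
Implicit Types F G : seq T -> R.

(* Joint measurability of F on each power of T, phrased through arbitrary
   measurable coordinates so that no product or tuple structure on T is needed. *)
Definition seq_measurable F : Prop :=
  forall d' (S : measurableType d') (ys : seq (S -> T)), all_measurable ys ->
    measurable_fun setT (fun w => F [seq y w | y <- ys]).

(** The bound may depend on the length because zeta grows linearly in the number of points. On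
    samples of [n] points it makes every integrand in [mean_sample] bounded, hence integrable. *)
Definition admissible F : Prop :=
  seq_measurable F /\
  forall n, exists M : R, forall l, (size l <= n)%N -> `|F l| <= M.

(** The parameter is tested along arbitrary measurable maps [phi], so that a point taken off the
    list can be absorbed into the parameter by replacing [S] with [S * T], as the induction in
    [mean_sample_param] does. *)
Definition jointly_measurable d' (S : measurableType d') (G : S -> seq T -> R) :=
  forall d2 (S' : measurableType d2) (phi : S' -> S) (ys : seq (S' -> T)),
    measurable_fun setT phi -> all_measurable ys ->
    measurable_fun setT (fun w => G (phi w) [seq y w | y <- ys]).

Lemma seq_measurable_prefix F l : seq_measurable F ->
  seq_measurable (fun l' => F (l ++ l')).
Proof.
move=> mF d' S ys mys.
have -> : (fun w => F (l ++ [seq y w | y <- ys])) =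
    fun w => F [seq y w | y <- [seq cst x | x <- l] ++ ys].
  by apply/funext => w; rewrite map_cat -map_comp /comp /= map_id.
apply: mF; apply/all_measurable_cat; split=> //.
by elim: l => //= x l IH; split=> //; exact: measurable_cst.
Qed.

Lemma admissible_cons F x : admissible F -> admissible (fun l => F (x :: l)).
Proof.
move=> [mF bF]; split; first exact: (seq_measurable_prefix [:: x] mF).
by move=> n; have [M hM] := bF n.+1; exists M => l ln; exact: hM.
Qed.

Lemma admissible_cst (c : R) : admissible (fun=> c).
Proof. by split=> [d' S ys _|n]; [exact: measurable_cst|exists `|c|]. Qed.

Lemma admissibleD F G : admissible F -> admissible G ->
  admissible (fun l => F l + G l).
Proof.
move=> [mF bF] [mG bG]; split=> [d' S ys mys|n].
  by apply: measurable_funD; [exact: mF|exact: mG].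
have [M hM] := bF n; have [M' hM'] := bG n; exists (M + M') => l ln.
by rewrite (le_trans (ler_normD _ _))// lerD ?hM ?hM'.
Qed.

Lemma admissibleM F G : admissible F -> admissible G ->
  admissible (fun l => F l * G l).
Proof.
move=> [mF bF] [mG bG]; split=> [d' S ys mys|n].
  by apply: measurable_funM; [exact: mF|exact: mG].
have [M hM] := bF n; have [M' hM'] := bG n; exists (M * M') => l ln.
by rewrite normrM ler_pM ?hM ?hM'.
Qed.

Lemma admissibleZ (c : R) F : admissible F -> admissible (fun l => c * F l).
Proof. exact/admissibleM/admissible_cst. Qed.

Lemma admissibleB F G : admissible F -> admissible G ->
  admissible (fun l => F l - G l).
Proof.
move=> aF aG; have -> : (fun l => F l - G l) = (fun l => F l + (-1) * G l).
  by apply/funext => l; rewrite mulN1r.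
exact/admissibleD/admissibleZ.
Qed.

Lemma admissible_sum (I : Type) (s : seq I) (Fs : I -> seq T -> R) :
  (forall i, admissible (Fs i)) -> admissible (fun l => \sum_(i <- s) Fs i l).
Proof.
move=> aF; elim: s => [|i s IH].
  by under eq_fun do rewrite big_nil; exact: admissible_cst.
by under eq_fun do rewrite big_cons; exact: admissibleD.
Qed.

Lemma admissible_expR F : admissible F -> admissible (fun l => expR (F l)).
Proof.
move=> [mF bF]; split=> [d' S ys mys|n].
  by apply: measurableT_comp; [exact: measurable_expR|exact: mF].
have [M hM] := bF n; exists (expR M) => l ln.
by rewrite ger0_norm ?expR_ge0// ler_expR (le_trans (ler_norm _))// hM.
Qed.

(** The length of the filtered list varies with [w], so no single instance of [seq_measurable]
    applies. The coordinates are decided one at a time, and those that pass [c] are collected in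
    [pre], whose length is fixed on each branch. *)
Lemma seq_measurable_filter F (c : pred T) d' (S : measurableType d')
    (pre ys : seq (S -> T)) : measurable [set x | c x] -> seq_measurable F ->
  all_measurable pre -> all_measurable ys -> measurable_fun setT
    (fun w => F ([seq y w | y <- pre] ++ seq.filter c [seq y w | y <- ys])).
Proof.
move=> mc mF; elim: ys pre => [|y ys IH] /= pre mpre mys.
  by under eq_fun do rewrite cats0; exact: mF.
have -> : (fun w => F ([seq y0 w | y0 <- pre] ++
      (if c (y w) then y w :: [seq x <- [seq y0 w | y0 <- ys] | c x]
       else [seq x <- [seq y0 w | y0 <- ys] | c x]))) =
    fun w => if c (y w)
      then F ([seq y0 w | y0 <- rcons pre y] ++ [seq x <- [seq y0 w | y0 <- ys] | c x])
      else F ([seq y0 w | y0 <- pre] ++ [seq x <- [seq y0 w | y0 <- ys] | c x]).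
  by apply/funext => w; case: (c (y w)) => //; rewrite map_rcons cat_rcons.
case: mys => my mys; apply: measurable_fun_ifT.
- apply: (measurable_fun_bool true) => /=.
  by rewrite setTI (_ : _ @^-1` _ = y @^-1` [set x | c x])// -[X in measurable X]setTI; exact: my.
- by apply: IH => //; rewrite -cats1; apply/all_measurable_cat.
- exact: IH.
Qed.

Lemma admissible_filter F (c : pred T) : measurable [set x | c x] ->
  admissible F -> admissible (fun l => F (seq.filter c l)).
Proof.
move=> mc [mF bF]; split=> [d' S ys mys|n]; last first.
  have [M hM] := bF n; exists M => l ln; apply: hM.
  by rewrite size_filter (leq_trans (count_size _ _)).
exact: (seq_measurable_filter (pre := [::])).
Qed.

Lemma admissible_count (c : pred T) : measurable [set x | c x] ->
  admissible (fun l => (count c l)%:R).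
Proof.
move=> mc; suff aS : admissible (fun l => (size l)%:R : R).
  have := admissible_filter mc aS.
  by under eq_fun do rewrite size_filter.
split=> [d' S ys _|n].
  by under eq_fun do rewrite size_map; exact: measurable_cst.
by exists n%:R => l ln; rewrite ger0_norm// ler_nat.
Qed.

End seq_measurable.

Lemma admissible_map {R : realType} {d d'} {T : measurableType d}
    {U : measurableType d'} (g : U -> T) (F : seq T -> R) :
  measurable_fun setT g -> admissible F -> admissible (fun l => F (map g l)).
Proof.
move=> mg [mF bF]; split=> [d2 S ys mys|n].
  have -> : (fun w => F (map g [seq y w | y <- ys])) =
      fun w => F [seq y w | y <- [seq g \o (y \o id) | y <- ys]].
    by apply/funext => w; rewrite -!map_comp.
  apply: mF; apply: all_measurable_comp => //; exact: measurable_id.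
by have [M hM] := bF n; exists M => l ln; apply: hM; rewrite size_map.
Qed.

(** * Means over samples with independently kept points *)

Section sampling.
Context {R : realType} {d} {T : measurableType d}.
Variables (p : R) (m : probability T R).
Hypothesis p01 : 0 <= p <= 1.
Implicit Types F G : seq T -> R.

(* Mean of F over n independent m-distributed points, each of which is kept
   with probability p. *)
Fixpoint mean_sample (n : nat) F : R :=
  if n is n'.+1 then
    p * (\int[m]_x mean_sample n' (fun l => F (x :: l)))%R
      + (1 - p) * mean_sample n' F
  else F [::].
Local Notation J := mean_sample.

Lemma measurable_Rintegral_param d' (S : measurableType d')
    (h : S * T -> R) : measurable_fun setT h ->
  measurable_fun setT (fun w => \int[m]_x h (w, x)).
Proof.
move=> mh; apply: measurableT_comp; first exact: fine_measurable.
have mh' : measurable_fun setT (EFin \o h) by exact/measurable_EFinP.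
under eq_fun do rewrite integralE.
apply: emeasurable_funB.
- rewrite [X in measurable_fun _ X](_ : _ = fubini_F m (EFin \o h)^\+%E); last first.
    by apply/funext => w; apply: eq_integral => x _; rewrite !funeposE.
  by apply: (@measurable_fun_fubini_tonelli_F _ _ S T R m) => //; exact: measurable_funepos.
- rewrite [X in measurable_fun _ X](_ : _ = fubini_F m (EFin \o h)^\-%E); last first.
    by apply/funext => w; apply: eq_integral => x _; rewrite !funenegE.
  by apply: (@measurable_fun_fubini_tonelli_F _ _ S T R m) => //; exact: measurable_funeneg.
Qed.

(** The induction lets the parameter space vary: the first sampled point joins the parameter, and
    then a single integral against [m] of a function measurable on [S * T] remains. *)
Lemma mean_sample_param n d' (S : measurableType d') (G : S -> seq T -> R) :
  jointly_measurable G -> measurable_fun setT (fun w => J n (G w)).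
Proof.
elim: n d' S G => [|n IH] d' S G mG /=.
  exact: (mG _ S id [::] (@measurable_id _ _ _) I).
apply: measurable_funD; apply: measurable_funM; try exact: measurable_cst; last exact: IH.
apply: (@measurable_Rintegral_param _ S (fun z => J n (fun l => G z.1 (z.2 :: l)))).
apply: (IH _ (S * T)%type (fun z l => G z.1 (z.2 :: l))).
move=> d2 S' phi ys mphi mys.
apply: (mG _ S' (fst \o phi) ((snd \o phi) :: ys)).
  by apply: measurableT_comp => //; exact: measurable_fst.
by split=> //; apply: measurableT_comp => //; exact: measurable_snd.
Qed.

Lemma mean_sample_measurable n F : seq_measurable F ->
  seq_measurable (fun l => J n (fun l' => F (l ++ l'))).
Proof.
move=> mF d' S ys mys.
apply: (mean_sample_param n (G := fun w l => F ([seq y w | y <- ys] ++ l))).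
move=> d2 S' phi ys' mphi mys' /=.
have -> : (fun w => F ([seq y (phi w) | y <- ys] ++ [seq y w | y <- ys'])) =
  fun w => F [seq y w | y <- [seq id \o (y \o phi) | y <- ys] ++ ys'].
  by apply/funext => w; rewrite map_cat -map_comp.
apply: mF; apply/all_measurable_cat; split=> //.
by apply: all_measurable_comp => //; exact: measurable_id.
Qed.

Lemma mean_sample_measurable1 n F : seq_measurable F ->
  measurable_fun setT (fun x => J n (fun l => F (x :: l))).
Proof.
move=> mF; have := mean_sample_measurable n mF (S := T) (ys := [:: id]).
by apply; split=> //; exact: measurable_id.
Qed.

Lemma bounded_integrable (h : T -> R) (D : set T) (M : R) : measurable D ->
  measurable_fun setT h -> (forall x, `|h x| <= M) -> m.-integrable D (EFin \o h).
Proof.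
move=> mD mh hM; apply: measurable_bounded_integrable => //.
- by rewrite (le_lt_trans (probability_le1 _ _))// ltry.
- exact: measurable_funTS.
- by exists M; split; [exact: num_real|move=> x Mx y _; exact: le_trans (hM y) (ltW Mx)].
Qed.

Lemma Rintegral_cstm (c : R) : \int[m]_x c = c.
Proof. by rewrite Rintegral_cst// [X in fine X](@probability_setT _ _ _ m) mulr1. Qed.

Lemma Rintegral_le_cst (h : T -> R) (M : R) :
  measurable_fun setT h -> (forall x, `|h x| <= M) -> `|\int[m]_x h x| <= M.
Proof.
move=> mh hM; have ih := bounded_integrable measurableT mh hM.
rewrite (le_trans (le_normr_Rintegral measurableT ih))//.
rewrite [leRHS](_ : _ = \int[m]_x (cst M x)); last first.
  by rewrite Rintegral_cstm.
apply: le_Rintegral => //.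
- by apply: (@bounded_integrable _ _ M) => //; [exact: measurableT_comp|move=> x; rewrite normr_id].
- by apply: (@bounded_integrable _ _ `|M|) => //; exact: measurable_cst.
Qed.

Let p0 : 0 <= p. Proof. by case/andP: p01. Qed.
Let p1 : 0 <= 1 - p. Proof. by rewrite subr_ge0; case/andP: p01. Qed.

Lemma mean_sample_bound n F M : seq_measurable F ->
  (forall l, (size l <= n)%N -> `|F l| <= M) -> `|J n F| <= M.
Proof.
elim: n F => [|n IH] F mF hM /=; first exact: hM.
rewrite (le_trans (ler_normD _ _))// !normrM (ger0_norm p0) (ger0_norm p1).
rewrite [leRHS](_ : _ = p * M + (1 - p) * M); last by ring.
rewrite lerD// ler_wpM2l//.
- apply: Rintegral_le_cst; first exact: mean_sample_measurable1.
  move=> x; apply: IH; first exact: (seq_measurable_prefix [:: x] mF).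
  by move=> l ln; exact: hM.
- by apply: IH => // l ln; apply: hM; rewrite (leq_trans ln).
Qed.

Lemma mean_sample_integrable n F : admissible F ->
  m.-integrable setT (EFin \o (fun x => J n (fun l => F (x :: l)))).
Proof.
move=> [mF bF]; have [M hM] := bF n.+1.
apply: (@bounded_integrable _ _ M) => //; first exact: mean_sample_measurable1.
move=> x; apply: mean_sample_bound; first exact: (seq_measurable_prefix [:: x] mF).
by move=> l ln; exact: hM.
Qed.

Lemma le_mean_sample n F G : admissible F -> admissible G ->
  (forall l, (size l <= n)%N -> F l <= G l) -> J n F <= J n G.
Proof.
elim: n F G => [|n IH] F G aF aG FG /=; first exact: FG.
rewrite lerD// ler_wpM2l//.
- apply: le_Rintegral => //; try exact: mean_sample_integrable.
  move=> x _; apply: IH; try exact: admissible_cons.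
  by move=> l ln; exact: FG.
- by apply: IH => // l ln; apply: FG; rewrite (leq_trans ln).
Qed.

Lemma mean_sampleD n F G : admissible F -> admissible G ->
  J n (fun l => F l + G l) = J n F + J n G.
Proof.
elim: n F G => [//|n IH] F G aF aG /=.
rewrite (IH _ _ aF aG).
under eq_Rintegral do rewrite (IH _ _ (admissible_cons _ aF) (admissible_cons _ aG)).
rewrite RintegralD//; try exact: mean_sample_integrable.
ring.
Qed.

Lemma mean_sampleZ n (c : R) F : admissible F ->
  J n (fun l => c * F l) = c * J n F.
Proof.
elim: n F => [//|n IH] F aF /=.
rewrite (IH _ aF).
under eq_Rintegral do rewrite (IH _ (admissible_cons _ aF)).
rewrite RintegralZl//; try exact: mean_sample_integrable.
ring.
Qed.

Lemma mean_sampleB n F G : admissible F -> admissible G ->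
  J n (fun l => F l - G l) = J n F - J n G.
Proof.
move=> aF aG; have -> : (fun l => F l - G l) = (fun l => F l + (-1) * G l).
  by apply/funext => l; rewrite mulN1r.
by rewrite mean_sampleD ?mean_sampleZ ?mulN1r//; exact: admissibleZ.
Qed.

Lemma mean_sample_cst n (c : R) : J n (fun=> c) = c.
Proof.
elim: n => [//|n IH] /=; rewrite IH Rintegral_cstm; ring.
Qed.

Lemma mean_sample_sum n (I : Type) (s : seq I) (Fs : I -> seq T -> R) :
  (forall i, admissible (Fs i)) ->
  J n (fun l => \sum_(i <- s) Fs i l) = \sum_(i <- s) J n (Fs i).
Proof.
move=> aF; elim: s => [|i s IH].
  rewrite big_nil -[RHS](mean_sample_cst n 0); congr J; apply/funext => l.
  by rewrite big_nil.
rewrite big_cons -IH -mean_sampleD//; last exact: admissible_sum.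
by congr J; apply/funext => l; rewrite big_cons.
Qed.


Lemma mean_sample_count n (c : pred T) : measurable [set x | c x] ->
  J n (fun l => (count c l)%:R) = n%:R * p * fine (m [set x | c x]).
Proof.
move=> mc; elim: n => [|n IH] /=; first by rewrite !mul0r.
have aC := @admissible_count R _ _ _ mc.
have e x : J n (fun l => (c x + count c l)%:R) = \1_[set x | c x] x + n%:R * p * fine (m [set x | c x]).
  have -> : (fun l => (c x + count c l)%:R : R) = fun l => (c x)%:R + (count c l)%:R.
    by apply/funext => l; rewrite natrD.
  rewrite mean_sampleD//; last exact: admissible_cst.
  rewrite mean_sample_cst IH indicE.
  by have -> : (x \in [set x | c x]) = c x by apply/idP/idP => [/set_mem|/mem_set].
under eq_Rintegral do rewrite e.
rewrite RintegralD//; last 2 first.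
- by apply: (@bounded_integrable _ _ 1) => // x; rewrite indicE normr_nat lern1 leq_b1.
- by apply: (@bounded_integrable _ _ `|n%:R * p * fine (m [set x | c x])|) => //; exact: measurable_cst.
rewrite Rintegral_cstm /Rintegral integral_indic// setIT IH.
rewrite -(natr1 n); ring.
Qed.

End sampling.

Section lipschitz.
Context {R : realType} {d} {T : measurableType d}.
Implicit Types F : seq T -> R.

(** Insertion is allowed at any position, not only at the head, so that the property passes to
    [fun l => F (x :: l)], the shape that every induction on the sample size produces. *)
Definition insertion_lipschitz (C : R) F : Prop :=
  forall l1 x l2, `|F (l1 ++ x :: l2) - F (l1 ++ l2)| <= C.

Lemma insertion_lipschitz_cons C F x :
  insertion_lipschitz C F -> insertion_lipschitz C (fun l => F (x :: l)).
Proof. by move=> lF l1 y l2; have := lF (x :: l1) y l2. Qed.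


Lemma insertion_lipschitz_size C F l : insertion_lipschitz C F ->
  `|F l - F [::]| <= C * (size l)%:R.
Proof.
move=> lF; elim: l => [|x l IH] /=; first by rewrite subrr normr0 mulr0.
rewrite -(natr1 (size l)) mulrDr mulr1 [leRHS]addrC.
rewrite (_ : F (x :: l) - _ = (F (x :: l) - F l) + (F l - F [::])); last by ring.
by rewrite (le_trans (ler_normD _ _))// lerD//; exact: (lF [::]).
Qed.

Lemma lipschitz_admissible C F : 0 <= C -> seq_measurable F ->
  insertion_lipschitz C F -> admissible F.
Proof.
move=> C0 mF lF; split=> // n; exists (C * n%:R + `|F [::]|) => l ln.
rewrite (_ : F l = (F l - F [::]) + F [::]); last by ring.
rewrite (le_trans (ler_normD _ _))// lerD// (le_trans (insertion_lipschitz_size _ lF))//.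
by rewrite ler_wpM2l// ler_nat.
Qed.


Lemma mean_sample_dist p (m : probability T R) n C F G : 0 <= p <= 1 ->
  admissible F -> admissible G ->
  (forall l, (size l <= n)%N -> `|F l - G l| <= C) ->
  `|mean_sample p m n F - mean_sample p m n G| <= C.
Proof.
move=> p01 aF aG FG; rewrite -mean_sampleB//.
by apply: mean_sample_bound => //; have [] := admissibleB aF aG.
Qed.


End lipschitz.

Lemma insertion_lipschitz_map {R : realType} {d d'} {T : measurableType d}
    {U : measurableType d'} (C : R) (F : seq T -> R) (g : U -> T) :
  insertion_lipschitz C F -> insertion_lipschitz C (fun l => F (map g l)).
Proof. by move=> lF l1 x l2; rewrite !map_cat /=; exact: lF. Qed.

Section mean_sample_comparison.
Context {R : realType} {d d'} {T : measurableType d} {U : measurableType d'}.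
Variables (p1 p2 : R) (m : probability T R) (u : probability U R).
Variables (c : pred T) (g : U -> T) (C K : R).
Hypotheses (p1_01 : 0 <= p1 <= 1) (p2_01 : 0 <= p2 <= 1).
Hypotheses (mc : measurable [set x | c x]) (mg : measurable_fun setT g).
Hypothesis close : forall h : T -> R, measurable_fun setT h ->
  (forall x, `|h x| <= C) ->
  `|p1 * (\int[m]_(x in [set x | c x]) h x)%R - p2 * (\int[u]_y h (g y))%R| <= K.

(** A hybrid argument: the samples are exchanged one point at a time, at cost K each. One exchange
    tests the mean increment [B x - b0] of [F] due to one further point, which is bounded by C
    whatever the size of [F]; hence [close] only concerns functions bounded by C. *)
Lemma mean_sample_compare n (F : seq T -> R) :
  admissible F -> insertion_lipschitz C F ->
  `|mean_sample p1 m n (fun l => F (seq.filter c l)) -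
    mean_sample p2 u n (fun l => F (map g l))| <= n%:R * K.
Proof.
elim: n F => [|n IH] F aF lF /=; first by rewrite subrr normr0 mul0r.
pose a x := mean_sample p1 m n (fun l => F (x :: seq.filter c l)).
pose B x := mean_sample p2 u n (fun l => F (x :: map g l)).
set a0 := mean_sample p1 m n (fun l => F (seq.filter c l)).
set b0 := mean_sample p2 u n (fun l => F (map g l)).
have aFf : admissible (fun l => F (seq.filter c l)) by exact: admissible_filter.
have aFm : admissible (fun l => F (map g l)) by exact: admissible_map.
have ma : measurable_fun setT a.
  apply: (mean_sample_param _ _ _ (G := fun x l => F (x :: seq.filter c l))).
  move=> d2 S' phi ys mphi mys.
  by apply: (seq_measurable_filter (pre := [:: phi])) => //; case: aF.
have mB : measurable_fun setT B.
  apply: (mean_sample_param _ _ _ (G := fun x l => F (x :: map g l))).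
  move=> d2 S' phi ys mphi mys.
  have -> : (fun w => F (phi w :: [seq g i | i <- [seq y w | y <- ys]])) =
      fun w => F [seq y w | y <- phi :: [seq g \o (y \o id) | y <- ys]].
    by apply/funext => w /=; rewrite -!map_comp.
  by case: aF => mF _; apply: mF; split=> //; apply: all_measurable_comp => //; exact: measurable_id.
have ha x : `|a x - a0| <= C.
  apply: mean_sample_dist => // [|l _]; last exact: (lF [::]).
  exact: (admissible_filter mc (admissible_cons x aF)).
have hB x : `|B x - b0| <= C.
  apply: mean_sample_dist => // [|l _]; last exact: (lF [::]).
  exact: (admissible_map mg (admissible_cons x aF)).
have maB : measurable_fun setT (fun x => a x - B x) := measurable_funB ma mB.
have mBb : measurable_fun setT (fun x => B x - b0) := measurable_funB mB (measurable_cst b0).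
have haB x : `|a x - B x| <= n%:R * K.
  exact: (IH _ (admissible_cons x aF) (insertion_lipschitz_cons x lF)).
have hab0 : `|a0 - b0| <= n%:R * K by exact: IH.
have nK0 : 0 <= n%:R * K by exact: le_trans (normr_ge0 _) hab0.
have mC : measurable (~` [set x | c x]) by exact: measurableC.
have ib (h : T -> R) (D : set T) M := @bounded_integrable R _ T m h D M.
have ba x : `|a x| <= C + `|a0|.
  by rewrite (_ : a x = (a x - a0) + a0); [rewrite (le_trans (ler_normD _ _))// lerD|ring].
have bB x : `|B x| <= C + `|b0|.
  by rewrite (_ : B x = (B x - b0) + b0); [rewrite (le_trans (ler_normD _ _))// lerD|ring].
have mcst (r : R) (D : set T) : measurable D -> m.-integrable D (EFin \o cst r).
  by move=> mD; apply: (ib _ _ `|r|) => //; exact: measurable_cst.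
set mu_c := fine (m [set x | c x]).
have mu_c01 : 0 <= mu_c <= 1.
  rewrite fine_ge0//= -lee_fin fineK ?fin_num_measure//; exact: probability_le1.
have eA : \int[m]_x mean_sample p1 m n (fun l => F (seq.filter c (x :: l))) =
    \int[m]_(x in [set x | c x]) a x + a0 * (1 - mu_c).
  have -> : \int[m]_x mean_sample p1 m n (fun l => F (seq.filter c (x :: l))) =
      \int[m]_x (if c x then a x else a0).
    by apply: eq_Rintegral => x _ /=; rewrite /a /a0; case: (c x).
  rewrite -(setUv [set x | c x]) Rintegral_setU//; last 2 first.
  - rewrite setUv; apply: (ib _ _ (C + `|a0|)) => //.
      by apply: measurable_fun_ifT => //; apply: (measurable_fun_bool true); rewrite setTI.
    move=> x; case: (c x) => //; rewrite lerDr.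
    exact: le_trans (normr_ge0 _) (ha x).
  - by apply/disj_setPS => x [].
  congr (_ + _).
    by apply: eq_Rintegral => x; rewrite inE /= => ->.
  transitivity (\int[m]_(x in ~` [set x | c x]) cst a0 x).
    by apply: eq_Rintegral => x; rewrite inE /= => /negP/negbTE ->.
  by rewrite Rintegral_cst// [X in fine X](@probability_setC _ _ _ m)// fineB// fin_num_measure.
have eB : \int[u]_y mean_sample p2 u n (fun l => F (map g (y :: l))) = \int[u]_y B (g y) by [].
rewrite eA eB.
have e1 : \int[m]_(x in [set x | c x]) a x =
    \int[m]_(x in [set x | c x]) (a x - B x) + \int[m]_(x in [set x | c x]) B x.
  rewrite -RintegralD//; last 2 first.
  - exact: (ib _ _ (n%:R * K)).
  - exact: (ib _ _ (C + `|b0|)).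
  by apply: eq_Rintegral => x _; ring.
have e2 : \int[m]_(x in [set x | c x]) B x =
    \int[m]_(x in [set x | c x]) (B x - b0) + b0 * mu_c.
  rewrite -(@Rintegral_cst _ _ _ m [set x | c x])// -RintegralD//; last 2 first.
  - exact: (ib _ _ C).
  - exact: mcst.
  by apply: eq_Rintegral => x _; ring.
have e3 : \int[u]_y B (g y) = \int[u]_y (B (g y) - b0) + b0.
  have eb : \int[u]_y (cst b0 y) = b0 by rewrite Rintegral_cst// [X in fine X](@probability_setT _ _ _ u) mulr1.
  rewrite -[X in _ = _ + X]eb -RintegralD//; last 2 first.
  - apply: (@bounded_integrable _ _ _ u _ _ C) => //.
    exact: (measurableT_comp (f := fun x => B x - b0) (g := g)).
  - by apply: (@bounded_integrable _ _ _ u _ _ `|b0|) => //; exact: measurable_cst.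
  by apply: eq_Rintegral => y _ /=; ring.
rewrite e1 e2 e3.
set D := \int[m]_(x in [set x | c x]) (a x - B x).
set I1 := \int[m]_(x in [set x | c x]) (B x - b0).
set I2 := \int[u]_y (B (g y) - b0).
have hD : `|D| <= n%:R * K * mu_c.
  rewrite (le_trans (le_normr_Rintegral _ _))//; first by exact: (ib _ _ (n%:R * K)).
  rewrite -Rintegral_cst//; apply: le_Rintegral => //; last exact: mcst.
  apply: (ib _ _ (n%:R * K)) => //; last by move=> x; rewrite normr_id.
  exact: measurableT_comp.
have hI : `|p1 * I1 - p2 * I2| <= K by exact: (close mBb hB).
(* The two differences covered by the induction hypothesis carry the weights [p1 * mu_c] and
   [1 - p1 * mu_c], which sum to 1, so [n * K] is not amplified. The last bracket is the exchange of
   the current point and adds one K. *)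
rewrite (_ : _ - _ = p1 * D + (1 - p1 * mu_c) * (a0 - b0) + (p1 * I1 - p2 * I2)); last by rewrite /= -/a0 -/b0; ring.
case/andP: p1_01 => p10 p11; case/andP: mu_c01 => mu0 mu1.
have q0 : 0 <= 1 - p1 * mu_c by rewrite subr_ge0 -[leRHS]mulr1 ler_pM.
rewrite -natr1 (_ : (n%:R + 1) * K = n%:R * K + K); last by ring.
rewrite (le_trans (ler_normD _ _))// lerD//.
rewrite (le_trans (ler_normD _ _))// !normrM (ger0_norm p10) (ger0_norm q0).
rewrite [leRHS](_ : _ = p1 * (n%:R * K * mu_c) + (1 - p1 * mu_c) * (n%:R * K)); last by ring.
by rewrite lerD// ler_wpM2l.
Qed.
End mean_sample_comparison.

Section binomial_mixture.
Context {R : realType} {d} {T : measurableType d}.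
Variables (p : R) (m : probability T R).
Hypothesis p01 : 0 <= p <= 1.

Definition binomial_weight (n : nat) (p : R) (k : nat) : R :=
  'C(n, k)%:R * p ^+ k * (1 - p) ^+ (n - k).

Lemma binomial_weightS n k : binomial_weight n.+1 p k.+1 =
  p * binomial_weight n p k + (1 - p) * binomial_weight n p k.+1.
Proof.
rewrite /binomial_weight binS natrD subSS; have [kn|nk] := ltnP k n.
  by rewrite -(subnSK kn) !exprS; ring.
by rewrite (bin_small (_ : n < k.+1)%N)// (exprS _ k); ring.
Qed.

(** Conditioning on the number of kept points: given that there are [k] of them, they are
    independent with law [m]. The induction is Pascal's rule, in the form [binomial_weightS]. *)
Lemma mean_sample_binomial n (F : seq T -> R) : admissible F ->
  mean_sample p m n F =
  \sum_(k < n.+1) binomial_weight n p k * mean_sample 1 m k F.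
Proof.
have o01 : 0 <= (1 : R) <= 1 by rewrite lexx ler01.
elim: n F => [|n IH] F aF; first by rewrite big_ord1 /binomial_weight /= bin0 !expr0 !mul1r.
rewrite [LHS]/= (IH F aF).
under eq_Rintegral do rewrite (IH _ (admissible_cons _ aF)).
have ii k : m.-integrable setT (EFin \o (fun x => mean_sample 1 m k (fun l => F (x :: l)))).
  exact: mean_sample_integrable.
have -> : \int[m]_x (\sum_(k < n.+1) binomial_weight n p k * mean_sample 1 m k (fun l => F (x :: l))) =
    \sum_(k < n.+1) binomial_weight n p k * mean_sample 1 m k.+1 F.
  elim: n.+1 => [|j IHj].
    under eq_Rintegral do rewrite big_ord0.
    by rewrite big_ord0 Rintegral_cst// mul0r.
  rewrite big_ord_recr/= -IHj.
  under eq_Rintegral do rewrite big_ord_recr/=.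
  rewrite RintegralD//.
  - by rewrite RintegralZl// mul1r subrr mul0r addr0.
  - rewrite (_ : _ \o _ = fun x => (\sum_(i < j) ((binomial_weight n p i)%:E * (mean_sample 1 m i (fun l => F (x :: l)))%:E))%E); last first.
      by apply/funext => x /=; rewrite -sumEFin; apply: eq_bigr => i _; rewrite EFinM.
    by apply: integrable_sum => // i _; exact: (integrableZl measurableT (binomial_weight n p i) (ii i)).
  - by have := integrableZl measurableT (binomial_weight n p j) (ii j); apply: eq_integrable => // x _; rewrite /= EFinM.
rewrite [RHS]big_ord_recl [X in _ = _ + X](eq_bigr (fun k : 'I_n.+1 =>
   p * (binomial_weight n p k * mean_sample 1 m k.+1 F) +
   (1 - p) * (binomial_weight n p k.+1 * mean_sample 1 m k.+1 F))); last first.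
  by move=> k _; rewrite !lift0 binomial_weightS; ring.
rewrite big_split/= -!mulr_sumr.
have e : \sum_(k < n.+1) binomial_weight n p k.+1 * mean_sample 1 m k.+1 F =
    \sum_(k < n) binomial_weight n p k.+1 * mean_sample 1 m k.+1 F.
  by rewrite big_ord_recr/= {2}/binomial_weight bin_small// !mul0r addr0.
rewrite e [X in _ + (1 - p) * X = _]big_ord_recl /=.
have b0 : binomial_weight n.+1 p 0 = (1 - p) * binomial_weight n p 0.
  by rewrite /binomial_weight !bin0 !subn0 (exprS _ n); ring.
by rewrite b0; ring.
Qed.

End binomial_mixture.

(** * Exponential concentration around the mean *)

Section concentration.
Context {R : realType}.

(** Inverting [1 - y <= expR (- y)] gives [expR y <= 1 / (1 - y)]. The quadratic dominates this,
    since after multiplication by [1 - y] the difference is [y ^ 2 * (1 - 2 * y)]. *)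
Lemma expR_le_quadratic (y : R) : `|y| <= 2^-1 -> expR y <= 1 + y + 2 * y ^+ 2.
Proof.
move=> yh; have /andP[y1 y2] : - 2^-1 <= y <= 2^-1 by rewrite -ler_norml.
have e1 : 1 - y <= expR (- y) by have := expR_ge1Dx (- y).
have e2 : expR y * expR (- y) = 1 by rewrite -expRD subrr expR0.
have e0 := expR_gt0 y.
have h1 : expR y * (1 - y) <= 1 by rewrite -[leRHS]e2 ler_pM2l.
have h2 : 1 <= (1 + y + 2 * y ^+ 2) * (1 - y).
  rewrite -subr_ge0 (_ : _ - _ = y ^+ 2 * (1 - 2 * y)); last by ring.
  by rewrite mulr_ge0 ?sqr_ge0//; lra.
have h3 : 0 < 1 - y by lra.
by rewrite -(ler_pM2r h3) (le_trans h1).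
Qed.

Context {d} {T : measurableType d}.
Variable m : probability T R.

(** The method of bounded differences. Given the first point [x], the mean is [G x], within [2 * C]
    of the total mean. In the quadratic bound for the exponential the linear term integrates to 0,
    so each point contributes a factor [1 + q <= expR q] with [q = 2 * (|sigma| * (2 * C)) ^ 2]. *)
Lemma mean_sample_expR n (C sigma : R) (F : seq T -> R) : 0 <= C ->
  admissible F -> insertion_lipschitz C F -> `|sigma| * (2 * C) <= 2^-1 ->
  mean_sample 1 m n (fun l => expR (sigma * (F l - mean_sample 1 m n F))) <=
  expR (n%:R * (8 * sigma ^+ 2 * C ^+ 2)).
Proof.
move=> C0 + + sC.
have o01 : 0 <= (1 : R) <= 1 by rewrite lexx ler01.
elim: n F => [|n IH] F aF lF; first by rewrite /= subrr mulr0 mul0r expR0.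
set q := 8 * sigma ^+ 2 * C ^+ 2.
pose G x := mean_sample 1 m n (fun l => F (x :: l)).
pose g := mean_sample 1 m n.+1 F.
have eg : g = \int[m]_x G x by rewrite /g /= mul1r subrr mul0r addr0.
have aE (c : R) (F' : seq T -> R) : admissible F' -> admissible (fun l => expR (sigma * (F' l - c))).
  by move=> aF'; exact/admissible_expR/admissibleZ/admissibleB/admissible_cst.
have mG : measurable_fun setT G by apply: mean_sample_measurable1; case: aF.
have iG : m.-integrable setT (EFin \o G) by exact: mean_sample_integrable.
have icst (c : R) : m.-integrable setT (EFin \o cst c).
  by apply: (@bounded_integrable _ _ _ m _ _ `|c|) => //; exact: measurable_cst.
have Icst := Rintegral_cstm m.
have Gg x : `|G x - g| <= 2 * C.
  have GG y : `|G x - G y| <= 2 * C.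
    apply: mean_sample_dist => //; try exact: admissible_cons.
    move=> l _; rewrite (_ : _ - _ = (F (x :: l) - F l) - (F (y :: l) - F l)); last by ring.
    rewrite (le_trans (ler_normB _ _))// (_ : 2 * C = C + C); last by ring.
    by rewrite lerD//; exact: (lF [::]).
  have mGx : measurable_fun setT (fun y => G x - G y) by apply: measurable_funB => //; exact: measurable_cst.
  rewrite (_ : G x - g = \int[m]_y (G x - G y)); last by rewrite RintegralB//; [rewrite Icst eg|exact: icst].
  exact: Rintegral_le_cst.
have key x : mean_sample 1 m n (fun l => expR (sigma * (F (x :: l) - g))) <=
    expR (n%:R * q) * (1 + sigma * (G x - g) + q).
  rewrite (_ : mean_sample _ _ _ _ = mean_sample 1 m n
     (fun l => expR (sigma * (G x - g)) * expR (sigma * (F (x :: l) - G x)))); last first.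
    by congr mean_sample; apply/funext => l; rewrite -expRD; congr expR; ring.
  rewrite mean_sampleZ//; last exact/aE/admissible_cons.
  rewrite mulrC ler_pM ?expR_ge0//.
  - rewrite -(mean_sample_cst 1 m n 0); apply: le_mean_sample => //.
    + exact: admissible_cst.
    + exact/aE/admissible_cons.
  - exact: (IH _ (admissible_cons x aF) (insertion_lipschitz_cons x lF)).
  - have b : `|sigma * (G x - g)| <= `|sigma| * (2 * C) by rewrite normrM ler_wpM2l.
    rewrite (le_trans (expR_le_quadratic (le_trans b sC)))// lerD2l.
    rewrite /q (_ : 8 * _ * _ = 2 * (`|sigma| * (2 * C)) ^+ 2); last first.
      by rewrite exprMn real_normK ?num_real//; ring.
    rewrite ler_wpM2l// -[leLHS]real_normK ?num_real//.
    by rewrite lerXn2r// nnegrE mulr_ge0// mulr_ge0.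
rewrite -/g [leLHS]/= mul1r subrr mul0r addr0.
have iL : m.-integrable setT (EFin \o (fun x => mean_sample 1 m n (fun l => expR (sigma * (F (x :: l) - g))))).
  exact: (@mean_sample_integrable _ _ _ 1 m o01 n (fun l => expR (sigma * (F l - g))) (aE g _ aF)).
have iGg : m.-integrable setT (EFin \o (fun x => G x - g)).
  apply: (@bounded_integrable _ _ _ m _ _ (2 * C)) => //.
  by apply: measurable_funB => //; exact: measurable_cst.
have isGg : m.-integrable setT (EFin \o (fun x => sigma * (G x - g))).
  by have := integrableZl measurableT sigma iGg; apply: eq_integrable => // x _; rewrite /= EFinM.
have i1 : m.-integrable setT (EFin \o (fun x => (1 + q) + sigma * (G x - g))).
  by have := integrableD measurableT (icst (1 + q)) isGg; apply: eq_integrable.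
have i2 : m.-integrable setT (EFin \o (fun x => expR (n%:R * q) * ((1 + q) + sigma * (G x - g)))).
  by have := integrableZl measurableT (expR (n%:R * q)) i1; apply: eq_integrable => // x _; rewrite /= EFinM.
apply: (@le_trans _ _ (\int[m]_x (expR (n%:R * q) * ((1 + q) + sigma * (G x - g))))).
  apply: le_Rintegral => // x _; rewrite (le_trans (key x))//.
  by rewrite (_ : 1 + sigma * (G x - g) + q = 1 + q + sigma * (G x - g))//; ring.
rewrite RintegralZl// RintegralD//; last exact: icst.
rewrite RintegralZl// RintegralB//; last exact: icst.
rewrite !Icst -eg subrr mulr0 addr0.
by rewrite -natr1 (_ : (n%:R + 1) * q = n%:R * q + q) ?expRD; [rewrite ler_wpM2l ?expR_ge0// expR_ge1Dx|ring].
Qed.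

End concentration.

(** * Laws of tuples and of i.i.d. samples *)

Section tuple_measure_unique.
Context {R : realType} {d} {T : measurableType d} {n : nat}.

Lemma measurable_rectangle (A : 'I_n -> set T) : (forall i, measurable (A i)) ->
  measurable [set t : n.-tuple T | forall i, A i (tnth t i)].
Proof.
move=> mA; rewrite (_ : mkset _ = \bigcap_(i in [set: 'I_n])
  ((fun t : n.-tuple T => tnth t i) @^-1` A i)); last first.
  by apply/seteqP; split => t /= h i => [_|]; [exact: h|exact: (h i I)].
apply: fin_bigcap_measurable => // i _.
by rewrite -[X in measurable X]setTI; exact: (measurable_tnth i).
Qed.

Lemma tuple_measure_unique (m1 m2 : {finite_measure set (n.-tuple T) -> \bar R}) :
  (forall A : 'I_n -> set T, (forall i, measurable (A i)) ->
    m1 [set t | forall i, A i (tnth t i)] = m2 [set t | forall i, A i (tnth t i)]) ->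
  forall B, measurable B -> m1 B = m2 B.
Proof.
move=> m12 B mB.
pose G := [set [set t : n.-tuple T | forall i, A i (tnth t i)] |
  A in [set A : 'I_n -> set T | forall i, measurable (A i)]].
have GT : G setT by exists (fun=> setT) => //; apply/seteqP; split.
apply: (measure_unique G (fun=> setT)) => //.
- apply/seteqP; split.
  + apply: smallest_sub; first exact: smallest_sigma_algebra.
    rewrite -bigcup_seq/= => C [i _ [A mA <-]]; apply: sub_sigma_algebra.
    exists (fun j => if j == i then A else setT); first by move=> j; case: ifP.
    apply/seteqP; split => t /=; first by move/(_ i); rewrite eqxx.
    by move=> [_ At] j; case: eqP => [->|].
  + apply: smallest_sub; first exact: sigma_algebra_measurable.
    by move=> _ [A mA <-]; exact: measurable_rectangle.
- move=> _ _ [A1 mA1 <-] [A2 mA2 <-]; exists (fun i => A1 i `&` A2 i).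
    by move=> i; exact: measurableI.
  apply/seteqP; split => t /=; first by move=> h; split => i; case: (h i).
  by move=> [h1 h2] i.
- by rewrite bigcup_const//; exists 0%N.
- by move=> _ [A mA <-]; exact: m12.
- by move=> _; rewrite ltey_eq fin_num_measure.
Qed.

End tuple_measure_unique.

Section prod_tuple.
Context {R : realType} {d} {T : measurableType d}.
Variable m : probability T R.

Definition pair_cons n (z : T * n.-tuple T) : n.+1.-tuple T := [tuple of z.1 :: z.2].

Lemma measurable_pair_cons n : measurable_fun setT (@pair_cons n).
Proof. exact: (measurable_cons measurable_fst measurable_snd). Qed.

Section step.
Variables (n : nat) (q : probability (n.-tuple T) R).

Definition prod_tuple_step : set (n.+1.-tuple T) -> \bar R :=
  pushforward (m \x q)%E (@pair_cons n).

Let step0 : prod_tuple_step set0 = 0%E.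
Proof. by rewrite /prod_tuple_step /pushforward preimage_set0 measure0. Qed.

Let step_ge0 A : (0 <= prod_tuple_step A)%E.
Proof. by rewrite /prod_tuple_step /pushforward; apply: measure_ge0. Qed.

Let step_sigma_additive : semi_sigma_additive prod_tuple_step.
Proof.
have := @measure_semi_sigma_additive _ _ _ (pushforward
  (m \x q)%E (@pair_cons n) : {measure set _ -> \bar R}).
by apply; exact: measurable_pair_cons.
Qed.

HB.instance Definition _ := isMeasure.Build _ _ _ prod_tuple_step
  step0 step_ge0 step_sigma_additive.

Let step_setT : prod_tuple_step setT = 1%E.
Proof.
rewrite /prod_tuple_step /pushforward preimage_setT -setXTT product_measure1E//.
by rewrite [X in (X * _)%E](@probability_setT _ _ _ m) [X in (_ * X)%E](@probability_setT _ _ _ q) mule1.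
Qed.

HB.instance Definition _ := Measure_isProbability.Build _ _ _ prod_tuple_step step_setT.
End step.

Fixpoint prod_tuple n : probability (n.-tuple T) R :=
  match n with
  | 0 => dirac [tuple]
  | n'.+1 => prod_tuple_step (prod_tuple n')
  end.

Lemma prod_tuple_rectangle n (A : 'I_n -> set T) : (forall i, measurable (A i)) ->
  prod_tuple n [set t | forall i, A i (tnth t i)] = (\prod_(i < n) m (A i))%E.
Proof.
elim: n A => [|n IH] A mA.
  by rewrite big_ord0 /= diracE mem_set//=; case.
rewrite big_ord_recl /= /prod_tuple_step /pushforward.
rewrite (_ : _ @^-1` _ = A ord0 `*` [set t : n.-tuple T | forall i, A (lift ord0 i) (tnth t i)]); last first.
  apply/seteqP; split => -[x t] /=.
    by move=> h; split=> [|i]; [have := h ord0|have := h (lift ord0 i); rewrite tnthS].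
  by move=> [h0 h] i; case: (unliftP ord0 i) => [j ->|->]; rewrite ?tnthS ?tnth0.
rewrite product_measure1E//; last first.
  exact: (measurable_rectangle (A := fun i => A (lift ord0 i))).
by congr (_ * _)%E; exact: (IH (fun i => A (lift ord0 i))).
Qed.

Lemma measurable_fun_tuple k (F : seq T -> R) : seq_measurable F ->
  measurable_fun setT (fun t : k.-tuple T => F t).
Proof.
move=> mF; rewrite (_ : (fun t => _) = (fun t : k.-tuple T =>
    F [seq y t | y <- [seq (fun t => tnth t i) | i <- enum 'I_k]])).
  by apply: mF; elim: (enum 'I_k) => //= i s IHs; split=> //; exact: measurable_tnth.
by apply/funext => t; congr F; rewrite -map_comp; exact/esym/map_tnth_enum.
Qed.

Lemma integral_prod_tuple n (F : seq T -> R) : admissible F ->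
  (\int[prod_tuple n]_t (F t)%:E)%E = (mean_sample 1 m n F)%:E.
Proof.
have o01 : 0 <= (1 : R) <= 1 by rewrite lexx ler01.
have mt k F' (aF' : admissible F') := @measurable_fun_tuple k F' aF'.1.
elim: n F => [|n IH] F aF.
  rewrite /= integral_dirac//; last by apply/measurable_EFinP; exact: (mt 0%N F aF).
  by rewrite diracT mul1e.
have mc : measurable_fun setT (@pair_cons n) by exact: measurable_pair_cons.
have mE : measurable_fun setT (fun t : n.+1.-tuple T => (F t)%:E) by apply/measurable_EFinP; exact: (mt n.+1 F aF).
have iF : (m \x prod_tuple n)%E.-integrable setT ((fun t : n.+1.-tuple T => (F t)%:E) \o @pair_cons n).
  have [_ /(_ n.+1)[M hM]] := aF.
  apply: (@bounded_integrable _ _ _ (m \x prod_tuple n)%E (fun z => F (pair_cons z)) _ M) => //.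
    exact: (measurableT_comp (mt n.+1 F aF) mc).
  by move=> z; apply: hM; rewrite size_tuple.
rewrite [LHS]/= (integral_pushforward mc)//.
rewrite preimage_setT -integral12_prod_meas1// /fubini_F /=.
under eq_integral => x _ do rewrite (IH _ (admissible_cons x aF)).
rewrite mul1r subrr mul0r addr0 /Rintegral fineK//.
by apply: integrable_fin_num => //; exact: mean_sample_integrable.
Qed.

End prod_tuple.

Section iid_mean.
Context {R : realType} {d} {T : measurableType d}.
Context {dO} {Omega : measurableType dO}.
Variables (P : probability Omega R) (mu : probability T R) (X : nat -> Omega -> T).
Hypothesis X_iid : iid_from P X mu.

Lemma measurable_iid i : measurable_fun setT (X i).
Proof. by case: X_iid. Qed.

Lemma all_measurable_iid n : all_measurable [seq X i | i <- iota 0 n].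
Proof.
by elim: (iota 0 n) => //= i s IH; split=> //; exact: measurable_iid.
Qed.

Lemma measurable_fun_iid n (F : seq T -> R) : seq_measurable F ->
  measurable_fun setT (fun w => F [seq X i w | i <- iota 0 n]).
Proof.
move=> mF; under eq_fun do rewrite (map_comp (fun Y => Y _) X).
by apply: mF; exact: all_measurable_iid.
Qed.

Definition iid_tuple n (w : Omega) : n.-tuple T := [tuple X i w | i < n].

Lemma measurable_iid_tuple n : measurable_fun setT (@iid_tuple n).
Proof.
apply/measurable_fun_tnthP => i.
rewrite (_ : _ \o _ = X i); first exact: measurable_iid.
by apply/funext => w /=; rewrite tnth_mktuple.
Qed.

(** By independence the law of the first [n] points and the product law agree on rectangles, hence
    everywhere. Means over the given probability space thus become [mean_sample] with every point
    kept. *)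
Lemma iid_mean n (F : seq T -> R) : admissible F ->
  (\int[P]_w (F [seq X i w | i <- iota 0 n])%:E)%E = (mean_sample 1 mu n F)%:E.
Proof.
move=> aF; have [mX lX iX] := X_iid.
have mt := @measurable_iid_tuple n.
pose Y : {mfun Omega >-> n.-tuple T} := HB.pack (@iid_tuple n) (isMeasurableFun.Build _ _ _ _ _ mt).
have YE w : Y w = [seq X i w | i <- iota 0 n] :> seq T.
  by rewrite /= -val_enum_ord -map_comp.
have dE B : measurable B -> prod_tuple mu n B = distribution P Y B.
  apply: tuple_measure_unique => A mA; rewrite [LHS](prod_tuple_rectangle mu mA).
  rewrite /distribution /pushforward.
  (* Independence speaks of families indexed by all of [nat], so the sides of the rectangle are
     extended by the full space beyond the first [n] indices. *)
  have := iX [fset i in iota 0 n]%fset (fun i => X i @^-1` (if insub i is Some j then A j else setT)).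
  rewrite (_ : \bigcap_(i in _) _ = Y @^-1` [set t | forall i, A i (tnth t i)]); last first.
    apply/seteqP; split => w /= h.
      move=> i; have := h i; rewrite /= in_fset mem_iota/= ltn_ord => /(_ isT).
      by rewrite tnth_mktuple valK.
    move=> i; rewrite /= in_fset mem_iota/= => li.
    by rewrite insubT/=; have := h (Ordinal li); rewrite tnth_mktuple.
  move=> h; refine (etrans _ (esym (h _))); last first.
    move=> i; rewrite in_fset mem_iota/= => li; rewrite insubT/=.
    by exists (A (Ordinal li)) => //; rewrite setTI.
  rewrite (perm_big (iota 0 n)); last first.
    apply: uniq_perm; [exact: fset_uniq|exact: iota_uniq|].
    by move=> i; rewrite in_fset.
  rewrite -[in iota 0 n](subn0 n) big_mkord; apply: eq_bigr => i _.
  by rewrite valK lX.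
rewrite -integral_prod_tuple//.
rewrite (eq_measure_integral (distribution P Y)); last by move=> A mA _; exact: dE.
rewrite integral_distribution//.
- by apply: eq_integral => w _ /=; rewrite -YE.
- by apply/measurable_EFinP; apply: measurable_fun_tuple; case: aF.
- have [mF /(_ n)[M hM]] := aF.
  apply: (@bounded_integrable _ _ _ P (fun w => F (Y w)) _ M) => //.
    rewrite (_ : (fun w => F (Y w)) = fun w => F [seq X i w | i <- iota 0 n]).
      exact: measurable_fun_iid.
    by apply/funext => w; rewrite YE.
  by move=> w; apply: (hM (Y w)); rewrite size_tuple.
Qed.

Lemma iid_upper_tail n (C sigma e : R) (F : seq T -> R) : 0 <= C ->
  admissible F -> insertion_lipschitz C F -> `|sigma| * (2 * C) <= 2^-1 ->
  (P [set w | e < sigma * (F [seq X i w | i <- iota 0 n] - mean_sample 1 mu n F)]%R <=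
  (expR (n%:R * (8 * sigma ^+ 2 * C ^+ 2) - e))%:E)%E.
Proof.
move=> C0 aF lF sC; set g := mean_sample 1 mu n F.
have o01 : 0 <= (1 : R) <= 1 by rewrite lexx ler01.
pose G l := expR (sigma * (F l - g) - e).
have aG : admissible G.
  by apply/admissible_expR/admissibleB/admissible_cst/admissibleZ/admissibleB/admissible_cst.
have mG : measurable_fun setT (fun w => G [seq X i w | i <- iota 0 n]).
  by apply: measurable_fun_iid; case: aG.
have mS : measurable [set w | e < sigma * (F [seq X i w | i <- iota 0 n] - g)].
  rewrite -[X in measurable X]setTI; apply: measurable_fun_ltr => //.
  apply: measurable_funM => //; apply: measurable_funB => //.
  by apply: measurable_fun_iid; case: aF.
apply: (@le_trans _ _ (\int[P]_w (G [seq X i w | i <- iota 0 n])%:E)%E).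
  rewrite -(setIT [set w | _]) -integral_indic//; apply: ge0_le_integral => //.
  - exact/measurable_EFinP.
  - exact/measurable_EFinP.
  - move=> w _; rewrite lee_fin indicE; case: (boolP (_ \in _)) => [|_]; last by rewrite expR_ge0.
    by rewrite inE /= => h; rewrite -expR0 ler_expR subr_ge0 ltW.
rewrite iid_mean// lee_fin.
rewrite (_ : mean_sample 1 mu n G = expR (- e) * mean_sample 1 mu n (fun l => expR (sigma * (F l - g)))).
  by rewrite addrC expRD ler_wpM2l ?expR_ge0// mean_sample_expR.
rewrite -mean_sampleZ//; last exact/admissible_expR/admissibleZ/admissibleB/admissible_cst.
by congr mean_sample; apply/funext => l; rewrite -expRD addrC.
Qed.

(** The rate [a] depends on neither [n] nor [F]. This uniformity matters because the functional
    changes with [n] through the scale [r n]. *)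
Lemma iid_concentration (C e : R) : 0 <= C -> 0 < e ->
  exists a : R, 0 <= a < 1 /\ forall n (F : seq T -> R), admissible F ->
    insertion_lipschitz C F ->
    (P [set w | (n%:R * e < `|F [seq X i w | i <- iota 0 n] - mean_sample 1 mu n F|)%R] <=
      (2 * a ^+ n)%:E)%E.
Proof.
move=> C0 e0; pose c := C + 1.
have c0 : 0 < c by rewrite ltr_wpDl.
(* The first bound is the smallness asked for by [mean_sample_expR]; the second keeps the quadratic
   term below half of the linear one, which leaves the rate [s * e / 2]. Using [c = C + 1] avoids a
   division by zero. *)
pose s := Num.min (4 * c)^-1 (e / (16 * c ^+ 2)).
have s0 : 0 < s by rewrite lt_min invr_gt0 divr_gt0 ?mulr_gt0 ?exprn_gt0.
have sC : s * (2 * C) <= 2^-1.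
  have : s <= (4 * c)^-1 by rewrite ge_min lexx.
  move=> h; rewrite (@le_trans _ _ ((4 * c)^-1 * (2 * c)))//.
    by rewrite ler_pM ?mulr_ge0// ?(ltW s0)// ler_wpM2l// lerDl.
  by rewrite (_ : (4 * c)^-1 * (2 * c) = 2^-1)//; field; rewrite gt_eqF.
have q : 8 * s ^+ 2 * C ^+ 2 <= s * e / 2.
  have h : s <= e / (16 * c ^+ 2) by rewrite ge_min lexx orbT.
  have h2 : s * (16 * c ^+ 2) <= e by rewrite -ler_pdivlMr// mulr_gt0// exprn_gt0.
  have h3 : C ^+ 2 <= c ^+ 2 by rewrite lerXn2r// ?nnegrE ?(ltW c0)// lerDl.
  have h4 : s * (16 * C ^+ 2) <= e by apply: le_trans h2; rewrite ler_pM2l// ler_pM2l.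
  have : s * (s * (16 * C ^+ 2)) <= s * e by rewrite ler_pM2l.
  by lra.
exists (expR (- (s * e / 2))); split.
  by rewrite expR_ge0/= expR_lt1 oppr_lt0 !mulr_gt0.
move=> n F aF lF; set D := fun w => F [seq X i w | i <- iota 0 n] - mean_sample 1 mu n F.
have mD : measurable_fun setT D.
  by apply: measurable_funB => //; apply: measurable_fun_iid; case: aF.
have tail sg : `|sg| = s ->
    (P [set w | (s * (n%:R * e) < sg * D w)%R] <= (expR (- (s * e / 2)) ^+ n)%:E)%E.
  move=> sgs; apply: (le_trans (iid_upper_tail n (s * (n%:R * e)) C0 aF lF _)); first by rewrite sgs.
  rewrite lee_fin -expRM_natl ler_expR.
  have -> : sg ^+ 2 = s ^+ 2 by rewrite -sgs real_normK// num_real.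
  have : n%:R * (8 * s ^+ 2 * C ^+ 2) <= n%:R * (s * e / 2) by rewrite ler_wpM2l.
  by rewrite -mulr_natl; lra.
have mS sg : measurable [set w | s * (n%:R * e) < sg * D w].
  rewrite -[X in measurable X]setTI; apply: measurable_fun_ltr => //.
  exact: measurable_funM.
have sub : [set w | n%:R * e < `|D w|] `<=` [set w | s * (n%:R * e) < s * D w] `|` [set w | s * (n%:R * e) < - s * D w].
  move=> w /=; rewrite ltr_normr => /orP[h|h]; [left|right].
    by rewrite ltr_pM2l.
  by rewrite mulNr -mulrN ltr_pM2l.
have mN : measurable [set w | n%:R * e < `|D w|].
  rewrite -[X in measurable X]setTI; apply: measurable_fun_ltr => //.
  exact: measurableT_comp.
apply: le_trans.
  apply: (@le_measure _ _ _ P) sub; rewrite inE//; exact: measurableU.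
apply: (le_trans (measureU2 P (mS s) (mS (- s)))) => //.
rewrite mulrDl !mul1r EFinD leeD// tail ?normrN ?gtr0_norm//.
Qed.

End iid_mean.

(** * Zeta as a functional of lists of points *)

Section rV_measurability.
Context {R : realType} {d : nat}.
Local Notation point := 'rV[R]_d.

Lemma measurable_rV_affine (a : point) (k : R) :
  measurable_fun [set: point] (fun x : point => a + k *: x).
Proof.
apply: measurable_fun_rVP => i; under eq_fun do rewrite !mxE.
apply: measurable_funD => //; apply: measurable_funM => //; exact: measurable_coord.
Qed.

Lemma measurable_rV_scale (k : R) : measurable_fun [set: point] (fun x : point => k *: x).
Proof. by have := measurable_rV_affine 0 k; under eq_fun do rewrite add0r. Qed.

Lemma measurable_rV_eq {d'} {S : measurableType d'} (y z : S -> point) :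
  measurable_fun setT y -> measurable_fun setT z -> measurable [set w | y w = z w].
Proof.
move=> my mz; rewrite (_ : mkset _ = \bigcap_(i in [set: 'I_d])
   [set w | y w ord0 i == z w ord0 i]); last first.
  apply/seteqP; split => w /=; first by move=> yz i _; rewrite /= yz.
  by move=> h; apply/rowP => i; apply/eqP; exact: (h i I).
apply: fin_bigcap_measurable => // i _.
rewrite -[X in measurable X]setTI; apply: measurable_fun_eqr => //.
- exact: (measurableT_comp (measurable_coord i) my).
- exact: (measurableT_comp (measurable_coord i) mz).
Qed.

Lemma measurable_rV_mem {d'} {S : measurableType d'} (y : S -> point) (ys : seq (S -> point)) :
  measurable_fun setT y -> all_measurable ys ->
  measurable [set w | y w \in [seq z w | z <- ys]].
Proof.
move=> my; elim: ys => [|z ys IH] /= h.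
  by rewrite (_ : mkset _ = set0)//; apply/seteqP; split.
rewrite (_ : mkset _ = [set w | y w = z w] `|` [set w | y w \in [seq z w | z <- ys]]).
  by case: h => mz mys; apply: measurableU; [exact: measurable_rV_eq|exact: IH].
apply/seteqP; split => w /=; first by rewrite in_cons => /orP[/eqP|]; [left|right].
by move=> [yz|yz]; rewrite in_cons yz ?eqxx ?orbT.
Qed.

Lemma measurable_rV_uniq {d'} {S : measurableType d'} (ys : seq (S -> point)) :
  all_measurable ys -> measurable [set w | uniq [seq z w | z <- ys]].
Proof.
elim: ys => [|z ys IH] /= h; first by rewrite (_ : mkset _ = setT)//; apply/seteqP; split.
case: h => mz mys.
rewrite (_ : mkset _ = ~` [set w | z w \in [seq z w | z <- ys]] `&` [set w | uniq [seq z w | z <- ys]]).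
  by apply: measurableI; [exact/measurableC/measurable_rV_mem|exact: IH].
by apply/seteqP; split => w /=; [move=> /andP[/negP]|move=> [/negP -> ->]].
Qed.

End rV_measurability.

Lemma euclid_dist_scale {R : realType} {d : nat} (k : R) (x y : 'rV[R]_d) : 0 <= k ->
  euclid_dist (k *: x) (k *: y) = k * euclid_dist x y.
Proof.
move=> k0; rewrite /euclid_dist.
under eq_bigr do rewrite !mxE -mulrBr exprMn.
by rewrite -mulr_sumr sqrtrM ?sqr_ge0// sqrtr_sqr ger0_norm.
Qed.

Section functional.
Context {R : realType} {d : nat}.
Local Notation point := 'rV[R]_d.
Variable zeta : {fset point} -> R.
Hypotheses (zeta_ge0 : forall Y, 0 <= zeta Y) (zeta_set0 : zeta fset0 = 0).
Hypotheses (zetaP1 : tuple_measurable zeta) (zetaP2 : translation_invariant zeta).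

Definition zeta_seq (r : R) (l : seq point) : R :=
  zeta [fset y in [seq r^-1 *: x | x <- l]]%fset.

Lemma zeta_seq_rescaled {T : Type} (X : nat -> T -> point) r n w :
  rescaled zeta r (sample X n w) = zeta_seq r [seq X i w | i <- iota 0 n].
Proof.
congr zeta; apply/fsetP => y; rewrite in_fset.
apply/imfsetP/mapP => /=.
  move=> [x /imfsetP[/= i hi ->] ->]; exists (X i w) => //.
  by apply/mapP; exists i.
move=> [x /mapP[i hi ->] ->]; exists (X i w) => //.
by apply/imfsetP; exists i.
Qed.

(** P1 speaks only of distinct points, while a list may repeat some. Coordinates are examined one by
    one: where one repeats an earlier one it is dropped, which leaves the set unchanged; elsewhere
    it joins [pre], whose coordinates are pairwise distinct on the domain considered. *)
Lemma seq_measurable_fset : seq_measurable (fun l => zeta [fset y in l]%fset).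
Proof.
move=> d' S ys mys.
suff h pre : all_measurable pre -> measurable_fun [set w | uniq [seq y w | y <- pre]]
    (fun w => zeta [fset y in [seq y w | y <- pre] ++ [seq y w | y <- ys]]%fset).
  have := h [::] I; rewrite (_ : mkset _ = setT) //.
  by apply/seteqP; split.
elim: ys mys pre => [|y ys IH] /= mys pre mpre.
  have [k hk] : exists k, size pre = k by exists (size pre).
  have st w : size [seq y w | y <- pre] == k by rewrite size_map hk.
  rewrite (_ : (fun w => _) = (fun x : k.-tuple point => zeta [fset y in (x : seq point)]%fset)
     \o (fun w => Tuple (st w))); last by apply/funext => w /=; rewrite cats0.
  apply: (measurable_comp (F := [set x : k.-tuple point | uniq x])).
  - have := @measurable_rV_uniq R d _ (k.-tuple point) [seq (fun t => tnth t i) | i <- enum 'I_k].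
    rewrite (_ : [set w | uniq [seq z w | z <- [seq (tnth (T:=point))^~ i | i <- enum 'I_k]]] = [set x | uniq x]).
      by apply; elim: (enum 'I_k) => //= i s IHs; split=> //; exact: measurable_tnth.
    by apply/seteqP; split => t /=; rewrite -map_comp (_ : [seq _ i | i <- enum 'I_k] = t)//; exact: map_tnth_enum.
  - by move=> _ [w /= h <-].
  - exact: zetaP1.
  - apply: measurable_funTS; apply/measurable_fun_tnthP => i.
    have y0 : S -> point by move: (leq_ltn_trans (leq0n _) (ltn_ord i)); rewrite -hk; case: (pre).
    rewrite (_ : _ \o _ = nth y0 pre i).
      have : (i < size pre)%N by rewrite hk.
      move: (nat_of_ord i) => j {i st hk}.
      by elim: pre mpre j => [//|z pre IHp] /= [mz mpre] [|j] //=; exact: IHp.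
    by apply/funext => w /=; rewrite (tnth_nth (y0 w))/= (nth_map y0)// hk.
case: mys => my mys.
set D := [set w | _].
have e : D = (D `&` [set w | y w \in [seq z w | z <- pre]]) `|`
    [set w | uniq [seq z w | z <- rcons pre y]].
  apply/seteqP; split => w /=; rewrite map_rcons rcons_uniq.
    by move=> u; case: (boolP (y w \in _)) => yw; [left|right; rewrite u].
  by case=> [[]//|/andP[]].
have mD : measurable D by exact: measurable_rV_uniq.
have mpre' : all_measurable (rcons pre y) by rewrite -cats1; apply/all_measurable_cat.
rewrite e; apply/measurable_funU.
- by apply: measurableI => //; exact: measurable_rV_mem.
- exact: measurable_rV_uniq.
split.
- apply: (@eq_measurable_fun _ _ _ _ _ (fun w => zeta [fset y in [seq y w | y <- pre] ++ [seq y w | y <- ys]]%fset)).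
    move=> w; rewrite inE /= => -[_ yw]; congr zeta; apply/fsetP => z.
    rewrite !in_fset !mem_cat in_cons.
    by case: eqP => [->|//]; rewrite yw.
  by apply: measurable_funS (IH mys pre mpre) => //; exact: subIsetl.
- have := IH mys (rcons pre y) mpre'.
  by apply: eq_measurable_fun => w _; rewrite map_rcons cat_rcons.
Qed.

Lemma zeta_set1 (x : point) : zeta [fset x]%fset = zeta [fset (0 : point)]%fset.
Proof.
rewrite -(zetaP2 [fset (0 : point)]%fset x); congr zeta; apply/fsetP => y.
rewrite in_fset1; apply/eqP/imfsetP => [->|/= [z]].
  by exists 0; rewrite ?in_fset1// addr0.
by rewrite in_fset1 => /eqP -> ->; rewrite addr0.
Qed.

Variables (c1 c2 : R).
Hypotheses (c1_ge0 : 0 <= c1) (c2_ge0 : 0 <= c2).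
Hypothesis sub : forall Y Z : {fset point}, [disjoint Y & Z]%fset ->
    zeta (Y `|` Z)%fset <= zeta Y + zeta Z + c1.
Hypothesis sup : forall Y Z : {fset point}, [disjoint Y & Z]%fset ->
    zeta Y + zeta Z - c2 * #|` boundary_points Z Y|%:R <= zeta (Y `|` Z)%fset.

(** A further point raises zeta by at most the value of a singleton plus c1, by P3, and lowers it by
    at most c2, by P4. *)
Definition zeta_lip := zeta [fset (0 : point)]%fset + c1 + c2.
Local Notation C := zeta_lip.

Lemma zeta_lip_ge0 : 0 <= C.
Proof. by rewrite !addr_ge0. Qed.

(** In P4 the singleton is taken as the first set, so its boundary has at most one point; with the
    roles exchanged the loss would involve every point of [A] near [x]. *)
Lemma zeta_add1 (x : point) (A : {fset point}) :
  `|zeta (x |` A)%fset - zeta A| <= C.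
Proof.
have [xA|xA] := boolP (x \in A).
  by rewrite (_ : (x |` A)%fset = A) ?subrr ?normr0 ?zeta_lip_ge0//; apply/fsetUidPr; rewrite fsub1set.
have dj : [disjoint [fset x] & A]%fset by rewrite fdisjoint1X.
have := sub dj; have := sup dj; rewrite zeta_set1.
have hb : (#|` boundary_points A [fset x]%fset| <= 1)%N.
  have := @fsubset_leq_card _ (boundary_points A [fset x]%fset) [fset x]%fset.
  rewrite cardfs1; apply; apply/fsubsetP => y.
  by rewrite !inE => /andP[].
have hc : c2 * #|` boundary_points A [fset x]%fset|%:R <= c2.
  by rewrite -[leRHS]mulr1 ler_wpM2l// lern1.
have z0 := zeta_ge0 [fset (0 : point)]%fset.
move=> h1 h2; move: c1_ge0 c2_ge0 => c10 c20.
by rewrite ler_norml /C; apply/andP; split; lra.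
Qed.

Lemma insertion_lipschitz_fset : insertion_lipschitz C (fun l => zeta [fset y in l]%fset).
Proof.
move=> l1 x l2; rewrite (_ : [fset y in l1 ++ x :: l2]%fset = (x |` [fset y in l1 ++ l2])%fset).
  exact: zeta_add1.
by apply/fsetP => y; rewrite in_fsetU in_fset1 !in_fset !mem_cat in_cons orbCA.
Qed.

Lemma admissible_zeta_seq r : admissible (zeta_seq r).
Proof.
exact: (admissible_map (F := fun l => zeta [fset y in l]%fset) (measurable_rV_scale r^-1)
  (lipschitz_admissible zeta_lip_ge0 seq_measurable_fset insertion_lipschitz_fset)).
Qed.

Lemma insertion_lipschitz_zeta_seq r : insertion_lipschitz C (zeta_seq r).
Proof.
exact: (insertion_lipschitz_map (F := fun l => zeta [fset y in l]%fset)
  (fun x : point => r^-1 *: x) insertion_lipschitz_fset).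
Qed.

Lemma zeta_seq_ge0 r l : 0 <= zeta_seq r l. Proof. exact: zeta_ge0. Qed.

Lemma zeta_seq_nil r : zeta_seq r [::] = 0.
Proof. by rewrite /zeta_seq /= (_ : [fset y in [::]]%fset = fset0)//; apply/fsetP => y; rewrite in_fset. Qed.

Lemma zeta_seq_size r l : zeta_seq r l <= C * (size l)%:R.
Proof.
have := insertion_lipschitz_size l (insertion_lipschitz_zeta_seq r).
by rewrite zeta_seq_nil subr0 ger0_norm// zeta_seq_ge0.
Qed.

Section split.
Variables (r : R) (r_gt0 : 0 < r).
Implicit Types (c : pred point) (l : seq point).

Let half c l : {fset point} := [fset y in [seq r^-1 *: x | x <- l & c x]]%fset.

Let half_disj c l : [disjoint half c l & half (predC c) l]%fset.
Proof.
apply/fdisjointP => y; rewrite !in_fset => /mapP[x + ->].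
rewrite mem_filter => /andP[cx _]; apply/negP => /mapP[z].
rewrite mem_filter => /andP[/= ncz _] /scalerI xz.
by move: ncz; rewrite -xz ?cx// invr_eq0 gt_eqF.
Qed.

Let half_cup c l : [fset y in [seq r^-1 *: x | x <- l]]%fset = (half c l `|` half (predC c) l)%fset.
Proof.
apply/fsetP => y; rewrite in_fsetU !in_fset -mem_cat -map_cat.
by apply/mapP/mapP => -[x hx ->]; exists x => //; move: hx;
   rewrite mem_cat !mem_filter /=; case: (c x) => //=; rewrite ?orbF ?orbT.
Qed.

Lemma zeta_seq_split_le c l :
  zeta_seq r l <= zeta_seq r (seq.filter c l) + c1 + zeta_seq r (seq.filter (predC c) l).
Proof. by rewrite {1}/zeta_seq (half_cup c) addrAC; exact/sub/half_disj. Qed.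

(** P4 with the points in [c] as first set. The predicate [b] marks a boundary layer: a point of [c]
    outside it is farther than [r] from all points outside [c], hence farther than 1 after
    rescaling. The count runs over the list with repetitions and so bounds the cardinality. *)
Lemma zeta_seq_split_ge c (b : pred point) l :
  (forall x y, c x -> ~~ b x -> ~~ c y -> r < euclid_dist x y) ->
  zeta_seq r (seq.filter c l) - c2 * (count (predI b c) l)%:R + zeta_seq r (seq.filter (predC c) l) <=
  zeta_seq r l.
Proof.
move=> cb; rewrite [leRHS]/zeta_seq (half_cup c) addrAC.
apply: le_trans (sup (half_disj c l)).
rewrite lerD2l lerN2 ler_wpM2l// ler_nat.
rewrite -size_filter -[X in (_ <= X)%N](size_map (fun x => r^-1 *: x)).
apply: uniq_leq_size; first exact: fset_uniq.
move=> y; rewrite !inE => /andP[/mapP[x + ->]].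
rewrite mem_filter => /andP[cx xl] /hasP[z].
rewrite in_fset => /mapP[v + ->]; rewrite mem_filter => /andP[/= ncv vl] dv.
apply/mapP; exists x => //; rewrite mem_filter /= cx xl !andbT.
apply: contraT => nb; have := cb _ _ cx nb ncv; rewrite ltNge => /negP; elim.
move: dv; rewrite euclid_dist_scale; last by rewrite invr_ge0 ltW.
by rewrite mulrC ler_pdivrMr// mul1r.
Qed.

Section family.
Variables (I : eqType) (c b : I -> pred point).
Hypothesis c_disj : forall i j x, c i x -> c j x -> i = j.

Let filter_filter i (s : seq I) l : i \notin s ->
  {in s, forall j, seq.filter (c j) (seq.filter (predC (c i)) l) = seq.filter (c j) l}.
Proof.
move=> is_ j js; rewrite -filter_predI; apply: eq_filter => x /=.
case: (boolP (c j x)) => //= cj; apply/negP => ci.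
by move: is_; rewrite (c_disj ci cj) js.
Qed.

(** P3 is applied one cell at a time, at cost c1 each; whatever lies in no cell is bounded by C per
    point. *)
Lemma zeta_seq_family_le (s : seq I) l : uniq s ->
  zeta_seq r l <= \sum_(i <- s) (zeta_seq r (seq.filter (c i) l) + c1) +
    C * (count (fun x => ~~ has (c^~ x) s) l)%:R.
Proof.
elim: s l => [|i s IH] l /=.
  move=> _; rewrite big_nil add0r (_ : count _ _ = size l); first exact: zeta_seq_size.
  exact: count_predT.
move=> /andP[is_ us]; rewrite big_cons -addrA (le_trans (zeta_seq_split_le (c i) l))// lerD2l.
apply: le_trans (IH _ us) _; rewrite lerD//.
  rewrite [leLHS]big_seq [leRHS]big_seq; apply: ler_sum => j js.
  by rewrite (filter_filter _ is_).
rewrite ler_wpM2l ?zeta_lip_ge0// ler_nat -size_filter -filter_predI size_filter.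
by rewrite (eq_count (a2 := fun x => ~~ (c i x || has (c^~ x) s)))// => x /=; rewrite negb_or andbC.
Qed.

(** Removing earlier cells can only lower the boundary counts of the later ones, and the points left
    over at the end are dropped by positivity of zeta. *)
Lemma zeta_seq_family_ge (s : seq I) l : uniq s ->
  (forall i x y, c i x -> ~~ b i x -> ~~ c i y -> r < euclid_dist x y) ->
  \sum_(i <- s) (zeta_seq r (seq.filter (c i) l) - c2 * (count (predI (b i) (c i)) l)%:R) <=
  zeta_seq r l.
Proof.
move=> us cb; elim: s l us => [|i s IH] l /=; first by rewrite big_nil zeta_seq_ge0.
move=> /andP[is_ us]; rewrite big_cons.
apply: le_trans (zeta_seq_split_ge l (cb i)); rewrite lerD2l.
apply: le_trans (IH _ us); rewrite [leLHS]big_seq [leRHS]big_seq; apply: ler_sum => j js.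
rewrite (filter_filter _ is_)// lerD2l lerN2 ler_wpM2l// ler_nat count_filter.
by apply: sub_count => x /= /andP[].
Qed.

End family.
End split.

(** Translated to the origin and rescaled, the cube fits in the ball of radius given by P5, which
    bounds zeta by [eta] per point once there are enough points. Fewer points are worth at most C
    each, and this is the constant M. *)
Lemma zeta_seq_concentrated (eta : R) : vanishing_concentration zeta -> 0 < eta ->
  exists delta M : R, [/\ 0 < delta, 0 <= M &
    forall (r : R) (a : point) (l : seq point), 0 < r ->
      (forall x, x \in l -> forall i, a ord0 i <= x ord0 i <= a ord0 i + r * delta) ->
      zeta_seq r l <= eta * (size l)%:R + M].
Proof.
move=> zetaP5 eta0.
have [delta [delta0 hdelta]] : exists delta : R, 0 < delta /\
    (ereal_sup [set (zeta X / #|` X|%:R)%:E | X in [set X : {fset point} |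
        (forall x, x \in X -> (euclid_dist x 0 <= delta)%R) /\ (delta^-1 <= #|` X|%:R)%R]] < eta%:E)%E.
  have h1 : \forall delta \near (0 : R)^'+, 0 < delta by exact: nbhs_right_gt.
  have h2 : \forall delta \near (0 : R)^'+,
    (ereal_sup [set (zeta X / #|` X|%:R)%:E | X in [set X : {fset point} |
        (forall x, x \in X -> (euclid_dist x 0 <= delta)%R) /\ (delta^-1 <= #|` X|%:R)%R]] < eta%:E)%E.
    apply: (zetaP5 [set u | (u < eta%:E)%E]); apply: open_nbhs_nbhs; split; last by rewrite /= lte_fin.
    exact: open_ereal_lt_ereal.
  have [delta h] := filter_ex (filterI h1 h2); by exists delta.
(* The side [delta / (d + 1)] puts the cube in the ball of radius [delta] because
   [d <= (d + 1) ^ 2]. P5 asks for at least [delta^-1] points, whence the second constant. *)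
exists (delta / d.+1%:R), (C * delta^-1); split.
- by rewrite divr_gt0.
- by rewrite mulr_ge0 ?zeta_lip_ge0// invr_ge0 ltW.
move=> r a l r0 la.
set X := [fset (r^-1 *: (- a) + y)%R | y in [fset y in [seq r^-1 *: x | x <- l]]]%fset.
have zX : zeta_seq r l = zeta X by rewrite /X zetaP2.
have X_size : (#|` X| <= size l)%N.
  rewrite (leq_trans (leq_imfset_card _ _ _))//= -(size_map (fun x => r^-1 *: x) l).
  by apply: uniq_leq_size; [exact: fset_uniq|move=> y; rewrite in_fset].
have zX_le : zeta X <= C * #|` X|%:R.
  have := insertion_lipschitz_size (enum_fset X) insertion_lipschitz_fset.
  rewrite (_ : [fset y in [::]]%fset = fset0) ?zeta_set0; last by apply/fsetP => y; rewrite in_fset.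
  rewrite subr0 ger0_norm//.
  suff e (s : seq point) : s = enum_fset X -> [fset y in s]%fset = X by rewrite (e _ erefl).
  by move=> ->; apply/fsetP => y; rewrite in_fset.
rewrite zX; have [Xl|lX] := leP (delta^-1) (#|` X|%:R : R); last first.
  rewrite (le_trans zX_le)//; apply: ler_wpDl; first by rewrite mulr_ge0// ltW.
  by rewrite ler_wpM2l ?zeta_lip_ge0// ltW.
have cX : 0 < #|` X|%:R :> R by apply: lt_le_trans Xl; rewrite invr_gt0.
have Xb x : x \in X -> euclid_dist x 0 <= delta.
  move=> /imfsetP[/= y + ->]; rewrite in_fset => /mapP[z zl ->].
  rewrite -scalerDr -[0](scaler0 _ r^-1) euclid_dist_scale ?invr_ge0 ?(ltW r0)//.
  rewrite mulrC ler_pdivrMr// /euclid_dist.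
  rewrite -(@ger0_norm _ (delta * r)) ?mulr_ge0 ?(ltW delta0) ?(ltW r0)//.
  rewrite -sqrtr_sqr ler_wsqrtr//.
  apply: (@le_trans _ _ (\sum_(i < d) (r * (delta / d.+1%:R)) ^+ 2)).
    apply: ler_sum => i _; rewrite !mxE subr0; have /andP[h1 h2] := la z zl i.
    rewrite lerXn2r// ?nnegrE; last by rewrite addrC lerBlDl.
    - by rewrite addrC subr_ge0.
    - by rewrite mulr_ge0 ?(ltW r0)// divr_ge0 ?(ltW delta0).
  rewrite sumr_const card_ord -[leLHS]mulr_natl.
  rewrite (_ : d%:R * _ = (delta * r) ^+ 2 * (d%:R / d.+1%:R ^+ 2)); last first.

    by field; rewrite nat1r pnatr_eq0.
  rewrite -[leRHS]mulr1 ler_wpM2l ?sqr_ge0// ler_pdivrMr ?exprn_gt0// mul1r -natrX ler_nat.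
  by rewrite expnS expn1 mulSn (leq_trans (leqnSn _))// leq_addr.
have h : zeta X / #|` X|%:R <= eta.
  rewrite -lee_fin ltW// (le_lt_trans _ hdelta)//.
  by apply: ereal_sup_ubound; exists X.
move: h; rewrite ler_pdivrMr// => /le_trans -> //.
rewrite ler_wpDr ?mulr_ge0 ?zeta_lip_ge0 ?invr_ge0 ?(ltW delta0)//.
by rewrite ler_wpM2l ?(ltW eta0)// ler_nat.
Qed.

End functional.

(** * Boxes, uniform points in a cube, dyadic cubes *)

Section rV_generators.
Context {R : realType}.

Lemma real_measurable_sub (H : set (set R)) : sigma_algebra setT H ->
  (forall c, H [set x | x < c]) -> measurable `<=` H.
Proof.
move=> sH hH; have -> : @measurable _ R = (@RGenInftyO.G R).-sigma.-measurable.
  exact: RGenInftyO.measurableE.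
apply: smallest_sub => // _ [c ->].
by rewrite (_ : `]-oo, c[%classic = [set x | x < c]).
Qed.

Lemma sigma_algebra_setX {T U : Type} (f : T -> U) (H : set (set T)) :
  sigma_algebra setT H -> sigma_algebra setT [set B | H (f @^-1` B)].
Proof.
case=> h0 hC hU; split=> /=.
- by rewrite preimage_set0.
- by move=> A hA; rewrite setTD preimage_setC -setTD; exact: hC.
- by move=> F hF; rewrite preimage_bigcup; exact: hU.
Qed.

(** Half-spaces generate because open rays generate the Borel sets of the line. Applied to the class
    of sets with a wanted property, this leaves half-spaces and the stability under complements and
    countable unions to be checked. *)
Lemma rV_measurable_sub n (H : set (set 'rV[R]_n)) : sigma_algebra setT H ->
  (forall i c, H [set x : 'rV[R]_n | x ord0 i < c]) -> measurable `<=` H.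
Proof.
move=> sH hH; apply: smallest_sub => //.
rewrite -bigcup_seq/= => _ [i _ [B mB <-]]; rewrite setTI.
exact: (real_measurable_sub (sigma_algebra_setX (fun x : 'rV[R]_n => x ord0 i) sH) (hH i) mB).
Qed.

Lemma tuple_rV_measurable_sub k n (H : set (set (k.-tuple 'rV[R]_n))) : sigma_algebra setT H ->
  (forall j i c, H [set t : k.-tuple 'rV[R]_n | tnth t j ord0 i < c]) -> measurable `<=` H.
Proof.
move=> sH hH; apply: smallest_sub => //.
rewrite -bigcup_seq/= => _ [j _ [B mB <-]]; rewrite setTI.
exact: (rV_measurable_sub (sigma_algebra_setX (fun t : k.-tuple 'rV[R]_n => tnth t j) sH) (hH j) mB).
Qed.

Definition box n (a b : 'rV[R]_n) : set 'rV[R]_n :=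
  [set x | forall i, a ord0 i <= x ord0 i < b ord0 i].

Lemma measurable_box n (a b : 'rV[R]_n) : measurable (box a b).
Proof.
rewrite (_ : box a b = \bigcap_(i in [set: 'I_n])
  ((fun x : 'rV[R]_n => x ord0 i) @^-1` [set` `[a ord0 i, b ord0 i[])); last first.
  apply/seteqP; split => x /= h i; first by move=> _ /=; rewrite in_itv/= h.
  by have := h i I; rewrite /= in_itv.
apply: fin_bigcap_measurable => // i _.
by rewrite -[X in measurable X]setTI; exact: measurable_coord.
Qed.

Lemma boxI n (a b a' b' : 'rV[R]_n) : box a b `&` box a' b' =
  box (\row_i Num.max (a ord0 i) (a' ord0 i)) (\row_i Num.min (b ord0 i) (b' ord0 i)).
Proof.
apply/seteqP; split => x /=.
  by move=> [h h'] i; rewrite !mxE ge_max lt_min; have /andP[-> ->] := h i; have /andP[-> ->] := h' i.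
move=> h; split=> i; have := h i; rewrite !mxE ge_max lt_min => /andP[/andP[u v] /andP[u' v']];
  exact/andP.
Qed.

Lemma rV_bounded n (x : 'rV[R]_n) : exists k : nat, forall j, - k%:R <= x ord0 j < k%:R.
Proof.
pose M := \sum_j `|x ord0 j|.
have hM j : `|x ord0 j| <= M by rewrite /M (bigD1 j)//= lerDl sumr_ge0.
have M0 : 0 <= M by rewrite /M sumr_ge0.
exists (Num.bound M) => j.
have := le_lt_trans (hM j) (archi_boundP M0).
by rewrite ltr_norml => /andP[/ltW -> ->].
Qed.

Lemma box_measure_unique n (m1 m2 : {measure set 'rV[R]_n -> \bar R}) : (m1 setT < +oo)%E ->
  (forall a b, m1 (box a b) = m2 (box a b)) -> forall A, measurable A -> m1 A = m2 A.
Proof.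
move=> m1oo m12 A mA.
pose G := [set box z.1 z.2 | z in [set: 'rV[R]_n * 'rV[R]_n]].
apply: (measure_unique G (fun k => box (const_mx (- k%:R)) (const_mx k%:R))) => //.
- apply/seteqP; split; last first.
    apply: smallest_sub; first exact: sigma_algebra_measurable.
    by move=> _ [z _ <-]; exact: measurable_box.
  apply: rV_measurable_sub; first exact: smallest_sigma_algebra.
  move=> i c; rewrite (_ : mkset _ = \bigcup_k
      box (const_mx (- k%:R)) (\row_j if j == i then c else k%:R)).
    apply: sigma_algebra_bigcup => k; apply: sub_sigma_algebra.
    by exists (const_mx (- k%:R), \row_j if j == i then c else k%:R).
  apply/seteqP; split => x /=; last first.
    by move=> [k _ /(_ i)]; rewrite !mxE eqxx => /andP[].
  move=> xc; have [k hk] := rV_bounded x; exists k => // j; rewrite !mxE.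
  by have /andP[-> ?] := hk j; case: eqP => [->|].
- move=> _ _ [z _ <-] [z' _ <-]; rewrite boxI.
  by exists (\row_i Num.max (z.1 ord0 i) (z'.1 ord0 i), \row_i Num.min (z.2 ord0 i) (z'.2 ord0 i)).
- by move=> k; exists (const_mx (- k%:R), const_mx k%:R).
- apply/seteqP; split => // x _; have [k hk] := rV_bounded x.
  by exists k => // j; rewrite !mxE.
- by move=> _ [z _ <-]; exact: m12.
- move=> k; apply: le_lt_trans m1oo; apply: le_measure => //; rewrite inE//; exact: measurable_box.
Qed.

Lemma lebesgue_rV_boxE n (a b : 'rV[R]_n) : lebesgue_rV n (box a b) =
  (\prod_(i < n) Num.max 0 (b ord0 i - a ord0 i))%:E.
Proof.
have [h|/existsNP[i /negP]] := pselect (forall i, a ord0 i <= b ord0 i).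
  rewrite lebesgue_rV_box//; congr (_%:E); apply: eq_bigr => i _.
  by apply/esym/max_idPr; rewrite subr_ge0.
rewrite -ltNge => ba.
rewrite (_ : box a b = set0) ?measure0; last first.
  apply/seteqP; split => // x /(_ i)/andP[h1 h2].
  by have := lt_trans (le_lt_trans h1 h2) ba; rewrite ltxx.
by rewrite (bigD1 i)//= (max_idPl _) ?mul0r// subr_le0 ltW.
Qed.

Definition cell n (a : 'rV[R]_n) (l : R) : set 'rV[R]_n := box a (a + const_mx l).

Lemma measurable_cell n (a : 'rV[R]_n) l : measurable (cell a l).
Proof. exact: measurable_box. Qed.

Lemma lebesgue_rV_cell n (a : 'rV[R]_n) l : 0 <= l ->
  lebesgue_rV n (cell a l) = (l ^+ n)%:E.
Proof.
move=> l0; rewrite lebesgue_rV_boxE; congr (_%:E).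
under eq_bigr do rewrite !mxE addrAC subrr add0r (max_idPr l0).
by rewrite prodr_const card_ord.
Qed.

Section unit_cube.
Variable n : nat.

Definition unif_cube : set 'rV[R]_n -> \bar R :=
  mrestr (lebesgue_rV n) (measurable_cell 0 1).

HB.instance Definition _ := Measure.on unif_cube.

Let unif_cubeT : unif_cube setT = 1%E.
Proof. by rewrite /unif_cube /mrestr setTI lebesgue_rV_cell// expr1n. Qed.

HB.instance Definition _ := Measure_isProbability.Build _ _ _ unif_cube unif_cubeT.

Definition to_cell (a : 'rV[R]_n) (l : R) (x : 'rV[R]_n) : 'rV[R]_n := a + l *: x.

Lemma measurable_to_cell a l : measurable_fun setT (to_cell a l).
Proof. exact: measurable_rV_affine. Qed.

(** The affine change of variables: two finite measures are compared on boxes, where both volumes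
    are explicit products. It transports questions about cells of any side to the one probability
    [unif_cube]. *)
Lemma lebesgue_cell_affine a l A : 0 < l -> measurable A ->
  lebesgue_rV n (A `&` cell a l) = ((l ^+ n)%:E * unif_cube (to_cell a l @^-1` A))%E.
Proof.
move=> l0.
have ma := measurable_to_cell a l.
pose m1 : {measure set 'rV[R]_n -> \bar R} := mrestr (lebesgue_rV n) (measurable_cell a l).
have ln0 : 0 <= l ^+ n by rewrite exprn_ge0// ltW.
pose aff : {mfun 'rV[R]_n >-> 'rV[R]_n} := HB.pack (to_cell a l) (isMeasurableFun.Build _ _ _ _ _ ma).
pose m2 : {measure set 'rV[R]_n -> \bar R} := mscale (NngNum ln0) (distribution unif_cube aff).
apply: (@box_measure_unique n m1 m2).
  by rewrite /m1/= /mrestr setTI lebesgue_rV_cell ?(ltW l0)// ltry.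
move=> p q; rewrite /m1 /m2 /= /mrestr /mscale/= /distribution /pushforward /unif_cube /mrestr.
rewrite (_ : to_cell a l @^-1` box p q = box (\row_i ((p ord0 i - a ord0 i) / l)) (\row_i ((q ord0 i - a ord0 i) / l))); last first.
  apply/seteqP; split => x /= h i; have := h i; rewrite !mxE ler_pdivrMr// ltr_pdivlMr//.
    by rewrite lerBlDl ltrBrDl mulrC.
  by rewrite lerBlDl ltrBrDl mulrC.
rewrite !boxI !lebesgue_rV_boxE -EFinM; congr (_%:E).
have -> : l ^+ n = \prod_(i < n) l by rewrite prodr_const card_ord.
rewrite -big_split/=; apply: eq_bigr => i _; rewrite !mxE add0r.
have l_neq0 : l != 0 by rewrite gt_eqF.
rewrite maxr_pMr ?(ltW l0)// mulr0 mulrBr minr_pMr ?(ltW l0)// maxr_pMr ?(ltW l0)//.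
rewrite mulr0 mulr1 ![l * (_ / l)]mulrC !divfK//.
congr (Num.max 0 _); rewrite !(minEle, maxEle).
have -> : q ord0 i - a ord0 i <= l = (q ord0 i <= a ord0 i + l) by rewrite lerBlDl.
have -> : p ord0 i - a ord0 i <= 0 = (p ord0 i <= a ord0 i) by rewrite subr_le0.
by case: ifP => _; case: ifP => _; ring.
Qed.

End unit_cube.
End rV_generators.

Lemma sigma_algebra_countable_bigcup {T : Type} {U : countType} (H : set (set T)) (F : U -> set T) :
  sigma_algebra setT H -> (forall v, H (F v)) -> H (\bigcup_v F v).
Proof.
case=> h0 _ hU hF.
rewrite (_ : \bigcup_v F v = \bigcup_n (if @choice.unpickle U n is Some v then F v else set0)).
  by apply: hU => n; case: (@choice.unpickle U n) => [v|]; [exact: hF|exact: h0].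
apply/seteqP; split => x [v _].
  by move=> Fv; exists (choice.pickle v) => //; rewrite choice.pickleK.
by case: (@choice.unpickle U v) => // u Fu; exists u.
Qed.

Section dyadic.
Context {R : realType} {d : nat}.
Local Notation point := 'rV[R]_d.

(** The labels form a countable type, so anything that depends only on the dyadic cube of [x] is
    measurable ([measurable_dyad_set]), and the partitions refine one another as [n] grows. *)
Definition dyad (n : nat) (x : point) : 'rV[int]_d := \row_i Num.floor (2 ^+ n * x ord0 i).

Lemma dyadP n x v : dyad n x = v <->
  forall i, (v ord0 i)%:~R <= 2 ^+ n * x ord0 i < (v ord0 i + 1)%:~R.
Proof.
split=> [<- i|h]; first by rewrite mxE real_floor_itv ?num_real.
by apply/rowP => i; rewrite mxE; apply: floor_def; exact: h.
Qed.

Lemma dyad_cell n v : [set x | dyad n x = v] =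
  cell (\row_i ((v ord0 i)%:~R / 2 ^+ n)) (2 ^- n).
Proof.
have n0 : 0 < 2 ^+ n :> R by rewrite exprn_gt0.
apply/seteqP; split => x /=.
  move=> /dyadP h i; have /andP[h1 h2] := h i; rewrite !mxE ler_pdivrMr// mulrC h1 /=.
  by rewrite -[X in _ + X]mul1r -mulrDl ltr_pdivlMr// mulrC; move: h2; rewrite intrD.
move=> h; apply/dyadP => i; have := h i; rewrite !mxE ler_pdivrMr// mulrC => /andP[-> /=].
by rewrite -[X in _ + X]mul1r -mulrDl ltr_pdivlMr// mulrC intrD.
Qed.

Lemma measurable_dyad n v : measurable [set x | dyad n x = v].
Proof. by rewrite dyad_cell; exact: measurable_cell. Qed.

Lemma measurable_dyad_set n (E : set 'rV[int]_d) : measurable [set x | E (dyad n x)].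
Proof.
rewrite (_ : mkset _ = \bigcup_v ([set x | dyad n x = v] `&` [set x | E v])); last first.
  by apply/seteqP; split => x /=; [exists (dyad n x)|move=> [v _ [/= -> ]]].
apply: (sigma_algebra_countable_bigcup (sigma_algebra_measurable _)) => v.
apply: measurableI; first exact: measurable_dyad.
have [Ev|nEv] := pselect (E v).
  by rewrite (_ : mkset _ = setT)//; apply/seteqP; split.
by rewrite (_ : mkset _ = set0)//; apply/seteqP; split.
Qed.

Lemma dyad_coarsen n m x y : (n <= m)%N -> dyad m x = dyad m y -> dyad n x = dyad n y.
Proof.
move=> nm; rewrite -(subnKC nm); elim: (m - n)%N => [|k IH]; first by rewrite addn0.
rewrite addnS => e; apply: IH; apply/dyadP => i.
have /dyadP/(_ i) := e; set w := dyad (n + k) y.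
have /dyadP/(_ i)/andP[a1 a2] : dyad (n + k) y = w by [].
have : dyad (n + k).+1 y = dyad (n + k).+1 y by [].
move=> /dyadP/(_ i); set v := dyad _ y ord0 i.
rewrite exprS -!mulrA => /andP[b1 b2] /andP[c1 c2].
have h1 : (w ord0 i * 2 <= v).
  rewrite -ltzD1 -(ltr_int R) intrM; lra.
have h2 : (v + 1 <= (w ord0 i + 1) * 2).
  rewrite lezD1 -(ltr_int R) intrM; lra.
move: h1 h2; rewrite -!(ler_int R) !intrM; lra.
Qed.

Lemma dyad_dist n x y i : dyad n x = dyad n y -> `|x ord0 i - y ord0 i| < 2 ^- n.
Proof.
move=> e; have n0 : 0 < 2 ^+ n :> R by rewrite exprn_gt0.
have /dyadP/(_ i) := e; have /dyadP/(_ i) : dyad n y = dyad n y by [].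
rewrite intrD => /andP[a1 a2] /andP[b1 b2].
rewrite -(ltr_pM2l n0) divff ?gt_eqF// -(gtr0_norm n0) -normrM mulrBr.
by rewrite ltr_norml; apply/andP; split; lra.
Qed.

Lemma expr2_inv_lt (e : R) : 0 < e -> exists n0, forall n, (n0 <= n)%N -> 2 ^- n < e.
Proof.
move=> e0; exists (Num.bound e^-1) => n hn.
rewrite -[ltRHS]invrK ltf_pV2 ?posrE ?invr_gt0 ?exprn_gt0//.
apply: (lt_le_trans (archi_boundP (ltW _))); first by rewrite invr_gt0.
by rewrite -natrX ler_nat (leq_trans hn)// ltnW// ltn_expl.
Qed.

Lemma dyad_lt (x : point) (i : 'I_d) (c : R) : x ord0 i < c -> exists n0, forall n, (n0 <= n)%N ->
  forall y, dyad n y = dyad n x -> y ord0 i < c.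
Proof.
move=> xc; have [n0 h] := @expr2_inv_lt (c - x ord0 i) ltac:(by rewrite subr_gt0).
exists n0 => n /h hn y /(dyad_dist i) /lt_trans/(_ hn).
by rewrite ltr_norml ltrBlDr subrK => /andP[].
Qed.

Lemma dyad_neq (x y : point) : x <> y -> exists n0, forall n, (n0 <= n)%N -> dyad n x <> dyad n y.
Proof.
move=> xy; have [i xyi] : exists i, x ord0 i <> y ord0 i.
  by apply/existsNP => h; apply: xy; apply/rowP.
have [n0 h] := @expr2_inv_lt `|x ord0 i - y ord0 i| ltac:(by rewrite normr_gt0 subr_eq0; apply/eqP).
exists n0 => n /h hn /(dyad_dist i) /lt_trans/(_ hn).
by rewrite ltxx.
Qed.

End dyadic.

(* The law of a Poisson process in a cube *)
From mathcomp Require Import fingroup perm.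

(** If each [Some j] occurs once and [None] never, the tuple rearranges the list of all [Some j] and
    exactly one permutation undoes this; otherwise none does. It turns a count of matching orderings
    into an indicator. *)
Lemma sum_perm_labels k (ls : k.-tuple (option 'I_k)) :
  (\sum_(s : 'S_k) [forall j, tnth ls (s j) == Some j] =
   [forall o, count_mem o ls == (o != None)])%N.
Proof.
pose tg := [tuple Some j | j < k].
have ctg o : count_mem o tg = (o != None).
  have -> : tg = [seq Some j | j <- enum 'I_k] :> seq (option 'I_k) by [].
  case: o => [j|].
    rewrite count_uniq_mem; last by rewrite map_inj_uniq ?enum_uniq// => ? ? [].
    by rewrite map_f// mem_enum.
  by apply/count_memPn/negP => /mapP[].
have -> : [forall o, count_mem o ls == (o != None)] = perm_eq ls tg.
  apply/forallP/idP => [h|/seq.permP h o]; last by rewrite h ctg.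
  by apply/allP => o _ /=; rewrite ctg; exact: h.
have [|np] := boolP (perm_eq ls tg); last first.
  rewrite big1// => s _; apply/eqP; rewrite eqb0; apply: contra np => /forallP h.
  rewrite perm_sym; apply/tuple_permP; exists s; congr tval.
  by apply: eq_from_tnth => j; rewrite !tnth_mktuple; apply/esym/eqP.
rewrite perm_sym => /tuple_permP[p hp].
have hp' j : tnth ls (p j) = Some j.
  have : tg = [tuple tnth ls (p i) | i < k] by exact: val_inj.
  by move=> /(congr1 (fun t => tnth t j)); rewrite !tnth_mktuple => ->.
rewrite (bigD1 p)//= big1 ?addn0; last first.
  move=> s sp; apply/eqP; rewrite eqb0; apply: contra sp => /forallP h.
  apply/eqP/perm.permP => j; apply: (canRL (permKV p)).
  have := hp' (p^-1 (s j))%g; rewrite permKV; have /eqP -> := h j.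
  by case.
by rewrite (_ : [forall j, _])//; apply/forallP => j; rewrite hp'.
Qed.

Section point_process_law.
Context {R : realType} {d : nat}.
Local Notation point := 'rV[R]_d.
Context {dH : measure_display} {OmegaH : measurableType dH}.
Variables (PH : probability OmegaH R) (lambda : R) (H : OmegaH -> set point).
Hypotheses (lambda_gt0 : 0 < lambda) (HP : is_homogeneous_poisson PH lambda H).
Variables (s : R) (s_gt0 : 0 < s).

Let Q : set point := cube s.
Let corner : point := const_mx (- (s / 2)).

Lemma cubeE : Q = cell corner s.
Proof.
apply/seteqP; split => x /= h i; have := h i; rewrite !mxE;
  by rewrite (_ : - (s / 2) + s = s / 2)//; field.
Qed.

Lemma bounded_cube (B : set point) : B `<=` Q -> bounded_set B.
Proof.
move=> BQ; exists (s / 2); split; first exact: num_real.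
move=> M sM x /BQ h; rewrite /Num.norm/= mx_normrE.
apply: bigmax_le => [|[i j] _]; first by apply: ltW; apply: lt_trans sM; rewrite divr_gt0.
rewrite /= ord1; have /andP[h1 h2] := h j; rewrite ler_norml.
by rewrite (le_trans _ h1) ?lerN2 ?(ltW sM)// (le_trans (ltW h2))// ltW.
Qed.

Let mQ : measurable Q. Proof. by rewrite cubeE; exact: measurable_cell. Qed.

Definition config (w : OmegaH) : {fset point} := fset_set (H w `&` Q).
Local Notation N := (npoints H Q).

Lemma npoints_config (B : set point) w : B `<=` Q ->
  npoints H B w = count (fun x => `[< B x >]) (config w).
Proof.
case: HP => fin _ _ BQ; rewrite /npoints /config.
have fQ : finite_set (H w `&` Q) by apply: fin; exact: bounded_cube.
rewrite -size_filter.
apply/perm_size/uniq_perm; [exact: fset_uniq|exact/filter_uniq/fset_uniq|].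
move=> x; rewrite mem_filter !in_fset_set//; last by apply: fin; exact: bounded_cube.
apply/idP/andP => [/set_mem[Hx Bx]|[/asboolP Bx /set_mem[Hx _]]].
  by split; [exact/asboolP|apply/mem_set; split=> //; exact: BQ].
exact/mem_set.
Qed.

Lemma config_mem w x : x \in config w -> Q x.
Proof.
case: HP => fin _ _; rewrite in_fset_set; last by apply: fin; exact: bounded_cube.
by move=> /set_mem[].
Qed.

Section fixed_size.
Variable k : nat.

Definition listing (w : OmegaH) (sg : 'S_k) : k.-tuple point :=
  [tuple nth 0 (config w) (sg i) | i < k].

(** The enumeration of the finite set [config w] is arbitrary and carries no measurability. Summing
    over all orderings removes the choice: on the event of exactly [k] points, the value is the
    number of orderings of the configuration that lie in [A]. *)
Definition perm_count (A : set (k.-tuple point)) (w : OmegaH) : R :=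
  if N w == k then \sum_(sg : 'S_k) \1_A (listing w sg) else 0.

Definition dyad_rectangle (n : nat) (v : {ffun 'I_k -> 'rV[int]_d}) : set (k.-tuple point) :=
  [set t | forall j, Q (tnth t j) /\ dyad n (tnth t j) = v j].

(** With disjoint sides at most one ordering fits, and one does precisely when each side holds one
    point and the rest of the cube none. Here orderings become counts, the only data the process
    provides. *)
Lemma perm_count_rectangle (B : 'I_k -> set point) w :
  (forall j, B j `<=` Q) -> (forall i j x, B i x -> B j x -> i = j) ->
  perm_count [set t | forall j, B j (tnth t j)] w =
  ([forall j, npoints H (B j) w == 1%N] && (npoints H (Q `\` \bigcup_j B j) w == 0%N))%:R.
Proof.
move=> BQ Bd.
pose lab (x : point) : option 'I_k := [pick j | `[< B j x >]].
have labS x j : (lab x == Some j) = `[< B j x >].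
  rewrite /lab; case: pickP => [i /asboolP Bi|h].
    apply/eqP/asboolP => [[<-]//|Bj]; congr Some; exact: Bd Bi Bj.
  by rewrite h.
have labN x : (lab x == None) = `[< ~ exists j, B j x >].
  rewrite /lab; case: pickP => [i /asboolP Bi|h].
    by apply/esym/asboolP => -[]; exists i.
  by apply/esym/asboolP => -[j /asboolP Bj]; have := h j; rewrite Bj.
have nQ : N w = size (config w).
  rewrite npoints_config// -size_filter; congr size; apply/all_filterP/allP => x xc.
  by apply/asboolP; exact: (config_mem xc).
have cB j : npoints H (B j) w = count_mem (Some j) (map lab (config w)).
  by rewrite npoints_config// count_map; apply: eq_count => x /=; rewrite labS.
have c0 : npoints H (Q `\` \bigcup_j B j) w = count_mem None (map lab (config w)).
  rewrite npoints_config; last exact: subDsetl.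
  rewrite count_map; apply: eq_in_count => x xc /=; rewrite labN.
  apply/asboolP/asboolP => [[_ h] [j Bj]|h]; first by apply: h; exists j.
  by split; [exact: (config_mem xc)|move=> [j _ Bj]; apply: h; exists j].
rewrite /perm_count nQ.
have -> : [forall j, npoints H (B j) w == 1%N] && (npoints H (Q `\` \bigcup_j B j) w == 0%N) =
    [forall o, count_mem o (map lab (config w)) == (o != None :> option 'I_k)].
  apply/andP/forallP => [[/forallP h1 h2] [j|]|h].
  - by rewrite -cB; exact: h1.
  - by rewrite -c0.
  - by split; [apply/forallP => j; rewrite cB (eqP (h (Some j)))|rewrite c0; exact: (h None)].
have [sk|sk] := eqVneq (size (config w)) k; last first.
  case: forallP => // h; exfalso; move/eqP: sk; apply.
  rewrite -(size_map lab) -sum1_size (partition_big (fun o => o) predT)//=.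
  under eq_bigr => o _ do rewrite sum1_count (eqP (h o)).
  rewrite (bigD1 None)//= add0n (reindex_omap Some id)//=; last by case.
  rewrite (eq_bigl predT); last by move=> j; rewrite /= eqxx.
  by rewrite sum1_card card_ord.
have st : size (map lab (config w)) == k by rewrite size_map sk.
rewrite -(sum_perm_labels (Tuple st)) natr_sum; apply: eq_bigr => sg _.
rewrite indicE; congr (_%:R); congr nat_of_bool.
apply/idP/forallP => [/set_mem /= h j|h].
  rewrite (tnth_nth None)/= (nth_map 0) ?sk// labS; apply/asboolP.
  by have := h j; rewrite tnth_mktuple.
apply/mem_set => /= j; rewrite tnth_mktuple; apply/asboolP; rewrite -labS.
by have := h j; rewrite (tnth_nth None)/= (nth_map 0) ?sk.
Qed.

Definition map_cell (t : k.-tuple point) : k.-tuple point := [tuple to_cell corner s (tnth t i) | i < k].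

Lemma measurable_map_cell : measurable_fun setT map_cell.
Proof.
apply/measurable_fun_tnthP => i.
rewrite (_ : _ \o _ = to_cell corner s \o (fun t : k.-tuple point => tnth t i)).
  by apply: measurableT_comp; [exact: measurable_to_cell|exact: measurable_tnth].
by apply/funext => t /=; rewrite tnth_mktuple.
Qed.

Let mapm : {mfun k.-tuple point >-> k.-tuple point} :=
  HB.pack map_cell (isMeasurableFun.Build _ _ _ _ _ measurable_map_cell).

Local Notation unif := (@unif_cube R d).

Definition tuple_law : probability (k.-tuple point) R := distribution (prod_tuple unif k) mapm.

Local Notation LEB := (lebesgue_rV d).
Local Notation kappa := (lambda * s ^+ d).

Let mnpoints (B : set point) : measurable B -> B `<=` Q -> measurable_fun setT (npoints H B).
Proof. by case: HP => _ /(_ B) h _ mB BQ; case: h => //; exact: bounded_cube. Qed.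

(** The counts in the sides and in the remainder are independent, so the expectation is a product of
    Poisson probabilities. The exponentials multiply to [expR (- kappa)] because the volumes add up
    to that of the cube, and the factors [lambda * b j] give [kappa ^+ k] times the uniform
    probabilities. *)
Lemma measurable_perm_count_rectangle (B : 'I_k -> set point) :
  (forall j, measurable (B j)) -> (forall j, B j `<=` Q) ->
  (forall i j x, B i x -> B j x -> i = j) ->
  measurable_fun setT (perm_count [set t | forall j, B j (tnth t j)]) /\
  (\int[PH]_w (perm_count [set t | forall j, B j (tnth t j)] w)%:E =
   (expR (- kappa) * kappa ^+ k)%:E * tuple_law [set t | forall j, B j (tnth t j)])%E.
Proof.
move=> mB BQ Bd.
pose rest := Q `\` \bigcup_j B j.
have mrest : measurable rest.
  by apply: measurableD => //; apply: fin_bigcup_measurable.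
have restQ : rest `<=` Q by exact: subDsetl.
(* The index [ord0] stands for the remainder of the cube, where no point is required, and
   [lift ord0 j] for the side [B j], where one is. *)
pose B' (i : 'I_k.+1) := if unlift ord0 i is Some j then B j else rest.
have mB' i : measurable (B' i) by rewrite /B'; case: (unlift _ _).
have B'Q i : B' i `<=` Q by rewrite /B'; case: (unlift _ _).
have tB' : trivIset setT B'.
  move=> i j _ _ [x []]; rewrite /B'.
  case: (unliftP ord0 i) => [i' ->|->]; case: (unliftP ord0 j) => [j' ->|->] //.
  - by move=> Bi Bj; rewrite (Bd _ _ _ Bi Bj).
  - by move=> Bi [_ h]; exfalso; apply: h; exists i'.
  - by move=> [_ h] Bj; exfalso; apply: h; exists j'.
case: HP => _ hP hI.
have hind := hI k.+1 B' (fun i => conj (mB' i) (bounded_cube (B'Q i))) tB'.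
pose c (i : 'I_k.+1) : nat := if unlift ord0 i is Some j then 1%N else 0%N.
pose E := \bigcap_(i in [set` [fset i | i in 'I_k.+1]%fset]) (npoints H (B' i) @^-1` [set c i]).
have EE : perm_count [set t | forall j, B j (tnth t j)] = \1_E :> (_ -> R).
  apply/funext => w; rewrite perm_count_rectangle// indicE; congr (_%:R); congr nat_of_bool.
  apply/andP/idP => [[/forallP h1 /eqP h2]|/set_mem h].
    apply/mem_set => i _ /=; rewrite /B' /c; case: (unliftP ord0 i) => [j _|_]; last exact: h2.
    exact/eqP/h1.
  have iJ i : i \in [fset i | i in 'I_k.+1]%fset by apply/imfsetP; exists i.
  split.
    apply/forallP => j; have := h (lift ord0 j) (iJ _).
    by rewrite /= /B' /c liftK => ->.
  by have := h ord0 (iJ _); rewrite /= /B' /c unlift_none => ->.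
have mE : measurable E.
  apply: fin_bigcap_measurable => // i _; rewrite -[X in measurable X]setTI.
  exact: mnpoints.
have PE := hind [fset i | i in 'I_k.+1]%fset (fun i => npoints H (B' i) @^-1` [set c i]).
have {}PE : PH E = (\prod_(i < k.+1) PH (npoints H (B' i) @^-1` [set c i]))%E.
  rewrite /E PE; last by move=> i _; exists [set c i] => //; rewrite setTI.
  apply: perm_big; apply: uniq_perm; [exact: fset_uniq|exact: index_enum_uniq|].
  by move=> i; rewrite mem_index_enum; apply/imfsetP; exists i.
split; first by rewrite EE; exact: measurable_indic.
rewrite EE integral_indic// setIT [LHS]PE.
have finL (B0 : set point) : measurable B0 -> B0 `<=` Q -> LEB B0 \is a fin_num.
  move=> mB0 B0Q; rewrite ge0_fin_numE//; apply: (@le_lt_trans _ _ (LEB Q)).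
    exact: (le_measure _ (mem_set mB0) (mem_set mQ) B0Q).
  by rewrite cubeE lebesgue_rV_cell ?(ltW s_gt0)// ltry.
pose b j := fine (LEB (B j)).
have lawE : tuple_law [set t | forall j, B j (tnth t j)] = (\prod_(j < k) (b j / s ^+ d)%:E)%E.
  rewrite /tuple_law /= /distribution /pushforward.
  rewrite (_ : mapm @^-1` _ = [set t | forall j, (to_cell corner s @^-1` B j) (tnth t j)]); last first.
    by apply/seteqP; split => t /= h j; have := h j; rewrite tnth_mktuple.
  rewrite [LHS](prod_tuple_rectangle unif (A := fun j => to_cell corner s @^-1` B j)); last first.
    by move=> j; rewrite -[X in measurable X]setTI; exact: measurable_to_cell.
  apply: eq_bigr => j _.
  have := lebesgue_cell_affine corner s_gt0 (mB j); rewrite -cubeE (setIidl (BQ j)) => e.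
  have u_fin : unif (to_cell corner s @^-1` B j) \is a fin_num.
    by rewrite fin_num_measure// -[X in measurable X]setTI; exact: measurable_to_cell.
  by rewrite /b e fineM//= [_ * fine _]mulrC mulfK ?fineK// gt_eqF// exprn_gt0.
rewrite lawE.
have Pj i : PH (npoints H (B' i) @^-1` [set c i]) =
    (expR (- (lambda * fine (LEB (B' i)))) * (if unlift ord0 i is Some j then lambda * b j else 1))%:E.
  have [_ ->] := hP (B' i) (mB' i) (bounded_cube (B'Q i)).
  rewrite /B' /c /b; case: (unlift ord0 i) => [j|]; first by rewrite expr1 divr1.
  by rewrite expr0 divr1.
under eq_bigr do rewrite Pj.
rewrite !prodEFin -EFinM; congr (_%:E).
rewrite big_split/= -expR_sum sumrN -mulr_sumr.
have -> : \sum_(i < k.+1) fine (LEB (B' i)) = s ^+ d.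
  have : LEB (\big[setU/set0]_(i < k.+1) B' i) = (\sum_(i < k.+1) LEB (B' i))%E.
    exact: measure_bigsetU_ord.
  rewrite -bigcup_seq (_ : \bigcup_(i in _) _ = Q); last first.
    apply/seteqP; split => x; first by move=> [i _]; exact: B'Q.
    move=> Qx; have [[j _ Bj]|nB] := pselect ((\bigcup_j B j) x).
      by exists (lift ord0 j); rewrite /= ?mem_index_enum// /B' liftK.
    by exists ord0; rewrite /= ?mem_index_enum// /B' unlift_none.
  rewrite cubeE lebesgue_rV_cell ?(ltW s_gt0)//.
  move=> /(congr1 fine)/= ->; by rewrite -sum_fine// => i _; exact: finL.
rewrite -mulrA; congr (_ * _); rewrite big_ord_recl unlift_none mul1r.
under [LHS]eq_bigr do rewrite liftK.
have -> : kappa ^+ k = \prod_(j < k) kappa by rewrite prodr_const card_ord.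
rewrite -big_split/=; apply: eq_bigr => j _.
have sd : s ^+ d != 0 by rewrite gt_eqF// exprn_gt0.
by rewrite -mulrA; congr (_ * _); rewrite mulrC divfK.
Qed.

Lemma perm_count_setT w : perm_count setT w = (N w == k)%:R * k`!%:R.
Proof.
rewrite /perm_count; case: eqP => _; last by rewrite mul0r.
by rewrite mul1r; under eq_bigr do rewrite indicT; rewrite sumr_const -[#|_|]/#|'S_k| card_Sn.
Qed.

Lemma perm_countD A B w : B `<=` A -> perm_count (A `\` B) w = perm_count A w - perm_count B w.
Proof.
move=> BA; rewrite /perm_count; case: eqP => _; last by rewrite subr0.
rewrite -sumrB; apply: eq_bigr => sg _; rewrite !indicE in_setD.
have [/set_mem Bt|Bt] := boolP (_ \in B); last by rewrite andbT subr0.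
by rewrite (mem_set (BA _ Bt)) andbF subrr.
Qed.

Lemma perm_count_ge0 A w : 0 <= perm_count A w.
Proof. by rewrite /perm_count; case: eqP => // _; rewrite sumr_ge0// => sg _; rewrite indicE. Qed.

Lemma perm_count_le A w : perm_count A w <= k`!%:R.
Proof.
rewrite /perm_count; case: eqP => _; last by rewrite ler0n.
rewrite -(card_Sn k) -sumr_const; apply: ler_sum => sg _.
by rewrite indicE lern1 leq_b1.
Qed.

Lemma perm_count_bigcup (F : (set (k.-tuple point))^nat) w :
  {homo F : n m / (n <= m)%N >-> (n <= m)%O} ->
  exists n0, forall n, (n0 <= n)%N -> perm_count (F n) w = perm_count (\bigcup_n F n) w.
Proof.
move=> ndF.
have h sg : exists n0, forall n, (n0 <= n)%N -> (listing w sg \in F n) = (listing w sg \in \bigcup_n F n).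
  have [/set_mem[n0 _ hn0]|/negP hn] := boolP (listing w sg \in \bigcup_n F n).
    exists n0 => n n0n; apply/mem_set.
    by have /subsetPset := ndF _ _ n0n; apply.
  by exists 0%N => n _; apply/negP => /set_mem Fn; apply: hn; apply/mem_set; exists n.
have [g hg] := choice h.
exists (\max_sg g sg) => n hn; rewrite /perm_count; case: eqP => // _.
apply: eq_bigr => sg _; rewrite !indicE hg//.
by apply: leq_trans hn; exact: leq_bigmax.
Qed.

(** On exactly [k] points, ordered configurations should have intensity
    [expR (- kappa) * kappa ^+ k] times the law of [k] independent uniform points: the number of
    orderings cancels the factorial in the Poisson weight. *)
Definition perm_count_class : set (set (k.-tuple point)) := [set A |
  [/\ measurable A, measurable_fun setT (perm_count A) &
    (\int[PH]_w (perm_count A w)%:E = (expR (- kappa) * kappa ^+ k)%:E * tuple_law A)%E]].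

Let integrable_perm_count A : measurable_fun setT (perm_count A) ->
  PH.-integrable setT (EFin \o perm_count A).
Proof.
move=> mA; apply: (@bounded_integrable _ _ _ PH _ _ k`!%:R) => // w.
by rewrite ger0_norm ?perm_count_ge0 ?perm_count_le.
Qed.

Let mN : measurable_fun setT N. Proof. exact: mnpoints. Qed.

Let poisson_N j : PH (N @^-1` [set j]) = (expR (- kappa) * kappa ^+ j / j`!%:R)%:E.
Proof.
have [_ h _] := HP; have [_ ->] := h Q mQ (bounded_cube (@subset_refl _ Q)).
by rewrite cubeE lebesgue_rV_cell ?(ltW s_gt0).
Qed.

Lemma lambda_system_perm_count : lambda_system setT perm_count_class.
Proof.
split => //.
- split => //.
    have -> : perm_count setT = fun w => \1_(N @^-1` [set k]) w * k`!%:R.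
      apply/funext => w; rewrite perm_count_setT indicE; congr (_%:R * _); congr nat_of_bool.
      by apply/eqP/idP => [h|/set_mem//]; exact/mem_set.
    apply: measurable_funM => //; apply: measurable_indic.
    by rewrite -[X in measurable X]setTI; exact: mN.
  have -> : (fun w => (perm_count setT w)%:E) = (fun w => k`!%:R%:E * (\1_(N @^-1` [set k]) w)%:E)%E.
    apply/funext => w; rewrite perm_count_setT -EFinM mulrC indicE; congr (_ * _%:R)%:E; congr nat_of_bool.
    by apply/eqP/idP => [h|/set_mem//]; exact/mem_set.
  have mE : measurable (N @^-1` [set k]) by rewrite -[X in measurable X]setTI; exact: mN.
  rewrite ge0_integralZl//; last by apply/measurable_EFinP; exact: measurable_indic.
  rewrite integral_indic// setIT [X in (_ * X)%E]poisson_N [X in _ = (_ * X)%E](@probability_setT _ _ _ tuple_law).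
  by rewrite mule1 -EFinM mulrC divfK// pnatr_eq0 -lt0n fact_gt0.
- move=> A B BA [mA fA iA] [mB fB iB]; split; first exact: measurableD.
    rewrite (_ : perm_count _ = fun w => perm_count A w - perm_count B w); last first.
      by apply/funext => w; exact: perm_countD.
    exact: measurable_funB.
  under eq_integral do rewrite perm_countD// EFinB.
  rewrite integralB_EFin//; try exact: integrable_perm_count.
  rewrite iA iB [X in _ = (_ * X)%E]measureD//; last by rewrite ltey_eq fin_num_measure.
  by rewrite (setIidr BA) muleBr// fin_num_adde_defr// fin_num_measure.
- move=> F ndF hF.
  have mU : measurable (\bigcup_i F i) by apply: bigcup_measurable => i _; case: (hF i).
  have cv w : perm_count (F n) w @[n --> \oo] --> perm_count (\bigcup_i F i) w.
    have [n0 h] := perm_count_bigcup w ndF.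
    by apply: cvg_near_cst; exists n0.
  have mF n : measurable_fun setT (perm_count (F n)) by case: (hF n).
  have mfU : measurable_fun setT (perm_count (\bigcup_i F i)).
    by apply: (measurable_fun_cvg (h := fun n => perm_count (F n))) => // w _; exact: cv.
  split => //.
  have icst : PH.-integrable setT (cst k`!%:R%:E).
    apply: (@bounded_integrable _ _ _ PH (cst k`!%:R) setT k`!%:R) => //.
    by move=> w /=; rewrite ger0_norm.
  have dom w n : (`|(perm_count (F n) w)%:E| <= cst k`!%:R%:E w)%E.
    by rewrite /= lee_fin ger0_norm ?perm_count_ge0 ?perm_count_le.
  have cI : (\int[PH]_w (perm_count (F n) w)%:E)%E @[n --> \oo] --> (\int[PH]_w (perm_count (\bigcup_i F i) w)%:E)%E.
    have [] := @dominated_convergence _ _ _ PH setT measurableT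
      (fun n => EFin \o perm_count (F n)) (EFin \o perm_count (\bigcup_i F i)) (cst k`!%:R%:E).
    + by move=> n; apply/measurable_EFinP.
    + exact/measurable_EFinP.
    + by apply: aeW => w _; apply: cvg_EFin; [exact: nearW|exact: cv].
    + exact: icst.
    + by apply: aeW => w n _; exact: dom.
    by [].
  have cM : ((expR (- kappa) * kappa ^+ k)%:E * tuple_law (F n))%E @[n --> \oo] -->
      ((expR (- kappa) * kappa ^+ k)%:E * tuple_law (\bigcup_i F i))%E.
    apply: cvgeZl => //; apply: nondecreasing_cvg_mu => // n; by case: (hF n).
  apply: (cvg_unique _ cI); first exact: ereal_hausdorff.
  rewrite (_ : (fun n => _) = fun n => ((expR (- kappa) * kappa ^+ k)%:E * tuple_law (F n))%E)//.
  by apply/funext => n /=; case: (hF n).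
Qed.

Definition simple_tuples : set (k.-tuple point) :=
  [set t | (forall j, Q (tnth t j)) /\ injective (tnth t)].

(** Only rectangles with distinct cells are taken, since [perm_count_rectangle] needs disjoint
    sides. They see only [simple_tuples], the tuples in the cube without repeated points, and there
    they generate everything. *)
Definition dyad_rectangles : set (set (k.-tuple point)) := [set A | A = set0 \/
  exists n (v : {ffun 'I_k -> 'rV[int]_d}), injective v /\ A = dyad_rectangle n v].

(** Dyadic cubes are nested or disjoint, so two rectangles have empty intersection or the finer one
    lies in the coarser. This is why the empty set belongs to the family. *)
Lemma dyad_rectanglesI : setI_closed dyad_rectangles.
Proof.
have key n (v : {ffun 'I_k -> 'rV[int]_d}) m (w : {ffun 'I_k -> 'rV[int]_d}) :
    (n <= m)%N -> injective w ->
    dyad_rectangles (dyad_rectangle n v `&` dyad_rectangle m w).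
  move=> nm iw; have [e|/set0P[t0 [h1 h2]]] := eqVneq (dyad_rectangle n v `&` dyad_rectangle m w) set0.
    by left.
  right; exists m, w; split=> //; apply/setIidr => t ht j; have [Qt tw] := ht j.
  split=> //; have [_ <-] := h1 j; apply: (dyad_coarsen nm).
  by rewrite tw; have [_ ->] := h2 j.
move=> A B [->|[n [v [iv ->]]]]; first by rewrite set0I; left.
move=> [->|[m [w [iw ->]]]]; first by rewrite setI0; left.
by have [nm|/ltnW mn] := leqP n m; [exact: key|rewrite setIC; exact: key].
Qed.

Lemma dyad_rectangles_class : dyad_rectangles `<=` perm_count_class.
Proof.
move=> A [->|[n [v [iv ->]]]].
  have e : perm_count set0 = fun=> 0.
    apply/funext => w; rewrite /perm_count; case: eqP => // _.
    by rewrite big1// => sg _; rewrite indic0.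
  split => //; first by rewrite e; exact: measurable_cst.
  by rewrite e integral0 measure0 mule0.
pose B j := Q `&` [set x | dyad n x = v j].
have mB j : measurable (B j) by apply: measurableI => //; exact: measurable_dyad.
have BQ j : B j `<=` Q by exact: subIsetl.
have Bd i j x : B i x -> B j x -> i = j by move=> [_ /= h1] [_ /= h2]; apply: iv; rewrite -h1.
have eB : dyad_rectangle n v = [set t | forall j, B j (tnth t j)] by [].
rewrite eB; have [h1 h2] := measurable_perm_count_rectangle mB BQ Bd.
by split => //; exact: measurable_rectangle.
Qed.

Lemma dyad_separate (t : k.-tuple point) : injective (tnth t) ->
  exists n0, forall n, (n0 <= n)%N -> injective [ffun j => dyad n (tnth t j)].
Proof.
move=> it.
have h (z : 'I_k * 'I_k) : exists n0, z.1 <> z.2 -> forall n, (n0 <= n)%N ->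
    dyad n (tnth t z.1) <> dyad n (tnth t z.2).
  have [->|ij] := eqVneq z.1 z.2; first by exists 0%N.
  have [n0 hn0] := @dyad_neq R d (tnth t z.1) (tnth t z.2) (fun e => negP ij (introT eqP (it _ _ e))).
  by exists n0.
have [g hg] := choice h.
exists (\max_z g z) => n hn i j; rewrite !ffunE => e; apply: contrapT => ij.
by apply: (hg (i, j) ij n) e; apply: leq_trans hn; exact: leq_bigmax.
Qed.

(** The sets whose trace is generated form a sigma-algebra, so half-spaces suffice. A strict
    inequality persists on all small enough dyadic rectangles around a tuple, and distinct points
    eventually get distinct cells, so the trace of a half-space is a countable union of rectangles
    of the family. *)
Lemma simple_tuples_trace A : measurable A -> <<s dyad_rectangles >> (A `&` simple_tuples).
Proof.
have sG := smallest_sigma_algebra setT dyad_rectangles.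
have [G0 GC GU] := sG.
have GI (A1 A2 : set (k.-tuple point)) : <<s dyad_rectangles >> A1 -> <<s dyad_rectangles >> A2 -> <<s dyad_rectangles >> (A1 `&` A2).
  move=> h1 h2; rewrite -(setCK (A1 `&` A2)) setCI -setTD; apply: (GC).
  rewrite (_ : _ `|` _ = \bigcup_i (if i == 0%N then ~` A1 else ~` A2)); last first.
    apply/seteqP; split => x /=; first by move=> [h|h]; [exists 0%N|exists 1%N].
    by move=> [n _]; case: eqP => _ h; [left|right].
  by apply: GU => i; case: ifP => _; rewrite -setTD; exact: GC.
(* every simple tuple lies in small dyadic rectangles with distinct cells *)
have cover (D : set (k.-tuple point)) : D `<=` simple_tuples ->
    (forall t, D t -> exists n0, forall n, (n0 <= n)%N -> dyad_rectangle n [ffun j => dyad n (tnth t j)] `<=` D) ->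
    <<s dyad_rectangles >> D.
  move=> DV hD.
  pose W (z : nat * {ffun 'I_k -> 'rV[int]_d}) : set (k.-tuple point) :=
    if `[< injective z.2 /\ dyad_rectangle z.1 z.2 `<=` D >] then dyad_rectangle z.1 z.2 else set0.
  rewrite (_ : D = \bigcup_z W z).
    apply: sigma_algebra_countable_bigcup => // -[n v]; rewrite /W/=.
    case: asboolP => [[iv _]|_]; last exact: G0.
    by apply: sub_sigma_algebra; right; exists n, v.
  apply/seteqP; split => t.
    move=> Dt; have [Qt it] := DV _ Dt; have [n0 h0] := hD _ Dt; have [n1 h1] := dyad_separate it.
    pose n := maxn n0 n1; exists (n, [ffun j => dyad n (tnth t j)]) => //.
    rewrite /W/=; case: asboolP => [_ j|]; first by rewrite ffunE.
    by case; split; [apply: h1; exact: leq_maxr|apply: h0; exact: leq_maxl].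
  by move=> [z _]; rewrite /W; case: asboolP => // -[_ h] ht; exact: h.
have GV : <<s dyad_rectangles >> simple_tuples.
  apply: cover => // t [Qt it]; have [n1 h1] := dyad_separate it; exists n1 => n /h1 inj t' ht'.
  split=> [j|i j e]; first by case: (ht' j).
  apply: inj; rewrite !ffunE; have [_] := ht' i; have [_] := ht' j.
  by rewrite !ffunE e => -> ->.
move=> mA; suff : measurable `<=` [set A : set (k.-tuple point) | <<s dyad_rectangles >> (A `&` simple_tuples)] by apply.
apply: tuple_rV_measurable_sub.
  split=> /=.
  - by rewrite set0I.
  - move=> B GB; rewrite (_ : _ `&` _ = simple_tuples `&` ~` (B `&` simple_tuples)).
      by apply: GI => //; rewrite -setTD; exact: GC.
    rewrite setTD; apply/seteqP; split => x /=; first by move=> [h1 h2]; split=> // -[].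
    by move=> [h1 h2]; split=> // Bx; apply: h2.
  - by move=> F GF; rewrite setI_bigcupl; exact: GU.
move=> j i c /=; apply: cover; first by move=> t [].
move=> t [/= tc [Qt it]]; have [n1 h1] := dyad_separate it.
have [n0 h0] := dyad_lt tc; exists (maxn n0 n1) => n.
rewrite geq_max => /andP[n0n n1n] t' ht'; split => /=.
  by apply: (h0 n n0n); have [_] := ht' j; rewrite ffunE.
split=> [j'|i' j' e]; first by case: (ht' j').
apply: (h1 n n1n); rewrite !ffunE; have [_] := ht' i'; have [_] := ht' j'.
by rewrite !ffunE e => -> ->.
Qed.

Lemma listing_simple w sg : N w = k -> simple_tuples (listing w sg).
Proof.
rewrite npoints_config// => Nk.
have sk : size (config w) = k.
  rewrite -[RHS]Nk -size_filter; congr size; apply/esym/all_filterP/allP => x xc.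
  by apply/asboolP; exact: (config_mem xc).
split=> [j|i j]; rewrite !tnth_mktuple.
  by apply: (@config_mem w); rewrite mem_nth// sk.
move=> /eqP; rewrite nth_uniq ?sk ?fset_uniq// => /eqP e.
by apply: (@perm_inj _ sg); exact: val_inj.
Qed.

Lemma perm_count_simple A : perm_count A = perm_count (A `&` simple_tuples).
Proof.
apply/funext => w; rewrite /perm_count; case: eqP => // Nk; apply: eq_bigr => sg _.
rewrite !indicE in_setI; rewrite (_ : _ \in simple_tuples = true) ?andbT//.
exact/mem_set/listing_simple.
Qed.

Lemma perm_count_classP A : measurable A -> perm_count_class A.
Proof.
have sub : <<s dyad_rectangles >> `<=` perm_count_class.
  apply: lambda_system_subset => //.
  - exact: dyad_rectanglesI.
  - exact: lambda_system_perm_count.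
  - exact: dyad_rectangles_class.
have k0 : 0 < expR (- kappa) * kappa ^+ k :> R.
  by rewrite mulr_gt0 ?expR_gt0// exprn_gt0// mulr_gt0// exprn_gt0.
have mV : measurable simple_tuples by case: (sub _ (simple_tuples_trace measurableT)); rewrite setTI.
(* That uniform points are almost surely distinct comes for free: [perm_count] takes the same values
   on the full space and on [simple_tuples], both sets are in the class, and the common factor is
   not 0. *)
have lawV : tuple_law simple_tuples = 1%E.
  have [_ _ iV] := sub _ (simple_tuples_trace measurableT).
  have [_ [_ _ iT] _ _] := lambda_system_perm_count.
  move: iV; rewrite -perm_count_simple iT setTI [X in (_ * X)%E = _](@probability_setT _ _ _ tuple_law).
  have /fineK <- : tuple_law simple_tuples \is a fin_num by rewrite fin_num_measure.
  by move=> [/(mulfI (lt0r_neq0 k0)) <-].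
have lawVC : tuple_law (~` simple_tuples) = 0%E.
  by rewrite [LHS](@probability_setC _ _ _ tuple_law)// lawV subee.
move=> mA; have [mAV fAV iAV] := sub _ (simple_tuples_trace mA).
split => //; first by rewrite perm_count_simple.
rewrite perm_count_simple iAV; congr (_ * _)%E; apply/eqP; rewrite eq_le; apply/andP; split.
  exact: (le_measure _ (mem_set mAV) (mem_set mA) (@subIsetl _ _ _)).
apply: (@le_trans _ _ (tuple_law ((A `&` simple_tuples) `|` ~` simple_tuples))).
  apply: (le_measure _ (mem_set mA) (mem_set (measurableU _ _ mAV (measurableC mV)))).
  by move=> t At; have [Vt|nVt] := pselect (simple_tuples t); [left|right].
apply: (le_trans (measureU2 tuple_law mAV (measurableC mV))).
by rewrite [X in (_ + X <= _)%E]lawVC adde0.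
Qed.

(* perm_count of a symmetric set counts each of the k! orderings. *)
Lemma config_law (F : {fset point} -> R) (B : set R) :
  seq_measurable (fun l => F [fset y in l]%fset) -> measurable B ->
  measurable (N @^-1` [set k] `&` [set w | B (F (config w))]) /\
  PH (N @^-1` [set k] `&` [set w | B (F (config w))]) =
  ((expR (- kappa) * kappa ^+ k / k`!%:R)%:E *
   tuple_law [set t : k.-tuple point | B (F [fset y in (t : seq point)]%fset)])%E.
Proof.
move=> mF mB; set E := _ `&` _; set A : set (k.-tuple point) := [set t | _].
have mA : measurable A.
  by rewrite -[X in measurable X]setTI; exact: (measurable_fun_tuple (k := k) mF).
have pE : perm_count A = fun w => k`!%:R * \1_E w.
  apply/funext => w; rewrite /perm_count indicE.
  have [Nk|Nk] := eqVneq (N w) k; last first.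
    by rewrite (_ : _ \in E = false) ?mulr0//; apply/negP => /set_mem[/= h]; move/eqP: Nk.
  have sk : size (config w) = k.
    rewrite -[RHS]Nk npoints_config// -size_filter; congr size; apply/esym/all_filterP/allP => x xc.
    by apply/asboolP; exact: (config_mem xc).
  have lE sg : [fset y in (listing w sg : seq point)]%fset = config w.
    apply/fsetP => x; rewrite in_fset; apply/mapP/idP => [[i _ ->]|xc].
      by rewrite mem_nth// sk.
    have ix : (index x (config w) < k)%N by rewrite -[X in (_ < X)%N]sk index_mem.
    exists (sg^-1 (Ordinal ix))%g; first exact: mem_enum.
    by rewrite permKV nth_index.
  rewrite (eq_bigr (fun=> (w \in E)%:R)); last first.
    move=> sg _; rewrite indicE; congr (_%:R); congr nat_of_bool.
    apply/idP/idP => /set_mem /= h; apply/mem_set; first by split=> //=; rewrite -(lE sg).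
    by rewrite /A/= lE; case: h.
  by rewrite sumr_const -[#|_|]/#|'S_k| card_Sn mulr_natl.
have kf : k`!%:R != 0 :> R by rewrite pnatr_eq0 -lt0n fact_gt0.
have [_ fA iA] := perm_count_classP mA.
have mE : measurable E.
  have e : \1_E = (fun w => k`!%:R^-1 * perm_count A w) :> (OmegaH -> R).
    by apply/funext => w; rewrite pE mulrA mulVf// mul1r.
  by apply/(measurable_indicP R); rewrite e; exact: measurable_funM.
split=> //; move: iA; rewrite pE.
under eq_integral do rewrite EFinM.
rewrite ge0_integralZl//; last by apply/measurable_EFinP; exact: measurable_indic.
rewrite integral_indic// setIT => iA.
have -> : PH E = ((k`!%:R^-1)%:E * (k`!%:R%:E * PH E))%E by rewrite muleA -EFinM mulVf// mul1e.
by rewrite [X in (_ * X)%E = _]iA muleA -EFinM [_^-1 * _]mulrC.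
Qed.

End fixed_size.

Section expectation.
Variable F : {fset point} -> R.
Hypotheses (F_ge0 : forall Y, 0 <= F Y) (aF : admissible (fun l => F [fset y in l]%fset)).
Local Notation kappa := (lambda * s ^+ d).

Lemma measurable_config : measurable_fun setT (F \o config).
Proof.
move=> _ B mB; rewrite setTI.
rewrite (_ : _ @^-1` _ = \bigcup_k (N @^-1` [set k] `&` [set w | B (F (config w))])).
  by apply: bigcupT_measurable => k; have [] := config_law k aF.1 mB.
apply/seteqP; split => w /=; first by move=> Bw; exists (N w).
by move=> [k _ []].
Qed.

(** The law of [F \o config] is the Poisson mixture over [k] of the laws of [F] at [k] uniform
    points of the cube. It is written as a series of measures on the line, along which the integral
    of a non-negative function can be summed. *)
Lemma expectation_config :
  ('E_PH[F \o config] = \sum_(k <oo) ((expR (- kappa) * kappa ^+ k / k`!%:R) *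
     mean_sample 1 (@unif_cube R d) k (fun l => F [fset y in [seq to_cell corner s x | x <- l]]%fset))%:E)%E.
Proof.
pose mZ : {mfun OmegaH >-> R} := HB.pack (F \o config) (isMeasurableFun.Build _ _ _ _ _ measurable_config).
have w0 k : 0 <= expR (- kappa) * kappa ^+ k / k`!%:R.
  by rewrite mulr_ge0 ?invr_ge0// mulr_ge0 ?expR_ge0// exprn_ge0// mulr_ge0 ?(ltW lambda_gt0)// exprn_ge0// ltW.
have mFk k : measurable_fun setT (fun t : k.-tuple point => F [fset y in (t : seq point)]%fset).
  exact: (measurable_fun_tuple (k := k) aF.1).
pose FM k : {mfun k.-tuple point >-> R} := HB.pack (fun t : k.-tuple point => F [fset y in (t : seq point)]%fset) (isMeasurableFun.Build _ _ _ _ _ (mFk k)).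
pose nu k : {measure set R -> \bar R} := mscale (NngNum (w0 k)) (distribution (tuple_law k) (FM k)).
have lawE A : measurable A -> distribution PH mZ A = mseries nu 0 A.
  move=> mA; rewrite /distribution /pushforward.
  rewrite (_ : mZ @^-1` A = \bigcup_k (N @^-1` [set k] `&` [set w | A (F (config w))])); last first.
    apply/seteqP; split => w /=; first by move=> Bw; exists (N w).
    by move=> [k _ []].
  rewrite measure_bigcup//; last 2 first.
  - by move=> k _; have [] := config_law k aF.1 mA.
  - by move=> i j _ _ [w [/= [<- _] [<- _]]].
  rewrite (eq_eseriesl (Q := xpredT)); last by move=> k; rewrite in_setT.
  by apply: eq_eseriesr => k _; have [_ h] := config_law k aF.1 mA; exact: h.
(* Integrals against a series of measures are summed for non-negative functions, so the absolute
   value replaces the identity; on values of [F] the two agree. *)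
have mh : measurable_fun setT (fun x : R => (`|x|)%:E).
  by apply/measurable_EFinP; exact: normr_measurable.
transitivity (\int[distribution PH mZ]_x (`|x|)%:E)%E.
  rewrite unlock ge0_integral_distribution//; apply: eq_integral => w _ /=.
  by rewrite ger0_norm.
rewrite (eq_measure_integral (mseries nu 0)); last by move=> A mA _; exact: lawE.
rewrite ge0_integral_measure_series//; apply: eq_eseriesr => k _.
rewrite ge0_integral_mscale// ge0_integral_distribution//.
rewrite [RHS]EFinM; congr (_ * _)%E.
rewrite /tuple_law /= ge0_integral_distribution//; last exact: (measurableT_comp mh (mFk k)).
rewrite -integral_prod_tuple; last exact: (admissible_map (F := fun l => F [fset y in l]%fset) (measurable_to_cell corner s) aF).
apply: eq_integral => t _ /=; rewrite ger0_norm//; congr (F _)%:E.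
rewrite (_ : [seq to_cell corner s x | x <- t] = [seq to_cell corner s (tnth t i) | i <- enum 'I_k])//.
by rewrite -{1}(map_tnth_enum t) -map_comp.
Qed.

End expectation.
End point_process_law.

(** * The binomial to Poisson limit *)

Section poisson_limit.
Context {R : realType}.

Lemma cvg_sum_ord (a : nat -> nat -> R) (b : nat -> R) m :
  (forall k, a n k @[n --> \oo] --> b k) ->
  \sum_(k < m) a n k @[n --> \oo] --> \sum_(k < m) b k.
Proof.
move=> ab; elim: m => [|m IH].
  by rewrite big_ord0; under eq_fun do rewrite big_ord0; exact: cvg_cst.
by rewrite big_ord_recr/=; under eq_fun do rewrite big_ord_recr/=; exact: cvgD.
Qed.

(** Dominated convergence for sums whose range grows with [n], the form in which binomial means
    arise. Both tails beyond a fixed [m] are bounded by the tail of the series of [D]. *)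
Lemma tannery (a : nat -> nat -> R) (b D : nat -> R) :
  (forall n k, `|a n k| <= D k) -> cvgn (series D) ->
  (forall k, a n k @[n --> \oo] --> b k) ->
  \sum_(k < n.+1) a n k @[n --> \oo] --> limn (series b).
Proof.
move=> aD cD ab.
have bD k : `|b k| <= D k.
  have c1 : `|a n k| @[n --> \oo] --> `|b k| by apply: cvg_norm; exact: ab.
  rewrite -(cvg_lim (@Rhausdorff R) c1); apply: limr_le; first by apply/cvg_ex; exists `|b k|.
  by apply: nearW => n; exact: aD.
have D0 k : 0 <= D k := le_trans (normr_ge0 _) (bD k).
have cb : cvgn (series b).
  by apply: normed_cvg; exact: (@series_le_cvg _ (fun k => `|b k|) D).
have ndD : nondecreasing_seq (series D).
  by apply/nondecreasing_seqP => n; rewrite -subr_ge0 seriesSB.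
have tailD m n : (m <= n)%N -> series D n - series D m <= limn (series D) - series D m.
  by move=> mn; rewrite lerB//; exact: nondecreasing_cvgn_le.
have tail_b m : `|limn (series b) - series b m| <= limn (series D) - series D m.
  have c1 : `|series b n - series b m| @[n --> \oo] --> `|limn (series b) - series b m|.
    by apply: cvg_norm; apply: cvgB => //; exact: cvg_cst.
  rewrite -(cvg_lim (@Rhausdorff R) c1); apply: limr_le; first by apply/cvg_ex; exists `|limn (series b) - series b m|.
  exists m => // n /= mn; apply: le_trans (tailD _ _ mn).
  by rewrite !sub_series_geq//; apply: (le_trans (ler_norm_sum _ _ _)); apply: ler_sum.
have tail_a m n : (m <= n.+1)%N -> `|\sum_(k < n.+1) a n k - \sum_(k < m) a n k| <= limn (series D) - series D m.
  move=> mn; apply: le_trans (tailD _ _ mn).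
  have -> : \sum_(k < n.+1) a n k = series (a n) n.+1 by rewrite seriesEord.
  have -> : \sum_(k < m) a n k = series (a n) m by rewrite seriesEord.
  by rewrite !sub_series_geq//; apply: (le_trans (ler_norm_sum _ _ _)); apply: ler_sum.
have tail0 : limn (series D) - series D m @[m --> \oo] --> 0.
  by rewrite -(subrr (limn (series D))); apply: cvgB => //; exact: cvg_cst.
apply/cvgrPdist_le => e e0.
have [m _ /(_ m (leqnn m))/= hm] : \forall m \near \oo, `|limn (series D) - series D m| <= e / 3.
  have /cvgr0Pnorm_le := tail0; apply; lra.
have cm : \sum_(k < m) a n k @[n --> \oo] --> series b m.
  by rewrite seriesEord; exact: cvg_sum_ord.
have /cvgrPdist_le/(_ (e / 3)) := cm; case; first lra.
move=> n0 _ hn0; exists (maxn m n0) => // n /=; rewrite geq_max => /andP[mn n0n].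
have h1 := tail_b m; have h2 := tail_a m n (leq_trans mn (leqnSn n)); have h3 := hn0 n n0n.
have h4 := le_trans (ler_norm _) hm.
rewrite (_ : _ - _ = (limn (series b) - series b m) + (series b m - \sum_(k < m) a n k) -
   (\sum_(k < n.+1) a n k - \sum_(k < m) a n k)); last by ring.
rewrite (le_trans (ler_normB _ _))// (le_trans (lerD (ler_normD _ _) (lexx _)))//.
move: h3 => /= h3; lra.
Qed.

Definition poisson_weight (a : R) (k : nat) : R := expR (- a) * a ^+ k / k`!%:R.

(** The upper bound depends on [n] only through [n * p], which stays bounded; it supplies the
    dominating series. *)
Lemma binomial_weight_le n (p : R) k : 0 <= p <= 1 ->
  0 <= binomial_weight n p k <= (n%:R * p) ^+ k / k`!%:R.
Proof.
move=> /andP[p0 p1]; have q0 : 0 <= 1 - p by lra.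
rewrite /binomial_weight; apply/andP; split; first by rewrite !mulr_ge0 ?exprn_ge0.
have fk : (n ^_ k <= n ^ k)%N.
  by elim: k => [//|k IH]; rewrite ffactnSr expnSr leq_mul// leq_subr.
have Ck : 'C(n, k)%:R * k`!%:R <= n%:R ^+ k :> R by rewrite -natrM -natrX ler_nat bin_ffact.
have q1 : (1 - p) ^+ (n - k) <= 1 by rewrite exprn_ile1//; lra.
rewrite ler_pdivlMr ?ltr0n ?fact_gt0// exprMn.
rewrite [leLHS](_ : _ = ('C(n, k)%:R * k`!%:R) * p ^+ k * (1 - p) ^+ (n - k)); last by ring.
rewrite -[leRHS]mulr1; apply: ler_pM => //; rewrite ?mulr_ge0 ?exprn_ge0//.
by rewrite ler_wpM2r// exprn_ge0.
Qed.

Lemma cvg_intensity0 (p : nat -> R) (kappa : R) :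
  n%:R * p n @[n --> \oo] --> kappa -> p n @[n --> \oo] --> 0.
Proof.
move=> ck.
have h : n.+1%:R * p n.+1 @[n --> \oo] --> kappa.
  by move: ck; rewrite -(cvg_shiftS (fun n => n%:R * p n)).
have h0 : n.+1%:R * p n.+1 * harmonic n @[n --> \oo] --> kappa * 0.
  by apply: cvgM => //; exact: cvg_harmonic.
suff : p n.+1 @[n --> \oo] --> (0 : R) by rewrite (cvg_shiftS p).
move: h0; rewrite mulr0.
rewrite (_ : (fun n => _) = fun n => p n.+1)//; apply/funext => n.
by rewrite /harmonic /= mulrAC mulfV ?mul1r// pnatr_eq0.
Qed.

(** The power is squeezed between [expR (- n p / (1 - p))] and [expR (- n p)]; both bounds follow
    from [1 + y <= expR y]. *)
Lemma cvg_bernoulli_power (p : nat -> R) (kappa : R) : (forall n, 0 <= p n <= 1) ->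
  n%:R * p n @[n --> \oo] --> kappa -> (1 - p n) ^+ n @[n --> \oo] --> expR (- kappa).
Proof.
move=> p01 ck; have p0 := cvg_intensity0 ck.
have q1 : 1 - p n @[n --> \oo] --> (1 : R).
  by have h : 1 - p n @[n --> \oo] --> (1 - 0 : R); [apply: cvgB => //; exact: cvg_cst|move: h; rewrite subr0].
have qV : (1 - p n)^-1 @[n --> \oo] --> (1 : R).
  by have h : (1 - p n)^-1 @[n --> \oo] --> (1^-1 : R); [apply: cvgV => //; exact: oner_neq0|move: h; rewrite invr1].
have cexp (u : nat -> R) l : u n @[n --> \oo] --> l -> expR (u n) @[n --> \oo] --> expR l.
  by move=> cu; exact: (continuous_cvg _ (@continuous_expR R l) cu).
apply: (@squeeze_cvgr _ _ _ _ (fun n => expR (- (n%:R * p n * (1 - p n)^-1))) (fun n => expR (- (n%:R * p n)))).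
- have /cvgrPdist_lt/(_ 2^-1) := p0; case; first by rewrite invr_gt0.
  move=> n0 _ hn0; exists n0 => // n /hn0 /=; rewrite sub0r normrN => pn.
  have /andP[pn0 _] := p01 n; move: pn; rewrite ger0_norm// => pn.
  have q0 : 0 < 1 - p n by lra.
  apply/andP; split.
    rewrite -mulrA -mulrN expRM_natl lerXn2r// ?nnegrE ?expR_ge0 ?(ltW q0)//.
    rewrite expRN -[leRHS]invrK lef_pV2 ?posrE ?invr_gt0 ?expR_gt0//.
    apply: le_trans (expR_ge1Dx _); rewrite -(ler_pM2r q0) mulVf ?gt_eqF//.
    by rewrite mulrDl mul1r mulfVK ?gt_eqF// subrK.
  rewrite -mulrN expRM_natl lerXn2r// ?nnegrE ?expR_ge0 ?(ltW q0)//.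
  exact: expR_ge1Dx.
- apply: cexp; apply: cvgN.
  by have h : n%:R * p n * (1 - p n)^-1 @[n --> \oo] --> kappa * 1; [exact: cvgM|move: h; rewrite mulr1].
- by apply: cexp; exact: cvgN.
Qed.

(** Induction on [k] through the ratio of consecutive weights, [(n - k) * p / ((1 - p) * (k + 1))],
    which tends to [kappa / (k + 1)]. *)
Lemma cvg_binomial_weight (p : nat -> R) (kappa : R) k : (forall n, 0 <= p n <= 1) ->
  n%:R * p n @[n --> \oo] --> kappa ->
  binomial_weight n (p n) k @[n --> \oo] --> poisson_weight kappa k.
Proof.
move=> p01 ck; have p0 := cvg_intensity0 ck.
have q1 : 1 - p n @[n --> \oo] --> (1 : R).
  by have h : 1 - p n @[n --> \oo] --> (1 - 0 : R); [apply: cvgB => //; exact: cvg_cst|move: h; rewrite subr0].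
have qV : (1 - p n)^-1 @[n --> \oo] --> (1 : R).
  by have h : (1 - p n)^-1 @[n --> \oo] --> (1^-1 : R); [apply: cvgV => //; exact: oner_neq0|move: h; rewrite invr1].
elim: k => [|k IH].
  rewrite /poisson_weight expr0 mulr1 fact0 divr1 /binomial_weight.
  under eq_fun do rewrite bin0 expr0 !mul1r subn0.
  exact: cvg_bernoulli_power.
have -> : poisson_weight kappa k.+1 = poisson_weight kappa k * ((kappa - k%:R * 0) * 1 * k.+1%:R^-1).
  by rewrite /poisson_weight factS natrM invfM exprS; ring.
have step : binomial_weight n (p n) k * ((n%:R * p n - k%:R * p n) * (1 - p n)^-1 * k.+1%:R^-1) @[n --> \oo] -->
    poisson_weight kappa k * ((kappa - k%:R * 0) * 1 * k.+1%:R^-1).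
  apply: cvgM => //; apply: cvgM; last exact: cvg_cst.
  by apply: cvgM => //; apply: cvgB => //; apply: cvgM => //; exact: cvg_cst.
apply: cvg_trans step; apply: near_eq_cvg.
have /cvgrPdist_lt/(_ 2^-1) := p0; case; first by rewrite invr_gt0.
move=> n0 _ hn0; exists (maxn n0 k.+1) => // n /=; rewrite geq_max => /andP[/hn0 /= + kn].
rewrite sub0r normrN => pn.
have /andP[pn0 _] := p01 n; move: pn; rewrite ger0_norm// => pn.
have q0 : 1 - p n != 0 by rewrite gt_eqF//; lra.
have k0 : k.+1%:R != 0 :> R by rewrite pnatr_eq0.
rewrite /binomial_weight -(subnSK kn).
have := mul_bin_left n k; move=> /(congr1 (fun z => z%:R : R)); rewrite !natrM natrB ?(ltnW kn)// => e.
have -> : 'C(n, k.+1)%:R = (n%:R - k%:R) * 'C(n, k)%:R / k.+1%:R :> R by rewrite -e mulrAC mulfV// mul1r.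
by rewrite !exprS; field; rewrite ?nat1r ?q0 ?k0.
Qed.

Lemma cvg_binomial_sum (p : nat -> R) (kappa C : R) (U : nat -> R) :
  (forall n, 0 <= p n <= 1) -> n%:R * p n @[n --> \oo] --> kappa ->
  (forall k, `|U k| <= C * k%:R) ->
  \sum_(k < n.+1) binomial_weight n (p n) k * U k @[n --> \oo] -->
    limn (series (fun k => poisson_weight kappa k * U k)).
Proof.
move=> p01 ck UC.
have C0 : 0 <= C by have := le_trans (normr_ge0 _) (UC 1%N); rewrite mulr1.
have [M hM] : exists M, forall n, `|n%:R * p n| <= M.
  have : bounded_fun (fun n => n%:R * p n) by apply: cvg_seq_bounded; apply/cvg_ex; exists kappa.
  move=> [M0 [_ hM0]]; exists (M0 + 1) => n.
  by apply: hM0 => //; rewrite ltrDl.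
(* The linear growth of [U] is absorbed by [k <= 2 ^ k], so the exponential series at [2 * M]
   dominates, where [M] bounds [n * p n]. *)
apply: (@tannery (fun n k => binomial_weight n (p n) k * U k) (fun k => poisson_weight kappa k * U k) (fun k => C * exp_coeff (2 * M) k)).
- move=> n k; rewrite normrM.
  have /andP[b0 b1] := binomial_weight_le n k (p01 n).
  rewrite (ger0_norm b0).
  apply: (@le_trans _ _ (M ^+ k / k`!%:R * (C * k%:R))).
    rewrite ler_pM// (le_trans b1)// ler_wpM2r ?invr_ge0//.
    rewrite lerXn2r// ?nnegrE; last by apply: le_trans (hM n); exact: ler_norm.
      by case/andP: (p01 n) => ? _; rewrite mulr_ge0.
    exact: le_trans (normr_ge0 _) (hM n).
  rewrite /exp_coeff /= exprMn (_ : _ * (C * k%:R) = C * (k%:R * (M ^+ k / k`!%:R))); last by ring.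
  rewrite ler_wpM2l// [leRHS](_ : _ = 2 ^+ k * (M ^+ k / k`!%:R)); last by ring.
  rewrite ler_wpM2r//.
    by rewrite divr_ge0// exprn_ge0//; exact: le_trans (normr_ge0 _) (hM n).
  by rewrite -natrX ler_nat ltnW// ltn_expl.
- rewrite (_ : (fun k => _) = C *: exp_coeff (2 * M)); last by apply/funext => k.
  apply: is_cvg_seriesZ; exact: is_cvg_series_exp_coeff.
- by move=> k; apply: cvgMl; exact: cvg_binomial_weight.
Qed.

End poisson_limit.

(** * Comparing a law on a cell with the uniform law *)

Section domination.
Context {R : realType} {d : nat}.
Local Notation point := 'rV[R]_d.
Local Notation unif := (@unif_cube R d).

Lemma to_cell_preimage (a : point) (l : R) : 0 < l ->
  to_cell a l @^-1` (cell a l) = cell 0 1.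
Proof.
move=> l0; apply/seteqP; split => x /= h i; have := h i; rewrite !mxE add0r.
  by rewrite lerDl ltrD2l pmulr_rge0// gtr_pMr.
by rewrite lerDl ltrD2l pmulr_rge0// gtr_pMr.
Qed.

Lemma unif_cubeI (A : set point) : unif (A `&` cell 0 1) = unif A.
Proof. by rewrite /unif_cube /mrestr -setIA setIid. Qed.

Lemma ge0_integral_dominated (m1 m2 th : {measure set point -> \bar R}) (D : set point)
    (f : point -> \bar R) : measurable D -> measurable_fun setT f -> (forall x, 0 <= f x)%E ->
  (forall A, measurable A -> A `<=` D -> (m1 A <= m2 A + th A)%E) ->
  (\int[m1]_(x in D) f x <= \int[m2]_(x in D) f x + \int[th]_(x in D) f x)%E.
Proof.
move=> mD mf f0 h.
have rE (m : {measure set point -> \bar R}) :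
    (\int[m]_(x in D) f x = \int[mrestr m mD]_(x in D) f x)%E.
  apply: eq_measure_integral => A mA AD.
  by rewrite [RHS](_ : _ = m (A `&` D)) // (setIidl AD).
rewrite (rE m1) (rE m2) (rE th) -ge0_integral_measure_add//; last exact: measurable_funTS.
apply: ge0_le_measure_integral => // S mS.
have := measure_addE (mrestr m2 mD) (mrestr th mD) S. move=> e; rewrite [leRHS]e. apply: h; first exact: measurableI.
exact: subIsetr.
Qed.

Lemma abs_shift (p q I J C M t : R) : 0 <= C ->
  p * M <= q + t -> q <= p * M + t ->
  p * (I + C * M) <= q * (J + C) + 2 * C * t ->
  q * (J + C) <= p * (I + C * M) + 2 * C * t -> `|p * I - q * J| <= 3 * C * t.
Proof.
move=> C0 k3 k4 k1 k2.
have k5 : C * (p * M) <= C * (q + t) by rewrite ler_wpM2l.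
have k6 : C * q <= C * (p * M + t) by rewrite ler_wpM2l.
by rewrite ler_norml; apply/andP; split; lra.
Qed.

(** Inequalities between measures pass to integrals of non-negative functions, so [h] is replaced by
    [h + C], which lies between 0 and [2 * C] and costs [2 * C * t]. Taking the constant out again
    compares the masses of the cell and costs [C * t] more, whence the factor 3. *)
Lemma cell_close (m : probability point R) (p q : R) (a : point) (l C t : R)
    (th : {measure set point -> \bar R}) (h : point -> R) :
  0 <= p -> 0 <= q -> 0 < l -> 0 <= C -> th (cell a l) = t%:E ->
  (forall A, measurable A -> A `<=` cell a l ->
    (p%:E * m A <= q%:E * unif (to_cell a l @^-1` A) + th A)%E) ->
  (forall A, measurable A -> A `<=` cell a l ->
    (q%:E * unif (to_cell a l @^-1` A) <= p%:E * m A + th A)%E) ->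
  measurable_fun setT h -> (forall x, `|h x| <= C) ->
  `|p * (\int[m]_(x in cell a l) h x)%R - q * (\int[unif]_y h (to_cell a l y))%R| <= 3 * C * t.
Proof.
move=> p0 q0 l0 C0 tht h12 h21 mh hC; set D := cell a l.
have mD : measurable D by exact: measurable_cell.
have ma := measurable_to_cell a l.
pose aff : {mfun point >-> point} := HB.pack (to_cell a l) (isMeasurableFun.Build _ _ _ _ _ ma).
pose m1 : {measure set point -> \bar R} := mscale (NngNum p0) m.
pose m2 : {measure set point -> \bar R} := mscale (NngNum q0) (distribution unif aff).
pose f x := h x + C.
have mf : measurable_fun setT f by apply: measurable_funD.
have mfE : measurable_fun setT (EFin \o f) by exact/measurable_EFinP.
have f0 x : 0 <= f x by have := hC x; rewrite ler_norml /f => /andP[]; lra.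
have f0E x : (0 <= (EFin \o f) x)%E by rewrite lee_fin.
have f2 x : f x <= 2 * C by have := hC x; rewrite ler_norml /f => /andP[]; lra.
have bf x : `|f x| <= 2 * C by rewrite ger0_norm.
have i1 : m.-integrable D (EFin \o f) by exact: (bounded_integrable _ mD mf bf).
have mfg : measurable_fun setT (fun y => f (to_cell a l y)) by exact: (measurableT_comp mf ma).
have i2 : unif.-integrable setT (EFin \o (fun y => f (to_cell a l y))).
  exact: (bounded_integrable _ measurableT mfg).
have e1 : (\int[m1]_(x in D) (f x)%:E = (p * \int[m]_(x in D) f x)%:E)%E.
  rewrite ge0_integral_mscale//=; last 2 first.
  - exact: measurable_funTS.
  - by move=> x _; rewrite lee_fin.
  by rewrite EFinM /Rintegral fineK// integrable_fin_num.
have e2 : (\int[m2]_(x in D) (f x)%:E = (q * \int[unif]_y f (to_cell a l y))%:E)%E.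
  transitivity (\int[m2]_x (f x)%:E)%E.
    have z : m2 (~` D) = 0%E.
      have w : unif (aff @^-1` (~` D)) = 0%E.
        by rewrite -preimage_setC [X in ~` X](to_cell_preimage a l0) -unif_cubeI setICl measure0.
      by rewrite /m2 /= /mscale [X in (_ * X)%E]w mule0.
    have := ge0_negligible_integral (measurableC mD) measurableT mfE (fun x _ => f0E x) z.
    by rewrite setTD setCK => ->.
  rewrite (ge0_integral_mscale _ measurableT (NngNum q0) mfE (fun x _ => f0E x)) /=.
  rewrite [X in (_ * X)%E](ge0_integral_distribution aff mfE f0E).
  by rewrite EFinM /Rintegral fineK// integrable_fin_num.
have e3 : (\int[th]_(x in D) (f x)%:E <= (2 * C * t)%:E)%E.
  rewrite EFinM -tht -(integral_cst th mD); apply: ge0_le_integral => //.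
  - by move=> x _; rewrite lee_fin.
  - exact: measurable_funTS.
  - by move=> x _; rewrite lee_fin.
have := ge0_integral_dominated mD mfE f0E (m1 := m1) (m2 := m2) (th := th) h12.
have := ge0_integral_dominated mD mfE f0E (m1 := m2) (m2 := m1) (th := th) h21.
rewrite e1 e2 => k1 k2.
have {}k1 := le_trans k1 (leeD2l _ e3); have {}k2 := le_trans k2 (leeD2l _ e3).
move: k1 k2; rewrite -!EFinD !lee_fin.
have ma1 : p * fine (m D) <= q + t /\ q <= p * fine (m D) + t.
  have fD : m D = (fine (m D))%:E by rewrite fineK// fin_num_measure.
  have u1 : unif (to_cell a l @^-1` D) = 1%E.
    by rewrite to_cell_preimage// -[X in unif X]setTI unif_cubeI probability_setT.
  have := h12 D mD (fun _ h => h); have := h21 D mD (fun _ h => h).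
  by rewrite u1 fD tht mule1 -!EFinM -!EFinD !lee_fin => ? ?; split.
have -> : \int[m]_(x in D) f x = \int[m]_(x in D) h x + C * fine (m D).
  rewrite RintegralD//; first by rewrite Rintegral_cst.
    exact: (@bounded_integrable _ _ _ m h D C mD mh hC).
  exact: (@bounded_integrable _ _ _ m (cst C) D `|C| mD (measurable_cst _) (fun=> lexx _)).
have -> : \int[unif]_y f (to_cell a l y) = \int[unif]_y h (to_cell a l y) + C.
  have mh' : measurable_fun setT (fun y => h (to_cell a l y)) by exact: (measurableT_comp mh ma).
  rewrite RintegralD//; first by rewrite Rintegral_cstm.
    exact: (@bounded_integrable _ _ _ unif _ setT C measurableT mh').
  exact: (@bounded_integrable _ _ _ unif (cst C) setT `|C| measurableT (measurable_cst _) (fun=> lexx _)).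
move=> k1 k2; case: ma1 => k3 k4; exact: (abs_shift C0 k3 k4 k2 k1).
Qed.

End domination.

Lemma measure_partition {R : realType} {d} {T : measurableType d}
    (mu : {measure set T -> \bar R}) (I : eqType) (s : seq I) (F : I -> set T) (B : set T) :
  uniq s -> (forall i, measurable (F i)) -> measurable B ->
  (forall i, i \in s -> F i `<=` B) -> (forall i j x, F i x -> F j x -> i = j) ->
  measurable (B `&` [set x | ~~ has (fun i => `[< F i x >]) s]) /\
  mu B = (\sum_(i <- s) mu (F i) + mu (B `&` [set x | ~~ has (fun i => `[< F i x >]) s]))%E.
Proof.
move=> us mF mB FB Fd; elim: s us B mB FB => [|i s IH] /= us B mB FB.
  rewrite big_nil add0e (_ : [set x | _] = setT) ?setIT//.
  by apply/seteqP; split.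
case/andP: us => nis us.
have mBF : measurable (B `\` F i) by exact: measurableD.
have [|m1 e1] := IH us _ mBF.
  move=> j js x Fjx; split; first by apply: (FB j) => //; rewrite inE js orbT.
  by move=> Fix; move: nis; rewrite (Fd _ _ _ Fix Fjx) js.
have e : (B `\` F i) `&` [set x | ~~ has (fun i => `[< F i x >]) s] =
    B `&` [set x | ~~ (`[< F i x >] || has (fun i => `[< F i x >]) s)].
  apply/seteqP; split => x /=.
    by move=> [[Bx nF] hs]; split=> //; rewrite negb_or hs andbT; apply/asboolPn.
  by move=> [Bx]; rewrite negb_or => /andP[/asboolPn nF hs].
rewrite e in m1 e1; split=> //.
rewrite big_cons; etransitivity; first exact: (measureDI mu mB (mF i)).
by rewrite (setIidr (FB i _)) ?mem_head// [X in (X + _)%E]e1 addeC addeA.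
Qed.

(** * Cutting dyadic cubes into grid cells *)

Section grid.
Context {R : realType} {d : nat}.
Local Notation point := 'rV[R]_d.

Definition dyad_corner (m : nat) (v : 'rV[int]_d) : point := \row_i ((v ord0 i)%:~R / 2 ^+ m).

(** An index is a dyadic cube together with a position in a grid anchored at its corner. The side
    [l] will be dictated by the scale, so [K * l] is in general smaller than the side of the cube
    and a margin stays uncovered. *)
Definition grid_corner (m : nat) (l : R) K (i : 'rV[int]_d * {ffun 'I_d -> 'I_K}) : point :=
  dyad_corner m i.1 + l *: \row_q (i.2 q)%:R.

Definition grid_cell (m : nat) (l : R) K i : set point := cell (@grid_corner m l K i) l.

Lemma measurable_grid_cell m l K i : measurable (@grid_cell m l K i).
Proof. exact: measurable_cell. Qed.

Lemma cellP (a : point) l x : cell a l x <->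
  forall i, a ord0 i <= x ord0 i < a ord0 i + l.
Proof. by split=> h i; have := h i; rewrite !mxE. Qed.

Section inside.
Variables (m : nat) (l : R) (K : nat).
Hypotheses (l_gt0 : 0 < l) (Kl : K%:R * l <= 2 ^- m).

Lemma grid_cellP (i : 'rV[int]_d * {ffun 'I_d -> 'I_K}) x : grid_cell m l i x <->
  forall q, (i.1 ord0 q)%:~R / 2 ^+ m + (i.2 q)%:R * l <= x ord0 q <
            (i.1 ord0 q)%:~R / 2 ^+ m + (i.2 q).+1%:R * l.
Proof.
rewrite /grid_cell; split=> [/cellP|] h.
  by move=> q; have := h q; rewrite !mxE -[(i.2 q).+1%:R]natr1 mulrDl mul1r addrA [l * _]mulrC.
by apply/cellP => q; have := h q; rewrite !mxE -[(i.2 q).+1%:R]natr1 mulrDl mul1r addrA [l * _]mulrC.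
Qed.

Lemma grid_cell_dyad (i : 'rV[int]_d * {ffun 'I_d -> 'I_K}) x : grid_cell m l i x -> dyad m x = i.1.
Proof.
move=> /grid_cellP h; apply/dyadP => q; have /andP[h1 h2] := h q.
have p2 : 0 < 2 ^+ m :> R by rewrite exprn_gt0.
have k1 : (i.2 q).+1%:R * l <= 2 ^- m.
  by apply: le_trans Kl; rewrite ler_wpM2r ?ler_nat ?ltn_ord// ltW.
have k2 : 0 <= (i.2 q)%:R * l by rewrite mulr_ge0// ltW.
rewrite mulrC -ler_pdivrMr// -ltr_pdivlMr// intrD mulrDl mul1r.
by apply/andP; split; lra.
Qed.

Lemma grid_cell_inj (i j : 'rV[int]_d * {ffun 'I_d -> 'I_K}) x :
  grid_cell m l i x -> grid_cell m l j x -> i = j.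
Proof.
move=> hi hj; have ei := grid_cell_dyad hi; have ej := grid_cell_dyad hj.
case: i j hi hj ei ej => [v a] [w b] /= hi hj ei ej.
have vw : v = w by rewrite -ei ej.
rewrite vw in hi *; congr (_, _); apply/ffunP => q; apply/val_inj => /=.
move: hi hj => /grid_cellP/(_ q)/= /andP[h1 h2] /grid_cellP/(_ q)/= /andP[h3 h4].
have lt1 : (a q)%:R * l < (b q).+1%:R * l.
  by rewrite -(ltrD2l ((w ord0 q)%:~R / 2 ^+ m)); exact: le_lt_trans h4.
have lt2 : (b q)%:R * l < (a q).+1%:R * l.
  by rewrite -(ltrD2l ((w ord0 q)%:~R / 2 ^+ m)); exact: le_lt_trans h2.
move: lt1 lt2; rewrite !ltr_pM2r// !ltr_nat !ltnS => ab ba.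
by apply/eqP; rewrite eqn_leq ab ba.
Qed.

End inside.

(** Here the side is exactly a [K]-th of that of the dyadic cube, so no margin is left. This serves
    the cubes that carry the singular part, all of whose points have to be covered. *)
Lemma grid_cell_cover m K x : (0 < K)%N ->
  exists j : {ffun 'I_d -> 'I_K}, grid_cell m (2 ^- m / K%:R) (dyad m x, j) x.
Proof.
move=> K0; have p2 : 0 < 2 ^+ m :> R by rewrite exprn_gt0.
have K0' : 0 < K%:R :> R by rewrite ltr0n.
set l := 2 ^- m / K%:R; have l0 : 0 < l by rewrite divr_gt0// invr_gt0.
have /dyadP hd : dyad m x = dyad m x by [].
pose u q := x ord0 q - (dyad m x ord0 q)%:~R / 2 ^+ m.
have u0 q : 0 <= u q < 2 ^- m.
  have /andP[h1 h2] := hd q; move: h1 h2.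
  rewrite mulrC -ler_pdivrMr// -ltr_pdivlMr// intrD mulrDl mul1r /u => h1 h2.
  by apply/andP; split; lra.
have ul q : 0 <= u q / l by have /andP[? _] := u0 q; rewrite divr_ge0// ltW.
have tr q : (Num.truncn (u q / l) < K)%N.
  rewrite -(@ltr_nat R); apply: (@le_lt_trans _ _ (u q / l)).
    by have /andP[] := truncn_itv (ul q).
  rewrite ltr_pdivrMr// /l mulrCA divff ?mulr1 ?gt_eqF//.
  by have /andP[] := u0 q.
exists [ffun q => Ordinal (tr q)]; apply/grid_cellP => // q /=; rewrite ffunE /=.
have /andP[] := truncn_itv (ul q).
by rewrite ler_pdivlMr// ltr_pdivrMr// /u => h1 h2; apply/andP; split; lra.
Qed.

Definition grid_index K (Z : seq 'rV[int]_d) : seq ('rV[int]_d * {ffun 'I_d -> 'I_K}) :=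
  [seq (v, j) | v <- Z, j <- enum {ffun 'I_d -> 'I_K}].

Lemma grid_index_uniq K Z : uniq Z -> uniq (grid_index K Z).
Proof. by move=> uZ; apply: allpairs_uniq => //; [exact: enum_uniq | move=> [? ?] [? ?]]. Qed.

Lemma mem_grid_index K Z i : (i \in grid_index K Z) = (i.1 \in Z).
Proof.
apply/allpairsP/idP => [[[v j] /= [vZ _ ->]]//|iZ].
by exists i; split=> //; [rewrite mem_enum | case: i iZ].
Qed.

Lemma sum_grid_index (V : nmodType) K Z (f : 'rV[int]_d -> V) :
  \sum_(i <- grid_index K Z) f i.1 = \sum_(v <- Z) f v *+ (K ^ d).
Proof.
rewrite big_allpairs; apply: eq_bigr => v _ /=.
by rewrite big_enum /= sumr_const card_ffun !card_ord.
Qed.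

(** Without a layer of width [r] on each side, the remaining points are farther than [r] from the
    complement of the cell, strictly so because the sides are half-open. The layer is what P4 has to
    pay for. *)
Definition inner_cell (r l : R) (a : point) : set point := cell (a + const_mx r) (l - r *+ 2).

Lemma inner_cell_dist r l (a : point) x y : 0 <= r ->
  inner_cell r l a x -> ~ cell a l y -> r < euclid_dist x y.
Proof.
move=> r0 /cellP hx ny.
have [i hi] : exists i, ~~ (a ord0 i <= y ord0 i < a ord0 i + l).
  by apply: contrapT => /forallNP h; apply: ny; apply/cellP => i; have /negP := h i; rewrite negbK.
have h : r < `|x ord0 i - y ord0 i|.
  have := hx i; rewrite !mxE => /andP[h1 h2]; move: hi; rewrite negb_and -!ltNge.
  case/orP => h; [apply: lt_le_trans (ler_norm _) | rewrite distrC; apply: lt_le_trans (ler_norm _)]; lra.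
apply: lt_le_trans h _; rewrite -sqrtr_sqr; apply: ler_wsqrtr.
by rewrite (bigD1 i)//= lerDl sumr_ge0// => j _; exact: sqr_ge0.
Qed.

Lemma inner_cell_sub r l (a : point) : 0 <= r -> inner_cell r l a `<=` cell a l.
Proof.
by move=> r0 x /cellP h; apply/cellP => i; have := h i; rewrite !mxE => /andP[? ?]; apply/andP; split; lra.
Qed.

End grid.

Lemma mulrn_expn {R : pzSemiRingType} (x : R) (K d : nat) : x *+ (K ^ d) = K%:R ^+ d * x.
Proof. by rewrite -[LHS]mulr_natl natrX. Qed.

Lemma adde_fin_le {R : realType} (a b : R) (x : \bar R) :
  a%:E = (b%:E + x)%E -> (x <= (a - b)%:E)%E.
Proof. by case: x => [u [->]| |] //=; rewrite lee_fin addrAC subrr add0r. Qed.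

(** * Two-sided bounds on the mean by cutting into cells *)

Section mean_bounds.
Context {R : realType} {d : nat}.
Local Notation point := 'rV[R]_d.
Local Notation unif := (@unif_cube R d).
Local Notation LEB := (lebesgue_rV d).
Variable zeta : {fset point} -> R.
Hypotheses (zeta_ge0 : forall Y, 0 <= zeta Y) (zeta_set0 : zeta fset0 = 0).
Hypotheses (zetaP1 : tuple_measurable zeta) (zetaP2 : translation_invariant zeta).
Variables (c1 c2 : R).
Hypotheses (c1_ge0 : 0 <= c1) (c2_ge0 : 0 <= c2).
Hypothesis sub : forall Y Z : {fset point}, [disjoint Y & Z]%fset ->
    zeta (Y `|` Z)%fset <= zeta Y + zeta Z + c1.
Hypothesis sup : forall Y Z : {fset point}, [disjoint Y & Z]%fset ->
    zeta Y + zeta Z - c2 * #|` boundary_points Z Y|%:R <= zeta (Y `|` Z)%fset.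
Local Notation C := (zeta_lip zeta c1 c2).

Let C0 : 0 <= C. Proof. exact: zeta_lip_ge0. Qed.
Let aZ r : admissible (zeta_seq zeta r).
Proof. exact: (admissible_zeta_seq zeta_ge0 zetaP1 zetaP2 c1_ge0 c2_ge0 sub sup). Qed.
Let lZ r : insertion_lipschitz C (zeta_seq zeta r).
Proof. exact: (insertion_lipschitz_zeta_seq zeta_ge0 zetaP2 c1_ge0 c2_ge0 sub sup). Qed.

(** As [zeta_seq zeta s^-1] dilates by [s], this is the mean of zeta over a binomial number of
    uniform points in a cube of side [s]. *)
Definition bin_mean (n : nat) (q s : R) : R := mean_sample q unif n (zeta_seq zeta s^-1).

Lemma zeta_seq_to_cell r s (a : point) l : 0 < r -> 0 < s ->
  zeta_seq zeta r [seq to_cell a (r * s) x | x <- l] = zeta_seq zeta s^-1 l.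
Proof.
move=> r0 s0; rewrite /zeta_seq -[RHS](zetaP2 _ (r^-1 *: a)); congr zeta.
apply/fsetP => x; apply/imfsetP/imfsetP => /=.
  move=> [_ /mapP[y /mapP[z zl ->] ->] ->]; exists (s *: z).
    by apply/imfsetP; exists (s *: z) => //; apply/mapP; exists z; rewrite ?invrK.
  by rewrite /to_cell scalerDr scalerA mulrA mulVf ?mul1r ?gt_eqF.
move=> [_ /imfsetP[_ /= /mapP[z zl ->] ->] ->].
exists (r^-1 *: to_cell a (r * s) z); first by apply/map_f/map_f.
by rewrite /to_cell scalerDr scalerA mulrA mulVf ?mul1r ?gt_eqF// invrK.
Qed.

Lemma asbool_set {T : Type} (A : set T) : [set x | `[< A x >]] = A.
Proof. by apply/seteqP; split => x /= /asboolP. Qed.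

Lemma mean_cell_compare (m : probability point R) (p q r s t : R) (a : point)
    (th : {measure set point -> \bar R}) n :
  0 <= p <= 1 -> 0 <= q <= 1 -> 0 < r -> 0 < s -> th (cell a (r * s)) = t%:E ->
  (forall A, measurable A -> A `<=` cell a (r * s) ->
    (p%:E * m A <= q%:E * unif (to_cell a (r * s) @^-1` A) + th A)%E) ->
  (forall A, measurable A -> A `<=` cell a (r * s) ->
    (q%:E * unif (to_cell a (r * s) @^-1` A) <= p%:E * m A + th A)%E) ->
  `|mean_sample p m n (fun l => zeta_seq zeta r (seq.filter (fun x => `[< cell a (r * s) x >]) l)) -
    bin_mean n q s| <= n%:R * (3 * C * t).
Proof.
move=> p01 q01 r0 s0 tht h12 h21.
have -> : bin_mean n q s = mean_sample q unif n (fun l => zeta_seq zeta r (map (to_cell a (r * s)) l)).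
  by congr mean_sample; apply/funext => l; rewrite zeta_seq_to_cell.
have [[p0 _] [q0 _]] := (andP p01, andP q01).
apply: (mean_sample_compare p01 q01 _ (measurable_to_cell a (r * s)) _ n (aZ r) (lZ r)).
  by rewrite asbool_set; exact: measurable_cell.
move=> h mh hC; rewrite asbool_set.
exact: (cell_close p0 q0 (mulr_gt0 r0 s0) C0 tht h12 h21 mh hC).
Qed.

Section family.
Variables (p : R) (m : probability point R) (th : {measure set point -> \bar R}).
Variables (mm : nat) (Z : seq 'rV[int]_d) (b : 'rV[int]_d -> R) (nG : pred point).
Variables (K : nat) (r s t : R).
Hypotheses (p01 : 0 <= p <= 1) (uZ : uniq Z) (b0 : forall v, 0 <= b v).
Hypotheses (mnG : measurable [set x | nG x]) (ZnG : forall x, dyad mm x \in Z -> nG x).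
Hypotheses (r_gt0 : 0 < r) (s_gt2 : 2 < s) (Krs : K%:R * (r * s) <= 2 ^- mm).
Hypothesis q1 : forall v, b v * (r * s) ^+ d <= 1.
Hypothesis tht : th [set x | nG x] = t%:E.
Let D v : set point := [set x | dyad mm x = v].
Hypothesis hu : forall A, measurable A -> A `<=` [set x | nG x] ->
  (p%:E * m A <= \sum_(v <- Z) (b v)%:E * LEB (A `&` D v) + th A)%E.
Hypothesis hl : forall A, measurable A -> A `<=` [set x | nG x] ->
  (\sum_(v <- Z) (b v)%:E * LEB (A `&` D v) <= p%:E * m A + th A)%E.

Let s0 : 0 < s. Proof. by apply: lt_trans s_gt2; rewrite ltr0n. Qed.
Let l0 : 0 < r * s. Proof. exact: mulr_gt0. Qed.
Let idx := grid_index K Z.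
Let gc (i : 'rV[int]_d * {ffun 'I_d -> 'I_K}) : set point := grid_cell mm (r * s) i.
Let gcE i : gc i = cell (grid_corner mm (r * s) i) (r * s). Proof. by []. Qed.
Let q v := b v * (r * s) ^+ d.
Let q01 v : 0 <= q v <= 1.
Proof. by rewrite q1 mulr_ge0// exprn_ge0// ltW. Qed.
Let mgc i : measurable (gc i). Proof. exact: measurable_grid_cell. Qed.
Let gcnG i : i \in idx -> gc i `<=` [set x | nG x].
Proof.
by move=> ii x /(grid_cell_dyad l0 Krs) e /=; apply: ZnG; rewrite e -mem_grid_index.
Qed.
Let thfin A : measurable A -> A `<=` [set x | nG x] -> th A = (fine (th A))%:E.
Proof.
move=> mA AG; rewrite fineK// ge0_fin_numE//.
apply: (@le_lt_trans _ _ (th [set x | nG x])); last by rewrite tht ltry.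
exact: (le_measure th (mem_set mA) (mem_set mnG) AG).
Qed.
Let t0 : 0 <= t. Proof. by rewrite -lee_fin -tht measure_ge0. Qed.

Let sumD A v : v \in Z -> A `<=` D v ->
  (\sum_(w <- Z) (b w)%:E * LEB (A `&` D w) = (b v)%:E * LEB A)%E.
Proof.
move=> vZ AD; rewrite (bigD1_seq v)//= (setIidl AD) big1 ?adde0// => w wv.
rewrite (_ : A `&` D w = set0) ?measure0 ?mule0//.
by apply/seteqP; split=> // x [/AD /= e1 /= e2]; rewrite -e2 e1 eqxx in wv.
Qed.

Let gcD i : gc i `<=` D i.1.
Proof. by move=> x /(grid_cell_dyad l0 Krs). Qed.

Let cellsum i A : i \in idx -> measurable A -> A `<=` gc i ->
  (\sum_(w <- Z) (b w)%:E * LEB (A `&` D w) =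
   (q i.1)%:E * unif (to_cell (grid_corner mm (r * s) i) (r * s) @^-1` A))%E.
Proof.
move=> ii mA Ac; rewrite (@sumD _ i.1) ?mem_grid_index//; last 2 first.
- by rewrite -mem_grid_index.
- by move=> x /Ac /gcD.
by rewrite -{1}(setIidl Ac) gcE lebesgue_cell_affine// muleA -EFinM.
Qed.

(** The keeping probability is the volume of the cell times the density [b] on its dyadic cube. The
    error is proportional to the [th]-mass of the cell, so the sum over all cells is controlled by
    [t] whatever their number. *)
Lemma mean_cell_bound n i : i \in idx ->
  `|mean_sample p m n (fun l => zeta_seq zeta r (seq.filter (fun x => `[< gc i x >]) l)) -
    bin_mean n (q i.1) s| <= n%:R * (3 * C * fine (th (gc i))).
Proof.
move=> ii; apply: (mean_cell_compare n p01 (q01 _) r_gt0 s0 (thfin (mgc i) (gcnG ii))).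
- move=> A mA Ac; rewrite -(cellsum ii mA Ac); apply: hu => // x /Ac; exact: gcnG.
- move=> A mA Ac; rewrite -(cellsum ii mA Ac); apply: hl => // x /Ac; exact: gcnG.
Qed.

Let gc_inj i j x : gc i x -> gc j x -> i = j.
Proof. exact: (grid_cell_inj l0 Krs). Qed.

Let rest := [set x | nG x] `&` [set x | ~~ has (fun i => `[< gc i x >]) idx].

Lemma sum_theta_cells : measurable rest /\
  \sum_(i <- idx) fine (th (gc i)) + fine (th rest) = t.
Proof.
have [mr e] := measure_partition th (grid_index_uniq K uZ) mgc mnG (fun i ii => gcnG ii) gc_inj.
split=> //; apply/EFin_inj; rewrite -tht e EFinD -thfin//; last by move=> x [].
congr (_ + _)%E; rewrite -sumEFin; rewrite big_seq [RHS]big_seq.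
by apply: eq_bigr => i ii; rewrite -thfin//; exact: gcnG.
Qed.

Let LD v : LEB (D v) = ((2 ^- mm) ^+ d)%:E.
Proof. by rewrite /D dyad_cell lebesgue_rV_cell// invr_ge0 exprn_ge0. Qed.

(** Two kinds of points of [nG] escape the cells: those in the margins of the dyadic cubes of [Z],
    where the density is [b v], and those accounted for by [th] alone. *)
Lemma rest_bound : p * fine (m rest) <=
  \sum_(v <- Z) b v * ((2 ^- mm) ^+ d - (K%:R * (r * s)) ^+ d) + t.
Proof.
have [mr e] := sum_theta_cells.
have th1 : fine (th rest) <= t.
  by rewrite -e lerDr sumr_ge0// => i _; exact: fine_ge0.
have mrE : m rest = (fine (m rest))%:E by rewrite fineK// fin_num_measure.
rewrite -lee_fin EFinM -mrE; apply: le_trans (hu mr _) _; first by move=> x [].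
rewrite EFinD leeD//; last by rewrite thfin ?lee_fin// => x [].
rewrite -sumEFin [leLHS]big_seq [leRHS]big_seq; apply: lee_sum => v vZ.
rewrite EFinM lee_wpmul2l ?lee_fin//.
have mDv : measurable (D v) by exact: measurable_dyad.
have [] := @measure_partition _ _ _ LEB _ (grid_index K [:: v]) gc (D v)
  (grid_index_uniq K (isT : uniq [:: v])) mgc mDv _ gc_inj.
  by move=> i; rewrite mem_grid_index inE => /eqP <-; exact: gcD.
set Dr := (X in measurable X) => mDr.
have -> : \sum_(i <- grid_index K [:: v]) LEB (gc i) = ((K%:R * (r * s)) ^+ d)%:E.
  under eq_bigr do rewrite gcE lebesgue_rV_cell ?ltW//.
  rewrite sumEFin (sum_grid_index K [:: v] (fun=> (r * s) ^+ d)) big_cons big_nil addr0.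
  by rewrite mulrn_expn -exprMn.
move=> eD0.
have eD : ((2 ^- mm) ^+ d)%:E = (((K%:R * (r * s)) ^+ d)%:E + LEB Dr)%E :> \bar R.
  exact: (etrans (esym (LD v)) eD0).
have le : (LEB (rest `&` D v) <= LEB Dr)%E.
  apply: (le_measure LEB (mem_set (measurableI _ _ mr mDv)) (mem_set mDr)).
  move=> x [[_ hx] Dx]; split=> //=; apply: contra hx => /hasP[i ii gi].
  apply/hasP; exists i => //; rewrite mem_grid_index.
  by move: ii; rewrite mem_grid_index inE => /eqP ->.
exact: le_trans le (adde_fin_le eD).
Qed.

(** Of the [4 * t], three come from comparing the cells with uniform points and one from the points
    outside all cells, which are worth at most C each. *)
Lemma mean_upper n :
  mean_sample p m n (fun l => zeta_seq zeta r (seq.filter nG l)) <=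
  \sum_(v <- Z) (K%:R ^+ d) * (bin_mean n (q v) s + c1) +
  C * n%:R * (\sum_(v <- Z) b v * ((2 ^- mm) ^+ d - (K%:R * (r * s)) ^+ d) + 4 * t).
Proof.
pose cc i x := `[< gc i x >].
have ccD i j x : cc i x -> cc j x -> i = j by move=> /asboolP h1 /asboolP h2; exact: gc_inj h1 h2.
have mcc i : measurable [set x | cc i x] by rewrite asbool_set; exact: mgc.
pose rst : pred point := predI (fun x => ~~ has (cc^~ x) idx) nG.
have rstE : [set x | rst x] = rest.
  by apply/seteqP; split => x /=; [move=> /andP[] | move=> [? ?]; apply/andP].
have [mr te] := sum_theta_cells.
have mrst : measurable [set x | rst x] by rewrite rstE.
have aI i : admissible (fun l => zeta_seq zeta r (seq.filter (cc i) l) + c1).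
  by apply: admissibleD; [exact: admissible_filter | exact: admissible_cst].
have aS := admissible_sum idx aI.
have aK := admissible_count mrst (R := R).
apply: (@le_trans _ _ (mean_sample p m n (fun l =>
   \sum_(i <- idx) (zeta_seq zeta r (seq.filter (cc i) l) + c1) + C * (count rst l)%:R))).
  apply: le_mean_sample => //.
  - exact: admissible_filter.
  - exact/admissibleD/admissibleZ.
  move=> l _; have := zeta_seq_family_le zeta_ge0 zeta_set0 zetaP2 c1_ge0 c2_ge0 sub sup
    r_gt0 ccD (seq.filter nG l) (grid_index_uniq K uZ).
  rewrite count_filter; congr (_ <= _ + _).
  rewrite big_seq [RHS]big_seq; apply: eq_bigr => i ii; congr (zeta_seq _ _ _ + _).
  rewrite -filter_predI; apply: eq_filter => x /=; rewrite /cc.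
  by case: asboolP => //= /(gcnG ii).
rewrite mean_sampleD//; last exact: admissibleZ.
rewrite mean_sampleZ// mean_sample_count// rstE mean_sample_sum//.
have h1 : \sum_(i <- idx) mean_sample p m n (fun l => zeta_seq zeta r (seq.filter (cc i) l) + c1) <=
    \sum_(v <- Z) (K%:R ^+ d) * (bin_mean n (q v) s + c1) + 3 * C * n%:R * t.
  apply: (@le_trans _ _ (\sum_(i <- idx) ((bin_mean n (q i.1) s + c1) + 3 * C * n%:R * fine (th (gc i))))).
    rewrite big_seq [leRHS]big_seq; apply: ler_sum => i ii.
    rewrite mean_sampleD//; [|exact: admissible_filter|exact: admissible_cst].
    have := mean_cell_bound n ii; rewrite ler_norml mean_sample_cst//.
    by rewrite /cc => /andP[_]; lra.
  rewrite big_split /= -mulr_sumr lerD//.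
    rewrite (sum_grid_index K Z (fun v => bin_mean n (q v) s + c1)).
    by rewrite le_eqVlt; apply/orP; left; apply/eqP; apply: eq_bigr => v _; rewrite mulrn_expn.
  rewrite ler_wpM2l//; first by rewrite !mulr_ge0.
  by rewrite -te lerDl fine_ge0.
have h2 : C * (n%:R * p * fine (m rest)) <= C * n%:R *
    (\sum_(v <- Z) b v * ((2 ^- mm) ^+ d - (K%:R * (r * s)) ^+ d) + t).
  by rewrite -[n%:R * p * _]mulrA mulrA ler_wpM2l ?mulr_ge0//; exact: rest_bound.
apply: le_trans (lerD h1 h2) _.
by rewrite le_eqVlt; apply/orP; left; apply/eqP; ring.
Qed.

(** P4 loses c2 per point in the boundary layers. The layer of a cell has volume
    [(r s) ^ d - (r (s - 2)) ^ d], and the mean number of points in it is this times the density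
    plus at most the [th]-mass of the cell, which is how c2 joins [3 * C] in front of [t]. *)
Lemma mean_lower n :
  \sum_(v <- Z) (K%:R ^+ d) * bin_mean n (q v) s -
  (3 * C + c2) * n%:R * t -
  c2 * n%:R * \sum_(v <- Z) K%:R ^+ d * (b v * ((r * s) ^+ d - (r * (s - 2)) ^+ d)) <=
  mean_sample p m n (zeta_seq zeta r).
Proof.
pose cc i x := `[< gc i x >].
pose inn (i : 'rV[int]_d * {ffun 'I_d -> 'I_K}) : set point := inner_cell r (r * s) (grid_corner mm (r * s) i).
pose bb i x := `[< ~ inn i x >].
have ccD i j x : cc i x -> cc j x -> i = j by move=> /asboolP h1 /asboolP h2; exact: gc_inj h1 h2.
have mcc i : measurable [set x | cc i x] by rewrite asbool_set; exact: mgc.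
pose st i := gc i `\` inn i.
have minn i : measurable (inn i) by exact: measurable_cell.
have mst i : measurable (st i) by exact: measurableD.
have stE i : [set x | predI (bb i) (cc i) x] = st i.
  apply/seteqP; split => x /=; first by move=> /andP[/asboolP ? /asboolP].
  by move=> [? ?]; apply/andP; split; apply/asboolP.
have mbc i : measurable [set x | predI (bb i) (cc i) x] by rewrite stE.
have [mr te] := sum_theta_cells.
have stb i : i \in idx -> p * fine (m (st i)) <=
    b i.1 * ((r * s) ^+ d - (r * (s - 2)) ^+ d) + fine (th (gc i)).
  move=> ii; have stg : st i `<=` gc i by move=> x [].
  have mE : m (st i) = (fine (m (st i)))%:E by rewrite fineK// fin_num_measure.
  rewrite -lee_fin EFinM -mE; apply: le_trans (hu (mst i) _) _; first by move=> x /stg; exact: gcnG.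
  rewrite EFinD leeD//; last first.
    rewrite -thfin//; last exact: gcnG.
    exact: (le_measure th (mem_set (mst i)) (mem_set (mgc i)) stg).
  rewrite (@sumD _ i.1); [|by rewrite -mem_grid_index|by move=> x /stg /gcD].
  rewrite EFinM lee_wpmul2l ?lee_fin//.
  have e1 : LEB (gc i) = ((r * s) ^+ d)%:E by rewrite gcE lebesgue_rV_cell// ltW.
  have e2 : LEB (inn i) = ((r * (s - 2)) ^+ d)%:E.
    have e : r * s - r *+ 2 = r * (s - 2) by ring.
    by rewrite /inn /inner_cell lebesgue_rV_cell e// mulr_ge0 ?ltW// subr_gt0.
  have e3 : LEB (gc i) = (LEB (st i) + LEB (gc i `&` inn i))%E := measureDI LEB (mgc i) (minn i).
  rewrite (setIidr (inner_cell_sub (ltW r_gt0))) e1 e2 addeC in e3.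
  exact: adde_fin_le e3.
have aI i : admissible (fun l => zeta_seq zeta r (seq.filter (cc i) l)
    - c2 * (count (predI (bb i) (cc i)) l)%:R).
  apply: admissibleB; first exact: admissible_filter.
  exact/admissibleZ/admissible_count.
apply: (@le_trans _ _ (mean_sample p m n (fun l =>
   \sum_(i <- idx) (zeta_seq zeta r (seq.filter (cc i) l)
    - c2 * (count (predI (bb i) (cc i)) l)%:R)))); last first.
  apply: le_mean_sample => //; first exact: admissible_sum.
  move=> l _; apply: (zeta_seq_family_ge zeta_ge0 c2_ge0 sup r_gt0 ccD l (grid_index_uniq K uZ)).
  move=> i x y _; rewrite /bb /cc => /asboolPn /contrapT hx /asboolPn hy.
  exact: inner_cell_dist (ltW r_gt0) hx hy.
rewrite mean_sample_sum//.
apply: (@le_trans _ _ (\sum_(i <- idx) (bin_mean n (q i.1) s - (3 * C + c2) * n%:R * fine (th (gc i))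
   - c2 * n%:R * (b i.1 * ((r * s) ^+ d - (r * (s - 2)) ^+ d))))).
  rewrite !sumrB -!mulr_sumr.
  rewrite (sum_grid_index K Z (fun v => bin_mean n (q v) s)).
  rewrite [X in _ <= _ - _ * X](sum_grid_index K Z (fun v => b v * ((r * s) ^+ d - (r * (s - 2)) ^+ d))).
  apply: lerB; [apply: lerB|].
  - by rewrite mulr_sumr; apply: ler_sum => v _; rewrite mulrn_expn.
  - by rewrite ler_wpM2l ?mulr_ge0 ?addr_ge0 ?mulr_ge0// -te lerDl fine_ge0.
  - by rewrite ler_wpM2l ?mulr_ge0// mulr_sumr; apply: ler_sum => v _; rewrite mulrn_expn.
rewrite big_seq [leRHS]big_seq; apply: ler_sum => i ii.
have aC : admissible (fun l => (count (predI (bb i) (cc i)) l)%:R : R) by exact: admissible_count.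
rewrite mean_sampleB//; [|exact: admissible_filter|exact: admissibleZ].
rewrite mean_sampleZ// mean_sample_count// stE.
have := mean_cell_bound n ii; rewrite ler_norml -/(cc i) => /andP[k1 _].
have k2 : c2 * (n%:R * p * fine (m (st i))) <=
    c2 * n%:R * (b i.1 * ((r * s) ^+ d - (r * (s - 2)) ^+ d) + fine (th (gc i))).
  by rewrite -[n%:R * p * _]mulrA mulrA ler_wpM2l ?mulr_ge0//; exact: stb.
by rewrite /cc; lra.
Qed.

End family.
End mean_bounds.

(** * The limiting mean over a cube and the limiting intensity *)

Lemma cvg_const_rate {R : realType} (kappa : R) : n%:R * (kappa / n%:R) @[n --> \oo] --> kappa.
Proof.
apply: (@cvg_trans _ ((fun _ : nat => kappa) @ \oo)); last exact: cvg_cst.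
apply: near_eq_cvg; near=> n.
have n0 : n%:R != 0 :> R by rewrite pnatr_eq0 -lt0n; near: n; exact: nbhs_infty_gt.
by rewrite mulrCA divff// mulr1.
Unshelve. all: by end_near. Qed.

Lemma cvg_poisson_series {R : realType} (kappa C : R) (U : nat -> R) : 0 <= kappa -> 0 <= C ->
  (forall k, 0 <= U k <= C * k%:R) -> cvgn (series (fun k => poisson_weight kappa k * U k)).
Proof.
move=> k0 C0 UC.
have w0 k : 0 <= kappa ^+ k / k`!%:R by rewrite divr_ge0// exprn_ge0.
have pw0 k : 0 <= poisson_weight kappa k.
  by rewrite /poisson_weight divr_ge0// mulr_ge0 ?expR_ge0 ?exprn_ge0.
have pw1 k : poisson_weight kappa k <= kappa ^+ k / k`!%:R.
  rewrite /poisson_weight -mulrA; apply: ler_piMl (w0 k) _.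
  by rewrite -expR0 ler_expR oppr_le0.
apply: (@series_le_cvg _ _ (C *: exp_coeff (2 * kappa))).
- move=> k; have /andP[u0 _] := UC k.
  by rewrite mulr_ge0.
- by move=> k; rewrite /= mulr_ge0// divr_ge0// exprn_ge0// mulr_ge0.
- move=> k; have /andP[u0 uC] := UC k.
  apply: (@le_trans _ _ (kappa ^+ k / k`!%:R * (C * k%:R))).
    by rewrite ler_pM.
  have -> : (C *: exp_coeff (2 * kappa)) k = C * exp_coeff (2 * kappa) k by [].
  rewrite /exp_coeff /= exprMn (_ : _ * (C * k%:R) = C * (k%:R * (kappa ^+ k / k`!%:R))); last by ring.
  rewrite ler_wpM2l// [leRHS](_ : _ = 2 ^+ k * (kappa ^+ k / k`!%:R)); last by ring.
  by rewrite ler_wpM2r// -natrX ler_nat ltnW// ltn_expl.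
- by apply: is_cvg_seriesZ; exact: is_cvg_series_exp_coeff.
Qed.

Section limit_density.
Context {R : realType} {d : nat}.
Local Notation point := 'rV[R]_d.
Local Notation unif := (@unif_cube R d).
Local Notation LEB := (lebesgue_rV d).
Variable zeta : {fset point} -> R.
Hypotheses (zeta_ge0 : forall Y, 0 <= zeta Y) (zeta_set0 : zeta fset0 = 0).
Hypotheses (zetaP1 : tuple_measurable zeta) (zetaP2 : translation_invariant zeta).
Variables (c1 c2 : R).
Hypotheses (c1_ge0 : 0 <= c1) (c2_ge0 : 0 <= c2).
Hypothesis sub : forall Y Z : {fset point}, [disjoint Y & Z]%fset ->
    zeta (Y `|` Z)%fset <= zeta Y + zeta Z + c1.
Hypothesis sup : forall Y Z : {fset point}, [disjoint Y & Z]%fset ->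
    zeta Y + zeta Z - c2 * #|` boundary_points Z Y|%:R <= zeta (Y `|` Z)%fset.
Local Notation C := (zeta_lip zeta c1 c2).

Let C0 : 0 <= C. Proof. exact: zeta_lip_ge0. Qed.
Let aZ r : admissible (zeta_seq zeta r).
Proof. exact: (admissible_zeta_seq zeta_ge0 zetaP1 zetaP2 c1_ge0 c2_ge0 sub sup). Qed.
Let lZ r : insertion_lipschitz C (zeta_seq zeta r).
Proof. exact: (insertion_lipschitz_zeta_seq zeta_ge0 zetaP2 c1_ge0 c2_ge0 sub sup). Qed.

Lemma mean_zeta_ge0 p (m : probability point R) n r : 0 <= p <= 1 ->
  0 <= mean_sample p m n (zeta_seq zeta r).
Proof.
move=> p01; rewrite [leLHS](_ : _ = mean_sample p m n (fun=> 0)); last by rewrite mean_sample_cst.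
apply: le_mean_sample => //.
  exact: admissible_cst.
by move=> l _; exact: zeta_ge0.
Qed.

Lemma mean_zeta_le p (m : probability point R) n r : 0 <= p <= 1 ->
  mean_sample p m n (zeta_seq zeta r) <= C * (n%:R * p).
Proof.
move=> p01; have mT : measurable [set x : point | predT x].
  by rewrite (_ : [set x | _] = setT)//; apply/seteqP; split.
have aC := admissible_count mT (R := R).
apply: (@le_trans _ _ (mean_sample p m n (fun l => C * (count predT l)%:R))).
  apply: le_mean_sample => //; first exact: admissibleZ.
  by move=> l _; rewrite count_predT; exact: (zeta_seq_size zeta_ge0 zeta_set0 zetaP2 c1_ge0 c2_ge0 sub sup).
rewrite mean_sampleZ// mean_sample_count// (_ : [set x | _] = setT); last by apply/seteqP; split.
by rewrite [X in fine X](@probability_setT _ _ _ m) mulr1.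
Qed.

(** This is [mean_sample_compare] with both laws uniform and no restriction to a cell: only the
    keeping probabilities differ, and one exchange costs [C * |q - q'|]. *)
Lemma bin_mean_lipschitz n q q' s : 0 <= q <= 1 -> 0 <= q' <= 1 ->
  `|bin_mean zeta n q s - bin_mean zeta n q' s| <= n%:R * (C * `|q - q'|).
Proof.
move=> q01 q01'.
have mT : measurable [set x : point | predT x].
  by rewrite (_ : [set x | _] = setT)//; apply/seteqP; split.
have h (p : R) : bin_mean zeta n q' s = mean_sample q' unif n (fun l => zeta_seq zeta s^-1 [seq id x | x <- l]).
  by rewrite /bin_mean; congr mean_sample; apply/funext => l; rewrite map_id.
have h2 : bin_mean zeta n q s = mean_sample q unif n (fun l => zeta_seq zeta s^-1 (seq.filter predT l)).
  by rewrite /bin_mean; congr mean_sample; apply/funext => l; rewrite filter_predT.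
rewrite (h q) h2.
apply: (mean_sample_compare q01 q01' mT (@measurable_id _ _ _) _ n (aZ s^-1) (lZ s^-1)).
move=> g mg gC; rewrite (_ : [set x | predT x] = setT); last by apply/seteqP; split.
rewrite -mulrBl normrM mulrC ler_wpM2r//.
exact: (Rintegral_le_cst unif mg gC).
Qed.

(** For [lam > 0] this is the mean of zeta over the Poisson process in a cube of side [s]
    ([poisson_mean]). A definition without a process also makes sense at [lam = 0], where none is
    given. *)
Definition limit_mean (lam s : R) : R := limn (series (fun k =>
  poisson_weight (lam * s ^+ d) k * mean_sample 1 unif k (zeta_seq zeta s^-1))).
Local Notation phi := limit_mean.

Let p11 : 0 <= (1 : R) <= 1. Proof. by rewrite lexx ler01. Qed.

Let U_bound s k : 0 <= mean_sample 1 unif k (zeta_seq zeta s^-1) <= C * k%:R.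
Proof.
by rewrite mean_zeta_ge0//=; have := mean_zeta_le unif k s^-1 p11; rewrite mulr1.
Qed.

Lemma cvg_bin_mean (p : nat -> R) (lam s : R) : (forall n, 0 <= p n) ->
  n%:R * p n @[n --> \oo] --> lam * s ^+ d ->
  bin_mean zeta n (p n) s @[n --> \oo] --> phi lam s.
Proof.
(* The rates are at most 1 only from some [n] on, while the binomial lemmas require it for every
   [n]. *)
move=> p0 cp; pose p' n := if p n <= 1 then p n else 0.
have np1 : \forall n \near \oo, p n <= 1.
  by apply: (cvgr_le _ (cvg_intensity0 cp)); exact: ltr01.
have p01' n : 0 <= p' n <= 1 by rewrite /p'; case: ifPn => [->|_]; rewrite ?p0// lexx ler01.
have cp' : n%:R * p' n @[n --> \oo] --> lam * s ^+ d.
  apply: cvg_trans cp; apply: near_eq_cvg; near=> n.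
  by rewrite /p' ifT//; near: n.
have h := cvg_binomial_sum p01' cp' (C := C)
  (U := fun k => mean_sample 1 unif k (zeta_seq zeta s^-1)).
apply: cvg_trans (h _); last by move=> k; have /andP[? ?] := U_bound s k; rewrite ger0_norm.
apply: near_eq_cvg; near=> n; rewrite /bin_mean.
have -> : p n = p' n by rewrite /p' ifT//; near: n.
by rewrite mean_sample_binomial.
Unshelve. all: by end_near. Qed.

(** The rates [lam * s ^+ d / n] present [limit_mean] as a limit of binomial means, from which its
    sign, growth, Lipschitz bound and subadditivity are inherited. At [n = 0] the quotient is 0,
    which keeps the rates non-negative. *)
Let rate_cvg (lam s : R) : 0 <= lam -> 0 <= s ->
  (forall n : nat, 0 <= lam * s ^+ d / n%:R) /\
  bin_mean zeta n (lam * s ^+ d / n%:R) s @[n --> \oo] --> phi lam s.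
Proof.
move=> l0 s0; have h n : 0 <= lam * s ^+ d / n%:R :> R by rewrite divr_ge0// mulr_ge0// exprn_ge0.
by split=> //; apply: cvg_bin_mean => //; exact: cvg_const_rate.
Qed.

Let rate_le1 (lam s : R) : \forall n \near \oo, lam * s ^+ d / n%:R <= 1.
Proof.
have h := @cvg_intensity0 R (fun n => lam * s ^+ d / n%:R) _ (@cvg_const_rate R (lam * s ^+ d)).
exact: (cvgr_le _ h _ ltr01).
Qed.

Lemma limit_mean_ge0 (lam s : R) : 0 <= lam -> 0 <= s -> 0 <= phi lam s.
Proof.
move=> l0 s0; have [p0 c] := rate_cvg l0 s0.
apply: (ler_cvg_to (cvg_cst 0) c).
near=> n; apply: mean_zeta_ge0; rewrite p0; near: n; exact: rate_le1.
Unshelve. all: by end_near. Qed.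

Lemma limit_mean_le (lam s : R) : 0 <= lam -> 0 <= s -> phi lam s <= C * (lam * s ^+ d).
Proof.
move=> l0 s0; have [p0 c] := rate_cvg l0 s0.
have c' : C * (n%:R * (lam * s ^+ d / n%:R)) @[n --> \oo] --> C * (lam * s ^+ d).
  by apply: cvgMr; exact: cvg_const_rate.
apply: (ler_cvg_to c c').
near=> n; apply: mean_zeta_le; rewrite p0; near: n; exact: rate_le1.
Unshelve. all: by end_near. Qed.

Lemma limit_mean_lipschitz (lam lam' s : R) : 0 <= lam -> 0 <= lam' -> 0 <= s ->
  `|phi lam s - phi lam' s| <= C * (s ^+ d * `|lam - lam'|).
Proof.
move=> l0 l0' s0; have [p0 c] := rate_cvg l0 s0; have [p0' c'] := rate_cvg l0' s0.
have cc : `|bin_mean zeta n (lam * s ^+ d / n%:R) s - bin_mean zeta n (lam' * s ^+ d / n%:R) s|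
    @[n --> \oo] --> `|phi lam s - phi lam' s| by apply: cvg_norm; exact: cvgB.
apply: (ler_cvg_to cc (cvg_cst _)).
near=> n.
have q1 : 0 <= lam * s ^+ d / n%:R <= 1 by rewrite p0; near: n; exact: rate_le1.
have q2 : 0 <= lam' * s ^+ d / n%:R <= 1 by rewrite p0'; near: n; exact: rate_le1.
apply: le_trans (bin_mean_lipschitz n s q1 q2) _.
have n0 : n%:R != 0 :> R by rewrite pnatr_eq0 -lt0n; near: n; exact: nbhs_infty_gt.
rewrite -mulrBl -mulrBl !normrM normfV (ger0_norm (exprn_ge0 d s0)) normr_nat.
by rewrite le_eqVlt; apply/orP; left; apply/eqP; field.
Unshelve. all: by end_near. Qed.

(** This is [mean_upper] with zero error measure, for uniform points in the single dyadic cube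
    [[0,1)^d] at scale [r = 1 / S]: in rescaled units a cube of side [S] is cut into [K ^ d] cubes
    of side [s], and the uncovered margin costs C per point. *)
Lemma limit_mean_subadditive (lam s S : R) (K : nat) : 0 <= lam -> 2 < s -> s <= S -> K%:R * s <= S ->
  phi lam S <= K%:R ^+ d * (phi lam s + c1) + C * (lam * (S ^+ d - (K%:R * s) ^+ d)).
Proof.
move=> l0 s2 sS KsS.
have s0 : 0 < s by apply: lt_trans s2; rewrite ltr0n.
have S0 : 0 < S := lt_le_trans s0 sS.
have [p0 cS] := rate_cvg l0 (ltW S0).
pose r := S^-1; have r0 : 0 < r by rewrite invr_gt0.
pose p n := lam * S ^+ d / n%:R : R.
have pE n : p n * (r * s) ^+ d = lam * s ^+ d / n%:R.
  rewrite /p /r exprMn exprVn; have Sd : S ^+ d != 0 by rewrite expf_neq0// gt_eqF.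
  by rewrite [LHS](_ : _ = lam * s ^+ d / n%:R * (S ^+ d / S ^+ d)); [rewrite divff// mulr1|ring].
have [_ cs] := rate_cvg l0 (ltW s0).
have c : K%:R ^+ d * (bin_mean zeta n (lam * s ^+ d / n%:R) s + c1) +
   C * ((n%:R * p n) * (1 - (K%:R * (r * s)) ^+ d)) @[n --> \oo] -->
   K%:R ^+ d * (phi lam s + c1) + C * ((lam * S ^+ d) * (1 - (K%:R * (r * s)) ^+ d)).
  apply: cvgD; apply: cvgMr; first by apply: cvgD => //; exact: cvg_cst.
  by apply: cvgMl; exact: cvg_const_rate.
have e : lam * (S ^+ d - (K%:R * s) ^+ d) = (lam * S ^+ d) * (1 - (K%:R * (r * s)) ^+ d).
  have e0 : (K%:R * (r * s)) ^+ d * S ^+ d = (K%:R * s) ^+ d.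
    by rewrite -exprMn -!mulrA [s * S]mulrC [r * _]mulrA /r mulVf ?mul1r ?gt_eqF.
  by rewrite [RHS]mulrBr mulr1 -mulrA [S ^+ d * _]mulrC e0 mulrBr.
rewrite e; apply: (ler_cvg_to cS c); near=> n.
have q1 : 0 <= p n <= 1 by rewrite p0; near: n; exact: rate_le1.
have D0 : [set x : point | dyad 0 x = 0] = cell 0 1.
  by rewrite dyad_cell expr0 invr1; congr cell; apply/rowP => i; rewrite !mxE mul0r.
have mT : measurable [set x : point | predT x].
  by rewrite (_ : [set x | _] = setT)//; apply/seteqP; split.
have hA (A : set point) : measurable A -> (\sum_(v <- [:: (0%R : 'rV[int]_d)]) (p n)%:E * LEB (A `&` [set x : point | dyad 0 x = v]) =
    (p n)%:E * unif A)%E.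
  by move=> mA; rewrite big_cons big_nil adde0 D0.
have Krs : K%:R * (r * s) <= 2 ^- 0.
  by rewrite expr0 invr1 mulrCA /r mulrC ler_pdivrMr// mul1r.
have qq (v : 'rV[int]_d) : p n * (r * s) ^+ d <= 1.
  rewrite pE; apply: le_trans (_ : p n <= 1); last by case/andP: q1.
  by rewrite /p ler_wpM2r ?invr_ge0// ler_wpM2l// lerXn2r// nnegrE ltW.
have := mean_upper zeta_ge0 zeta_set0 zetaP1 zetaP2 c1_ge0 c2_ge0 sub sup (m := unif)
  (th := mzero) (mm := 0%N) (Z := [:: 0]) (b := fun=> p n) (nG := predT) (t := 0) q1 (isT : uniq [:: _])
  _ mT _ r0 s2 Krs qq _ _ _ n.
have -> : mean_sample (p n) unif n (fun l => zeta_seq zeta r (seq.filter predT l)) =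
    bin_mean zeta n (p n) S.
  by rewrite /bin_mean; congr mean_sample; apply/funext => l; rewrite filter_predT.
rewrite !big_cons !big_nil !addr0 mulr0 addr0 pE expr0 invr1 expr1n.
move=> h; apply: le_trans (h _ _ _ _ _) _ => //.
- by move=> _; case/andP: q1.
- by move=> A mA _; rewrite hA// adde0.
- by move=> A mA _; rewrite hA// adde0.
by rewrite le_eqVlt; apply/orP; left; apply/eqP; rewrite /p; ring.
Unshelve. all: by end_near. Qed.

Lemma poisson_mean {dH : measure_display} {OmegaH : measurableType dH}
    (PH : probability OmegaH R) (lam : R) (H : OmegaH -> set point) (s : R) :
  0 < lam -> is_homogeneous_poisson PH lam H -> 0 < s ->
  ('E_PH[fun w => zeta (fset_set (H w `&` cube s))] = (phi lam s)%:E)%E.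
Proof.
move=> l0 HP s0.
have lF := insertion_lipschitz_fset zeta_ge0 zetaP2 c1_ge0 c2_ge0 sub sup.
have mF := seq_measurable_fset zetaP1.
have aF := lipschitz_admissible C0 mF lF.
rewrite [LHS](expectation_config l0 HP s0 zeta_ge0 aF).
have e k : mean_sample 1 unif k (fun l => zeta [fset y in [seq to_cell (const_mx (- (s / 2))) s x | x <- l]]%fset) =
    mean_sample 1 unif k (zeta_seq zeta s^-1).
  congr mean_sample; apply/funext => l.
  have h := zeta_seq_to_cell zetaP2 (const_mx (- (s / 2))) l (ltr01 : 0 < (1 : R)) s0.
  have e1 (l' : seq point) : [seq 1^-1 *: x | x <- l'] = l'.
    by rewrite -[RHS]map_id; apply: eq_map => x; rewrite invr1 scale1r.
  by rewrite -h mul1r /zeta_seq e1.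
under eq_eseriesr do rewrite e.
rewrite /phi -EFin_lim; last by apply: (cvg_poisson_series _ C0 (U_bound s)); rewrite mulr_ge0 ?exprn_ge0 ?ltW.
congr (limn _); apply/funext => n /=; rewrite /series /=.
by rewrite sumEFin.
Qed.

End limit_density.

Lemma one_sub_expr_le {R : realDomainType} (q : R) n : 0 <= q <= 1 -> 1 - q ^+ n <= n%:R * (1 - q).
Proof.
move=> /andP[q0 q1]; elim: n => [|n IH]; first by rewrite expr0 subrr mul0r.
have qn : q ^+ n * (1 - q) <= 1 * (1 - q).
  by rewrite ler_wpM2r ?subr_ge0// exprn_ile1.
rewrite -natr1 exprSr mulrDl; apply: le_trans (lerD IH qn).
by rewrite le_eqVlt; apply/orP; left; apply/eqP; ring.
Qed.

(** A Fekete argument. The limit is the infimum of [psi s + A / s ^+ d] over [s > 2]; the correction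
    stands for the constant paid per cube and vanishes at infinity since [d] is positive. For the
    upper bound a nearly optimal [s0] is fixed and a cube of side [S] is filled with cubes of side
    [s0]. *)
Lemma cvg_almost_subadditive {R : realType} (psi : R -> R) (A B : R) (d : nat) :
  (0 < d)%N -> 0 <= A -> 0 <= B -> (forall s, 0 < s -> 0 <= psi s) ->
  (forall s S (K : nat), 2 < s -> s <= S -> K%:R * s <= S ->
    psi S <= (K%:R * s / S) ^+ d * (psi s + A / s ^+ d) + B * (1 - (K%:R * s / S) ^+ d)) ->
  cvg (psi s @[s --> +oo]).
Proof.
move=> d0 A0 B0 psi0 psub.
pose E := [set psi s + A / s ^+ d | s in [set s | 2 < s]].
have Elb x : E x -> 0 <= x.
  move=> [s /= s2 <-]; have s0 : 0 < s by apply: lt_trans s2; rewrite ltr0n.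
  by rewrite addr_ge0 ?psi0// divr_ge0// exprn_ge0// ltW.
have hE : has_inf E.
  split; first by exists (psi 3 + A / 3 ^+ d), 3 => //=; rewrite ltr_nat.
  by exists 0 => x /Elb.
apply/cvg_ex; exists (inf E); apply/cvgrPdist_le => e e0.
have e20 : 0 < e / 2 by rewrite divr_gt0.
have [_ [s0 /= s02 <-] hs0] := inf_adherent e20 hE.
have s00 : 0 < s0 by apply: lt_trans s02; rewrite ltr0n.
near=> S.
have S2 : s0 <= S by near: S; apply: nbhs_pinfty_ge; exact: num_real.
have S0 : 0 < S := lt_le_trans s00 S2.
have S1 : 1 <= S by apply: le_trans S2; apply: ltW; apply: lt_trans s02; rewrite ltr1n.
have hB : B * d%:R * s0 / (e / 2) <= S by near: S; apply: nbhs_pinfty_ge; exact: num_real.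
have hA : A / e <= S by near: S; apply: nbhs_pinfty_ge; exact: num_real.
have low : inf E <= psi S + A / S ^+ d.
  by apply: ge_inf; [exists 0 => x /Elb | exists S => //=; exact: lt_le_trans S2].
have AS : A / S ^+ d <= e.
  apply: (@le_trans _ _ (A / S)); last by rewrite ler_pdivrMr// mulrC -ler_pdivrMr.
  rewrite ler_wpM2l// lef_pV2 ?posrE ?exprn_gt0//.
  by rewrite -[leLHS]expr1 ler_weXn2l.
have Ss0 : 0 <= S / s0 by rewrite divr_ge0// ltW.
(* With [K] the integer part of [S / s0], the uncovered proportion of each side is at most
   [s0 / S]. *)
have /andP[k1 k2] := truncn_itv Ss0; set K := Num.truncn (S / s0) in k1 k2.
have Ks : K%:R * s0 <= S by rewrite -ler_pdivlMr.
have Ks' : S < K%:R * s0 + s0 by rewrite -[X in _ + X]mul1r -mulrDl natr1 -ltr_pdivrMr.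
pose q := K%:R * s0 / S.
have q01 : 0 <= q <= 1.
  by rewrite divr_ge0 ?mulr_ge0 ?(ltW s00) ?(ltW S0)//= ler_pdivrMr// mul1r.
have q1 : 1 - q <= s0 / S.
  by rewrite lerBlDr /q -mulrDl ler_pdivlMr// mul1r addrC ltW.
have up := psub s0 S K s02 S2 Ks; rewrite -/q in up.
have Bq : B * (1 - q ^+ d) <= e / 2.
  apply: (@le_trans _ _ (B * (d%:R * (s0 / S)))).
    rewrite ler_wpM2l//; apply: le_trans (one_sub_expr_le d q01) _.
    by rewrite ler_wpM2l.
  rewrite (_ : _ * _ = B * d%:R * s0 / S); last by ring.
  by rewrite ler_pdivrMr// [leRHS]mulrC -ler_pdivrMr//.
have qd : q ^+ d * (psi s0 + A / s0 ^+ d) <= psi s0 + A / s0 ^+ d.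
  case/andP: q01 => qa qb; rewrite ler_piMl ?exprn_ile1//.
  by apply: Elb; exists s0.
have u1 : psi S <= inf E + e by lra.
rewrite ler_norml; apply/andP; split; lra.
Unshelve. all: by end_near. Qed.

Section limit_intensity.
Context {R : realType} {d : nat}.
Hypothesis d_gt0 : (0 < d)%N.
Local Notation point := 'rV[R]_d.
Variable zeta : {fset point} -> R.
Hypotheses (zeta_ge0 : forall Y, 0 <= zeta Y) (zeta_set0 : zeta fset0 = 0).
Hypotheses (zetaP1 : tuple_measurable zeta) (zetaP2 : translation_invariant zeta).
Variables (c1 c2 : R).
Hypotheses (c1_ge0 : 0 <= c1) (c2_ge0 : 0 <= c2).
Hypothesis sub : forall Y Z : {fset point}, [disjoint Y & Z]%fset ->
    zeta (Y `|` Z)%fset <= zeta Y + zeta Z + c1.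
Hypothesis sup : forall Y Z : {fset point}, [disjoint Y & Z]%fset ->
    zeta Y + zeta Z - c2 * #|` boundary_points Z Y|%:R <= zeta (Y `|` Z)%fset.
Local Notation C := (zeta_lip zeta c1 c2).
Local Notation phi := (limit_mean zeta).

Let C0 : 0 <= C. Proof. exact: zeta_lip_ge0. Qed.

(* The paper's [lambda * rho lambda]. *)
Definition limit_intensity (lam : R) : R := lim (phi lam s / s ^+ d @[s --> +oo]).

Lemma cvg_limit_intensity (lam : R) : 0 <= lam ->
  phi lam s / s ^+ d @[s --> +oo] --> limit_intensity lam.
Proof.
move=> l0; apply: (cvg_almost_subadditive (A := c1) (B := C * lam) d_gt0) => //.
- by rewrite mulr_ge0.
- move=> s s0; rewrite divr_ge0 ?exprn_ge0 ?(ltW s0)//.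
  exact: (limit_mean_ge0 zeta_ge0 zeta_set0 zetaP1 zetaP2 c1_ge0 c2_ge0 sub sup l0 (ltW s0)).
move=> s S K s2 sS KsS.
have s0 : 0 < s by apply: lt_trans s2; rewrite ltr0n.
have S0 : 0 < S := lt_le_trans s0 sS.
have := limit_mean_subadditive zeta_ge0 zeta_set0 zetaP1 zetaP2 c1_ge0 c2_ge0 sub sup l0 s2 sS KsS.
rewrite ler_pdivrMr ?exprn_gt0// => /le_trans; apply.
have sd : s ^+ d != 0 by rewrite expf_neq0// gt_eqF.
have Sd : S ^+ d != 0 by rewrite expf_neq0// gt_eqF.
rewrite !exprMn exprVn le_eqVlt; apply/orP; left; apply/eqP; field.
by rewrite sd Sd.
Qed.

Lemma limit_intensity_ge0 (lam : R) : 0 <= lam -> 0 <= limit_intensity lam.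
Proof.
move=> l0; apply: (ler_cvg_to (cvg_cst 0) (cvg_limit_intensity l0)).
near=> s; have s0 : 0 < s by near: s; exact: nbhs_pinfty_gt.
rewrite divr_ge0 ?exprn_ge0 ?(ltW s0)//.
exact: (limit_mean_ge0 zeta_ge0 zeta_set0 zetaP1 zetaP2 c1_ge0 c2_ge0 sub sup l0 (ltW s0)).
Unshelve. all: by end_near. Qed.

Lemma limit_intensity_le (lam : R) : 0 <= lam -> limit_intensity lam <= C * lam.
Proof.
move=> l0; apply: (ler_cvg_to (cvg_limit_intensity l0) (cvg_cst _)).
near=> s; have s0 : 0 < s by near: s; exact: nbhs_pinfty_gt.
rewrite ler_pdivrMr ?exprn_gt0// -mulrA.
exact: (limit_mean_le zeta_ge0 zeta_set0 zetaP1 zetaP2 c1_ge0 c2_ge0 sub sup l0 (ltW s0)).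
Unshelve. all: by end_near. Qed.

(** This is why approximating the density in L^1 is enough: it changes the integral in the limit by
    at most C times the L^1 distance. *)
Lemma limit_intensity_lipschitz (lam lam' : R) : 0 <= lam -> 0 <= lam' ->
  `|limit_intensity lam - limit_intensity lam'| <= C * `|lam - lam'|.
Proof.
move=> l0 l0'.
have c : `|phi lam s / s ^+ d - phi lam' s / s ^+ d| @[s --> +oo] -->
    `|limit_intensity lam - limit_intensity lam'|.
  by apply: cvg_norm; apply: cvgB; exact: cvg_limit_intensity.
apply: (ler_cvg_to c (cvg_cst _)).
near=> s; have s0 : 0 < s by near: s; exact: nbhs_pinfty_gt.
rewrite -mulrBl normrM normfV (ger0_norm (exprn_ge0 d (ltW s0))) ler_pdivrMr ?exprn_gt0//.
rewrite -mulrA [X in _ <= C * X]mulrC.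
exact: (limit_mean_lipschitz zeta_ge0 zeta_set0 zetaP1 zetaP2 c1_ge0 c2_ge0 sub sup l0 l0' (ltW s0)).
Unshelve. all: by end_near. Qed.

End limit_intensity.

(** * Dyadic approximation of sets and densities *)

Import HBSimple.

Section dyadic_dense.
Context {R : realType} {d : nat}.
Local Notation point := 'rV[R]_d.
Variable M : {measure set point -> \bar R}.
Hypothesis Mfin : (M setT < +oo)%E.

Definition symdiff {T} (A B : set T) := (A `\` B) `|` (B `\` A).

(** The approximation is asked at all levels from [m0] on, so that several approximations can be
    made at a common level. *)
Definition dyadic_approximable (A : set point) := measurable A /\
  forall e : R, 0 < e -> exists m0, forall m, (m0 <= m)%N -> exists E : set 'rV[int]_d,
    (M (symdiff A [set x | E (dyad m x)]) <= e%:E)%E.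

Let mE m (E : set 'rV[int]_d) : measurable [set x : point | E (dyad m x)].
Proof. exact: measurable_dyad_set. Qed.

Let msym (A B : set point) : measurable A -> measurable B -> measurable (symdiff A B).
Proof. by move=> mA mB; apply: measurableU; exact: measurableD. Qed.

Let MleU (A B D : set point) : measurable A -> measurable B -> measurable D ->
  A `<=` B `|` D -> (M A <= M B + M D)%E.
Proof.
move=> mA mB mD AB; apply: le_trans (measureU2 M mB mD).
exact: (le_measure M (mem_set mA) (mem_set (measurableU _ _ mB mD)) AB).
Qed.

Lemma dyadic_approximableC A : dyadic_approximable A -> dyadic_approximable (~` A).
Proof.
move=> [mA h]; split; first exact: measurableC.
move=> e /h[m0 hm]; exists m0 => m /hm[E hE]; exists (~` E).
rewrite (_ : symdiff _ _ = symdiff A [set x | E (dyad m x)])//.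
rewrite /symdiff; apply/seteqP; split => x /= [[h1 h2]|[h1 h2]].
- by right; split=> //; apply: contrapT.
- by left; split=> //; apply: contrapT.
- by right; split=> //; exact.
- by left; split=> //; exact.
Qed.

Lemma dyadic_approximableU A B : dyadic_approximable A -> dyadic_approximable B ->
  dyadic_approximable (A `|` B).
Proof.
move=> [mA hA] [mB hB]; split; first exact: measurableU.
move=> e e0; have e20 : 0 < e / 2 by rewrite divr_gt0.
have [m1 h1] := hA _ e20; have [m2 h2] := hB _ e20.
exists (maxn m1 m2) => m; rewrite geq_max => /andP[/h1[E1 k1] /h2[E2 k2]].
exists (E1 `|` E2); have -> : e%:E = ((e / 2)%:E + (e / 2)%:E)%E by rewrite -EFinD -splitr.
apply: le_trans (leeD k1 k2); apply: MleU.
- by apply: msym; [exact: measurableU | exact: (mE m (E1 `|` E2))].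
- exact: msym.
- exact: msym.
move=> x /= [[[Ax|Bx] /not_orP[n1 n2]]|[[h|h] /not_orP[n1 n2]]].
- by left; left.
- by right; left.
- by left; right.
- by right; right.
Qed.

Lemma decreasing_null (F : nat -> set point) (e : R) : (forall n, measurable (F n)) ->
  {homo F : n m / (n <= m)%N >-> m `<=` n} -> \bigcap_n F n = set0 -> 0 < e ->
  exists n0, forall n, (n0 <= n)%N -> (M (F n) <= e%:E)%E.
Proof.
move=> mF dF F0 e0.
have c : M (F n) @[n --> \oo] --> 0%E.
  rewrite -(measure0 M) -F0; apply: nonincreasing_cvg_mu => //.
  - by apply: le_lt_trans Mfin; apply: (le_measure M (mem_set (mF 0%N)) (mem_set measurableT)).
  - by rewrite F0.
  - by move=> n m nm; apply/subsetPset; exact: dF.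
have /fine_cvgP[_ c'] := c.
have fF n : M (F n) \is a fin_num.
  rewrite ge0_fin_numE//; apply: le_lt_trans Mfin.
  exact: (le_measure M (mem_set (mF n)) (mem_set measurableT)).
have [n0 _ h] := cvgr_le _ c' _ e0.
by exists n0 => n /h /=; rewrite -lee_fin fineK.
Qed.

Lemma dyadic_approximable_bigcup (F : nat -> set point) : (forall n, dyadic_approximable (F n)) ->
  dyadic_approximable (\bigcup_n F n).
Proof.
move=> hF; have mU : measurable (\bigcup_n F n) by apply: bigcup_measurable => n _; case: (hF n).
split=> // e e0; have e20 : 0 < e / 2 by rewrite divr_gt0.
pose G n := \big[setU/set0]_(i < n) F i.
have hG n : dyadic_approximable (G n).
  elim: n => [|n IH]; last by rewrite /G big_ord_recr; exact: dyadic_approximableU.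
  rewrite /G big_ord0; split=> // e' e'0; exists 0%N => m _; exists set0.
  by rewrite (_ : symdiff _ _ = set0) ?measure0 ?lee_fin ?ltW//; apply/seteqP; split=> x //= [[]|[]].
have GE n x : G n x <-> exists2 i, (i < n)%N & F i x.
  by rewrite /G -bigcup_mkord; split => [[i /= ni Fx]|[i ni Fx]]; exists i.
have [||||n0 hn] := @decreasing_null (fun n => (\bigcup_n F n) `\` G n) (e / 2).
- by move=> n; apply: measurableD => //; case: (hG n).
- move=> n m nm x [Ux nG]; split=> // /GE[i ni Fx]; apply: nG; apply/GE; exists i => //.
  exact: leq_trans ni nm.
- apply/seteqP; split=> // x h; have [[i _ Fx] _] := h 0%N I.
  by have [_ nG] := h i.+1 I; apply: nG; apply/GE; exists i.
- by [].
have [mG hGn] := hG n0; have [m0 hm] := hGn _ e20.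
exists m0 => m /hm[E hE]; exists E.
have -> : e%:E = ((e / 2)%:E + (e / 2)%:E)%E by rewrite -EFinD -splitr.
apply: le_trans (leeD (hn n0 (leqnn _)) hE); apply: MleU.
- exact: msym.
- exact: measurableD.
- exact: msym.
move=> x /= [[Ux nE]|[Ex nU]].
- have [Gx|nG] := pselect (G n0 x); first by right; left.
  by left; split.
- by right; right; split=> // /GE[i _ Fx]; apply: nU; exists i.
Qed.

Lemma measurable_dyadic_approximable A : measurable A -> dyadic_approximable A.
Proof.
apply: rV_measurable_sub; first split.
- split=> // e e0; exists 0%N => m _; exists set0.
  by rewrite (_ : symdiff _ _ = set0) ?measure0 ?lee_fin ?ltW//; apply/seteqP; split=> x //= [[]|[]].
- by move=> B hB; rewrite setTD; exact: dyadic_approximableC.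
- exact: dyadic_approximable_bigcup.
move=> i c; set A0 := [set x : point | x ord0 i < c].
have mA0 : measurable A0.
  rewrite -[X in measurable X]setTI; apply: measurable_fun_ltr => //; exact: measurable_coord.
split=> // e e0.
(* The cubes of level [m] contained in the half-space; they exhaust it as [m] grows because the
   inequality is strict. *)
pose E m : set 'rV[int]_d := [set v | forall y : point, dyad m y = v -> y ord0 i < c].
have sE m : [set x : point | E m (dyad m x)] `<=` A0 by move=> x /= h; exact: h.
have [||||n0 hn] := @decreasing_null (fun m => A0 `\` [set x : point | E m (dyad m x)]) e.
- by move=> n; apply: measurableD.
- move=> n m nm x [Ax nE]; split=> // h; apply: nE => y /esym yx; apply: h.
  by apply: (dyad_coarsen nm).
- apply/seteqP; split=> // x h; have [Ax _] := h 0%N I.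
  have [k hk] := dyad_lt Ax; have [_ nE] := h k I; apply: nE => y /=; exact: hk.
- by [].
exists n0 => m /hn hm; exists (E m); rewrite /symdiff.
by rewrite [X in _ `|` X](_ : _ = set0) ?setU0//; apply/seteqP; split=> // x [/sE].
Qed.

Definition step_approximable (f : point -> R) := measurable_fun setT f /\
  forall e : R, 0 < e -> exists m0, forall m, (m0 <= m)%N -> exists g : 'rV[int]_d -> R,
    (\int[M]_x (`|f x - g (dyad m x)|)%:E <= e%:E)%E.

Lemma measurable_dyad_fun m (g : 'rV[int]_d -> R) : measurable_fun setT (fun x : point => g (dyad m x)).
Proof. by move=> _ B mB; rewrite setTI; exact: (mE m (g @^-1` B)). Qed.

Let mdist m (g : 'rV[int]_d -> R) (f : point -> R) : measurable_fun setT f ->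
  measurable_fun setT (fun x => (`|f x - g (dyad m x)|)%:E).
Proof.
move=> mf; apply/measurable_EFinP; apply: measurableT_comp => //; apply: measurable_funB => //.
exact: measurable_dyad_fun.
Qed.

Lemma step_approximableD f1 f2 : step_approximable f1 -> step_approximable f2 ->
  step_approximable (fun x => f1 x + f2 x).
Proof.
move=> [m1 h1] [m2 h2]; split; first exact: measurable_funD.
move=> e e0; have e20 : 0 < e / 2 by rewrite divr_gt0.
have [n1 k1] := h1 _ e20; have [n2 k2] := h2 _ e20.
exists (maxn n1 n2) => m; rewrite geq_max => /andP[/k1[g1 l1] /k2[g2 l2]].
exists (fun v => g1 v + g2 v); have -> : e%:E = ((e / 2)%:E + (e / 2)%:E)%E by rewrite -EFinD -splitr.
apply: le_trans (leeD l1 l2); rewrite -ge0_integralD//; try exact: mdist.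
apply: ge0_le_integral => //.
- by apply: (mdist m (fun v => g1 v + g2 v)); exact: measurable_funD.
- by apply: emeasurable_funD; exact: mdist.
- move=> x _; rewrite -EFinD lee_fin; set a := g1 _; set b := g2 _.
  by rewrite (_ : _ - _ = (f1 x - a) + (f2 x - b)); [exact: ler_normD | ring].
Qed.

Lemma step_approximable_indic (k : R) A : measurable A -> step_approximable (fun x => k * \1_A x).
Proof.
move=> mA; split; first by apply: measurable_funM => //; exact: measurable_indic.
move=> e e0; have k0 : 0 < `|k| + 1 by rewrite ltr_wpDl.
have ek : 0 < e / (`|k| + 1) by rewrite divr_gt0.
have [_ /(_ _ ek)[m0 h]] := measurable_dyadic_approximable mA.
exists m0 => m /h[E hE]; exists (fun v => k * \1_E v).
apply: (@le_trans _ _ (\int[M]_x (`|k|%:E * (\1_(symdiff A [set x | E (dyad m x)]) x)%:E))%E).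
  apply: ge0_le_integral => //.
  - apply: (mdist m (fun v => k * \1_E v)); apply: measurable_funM => //; exact: measurable_indic.
  - apply/measurable_EFinP; apply: measurable_funM => //; apply: measurable_indic; exact: msym.
  move=> x _; rewrite -EFinM lee_fin -mulrBr normrM ler_wpM2l// !indicE.
  have -> : (dyad m x \in E) = (x \in [set x | E (dyad m x)]).
    by apply/idP/idP => /set_mem h'; exact/mem_set.
  set B := [set x | _].
  have [xA|xA] := boolP (x \in A); have [xB|xB] := boolP (x \in B);
    rewrite ?subrr ?normr0 ?subr0 ?sub0r ?normrN ?normr1//.
  + by rewrite mem_set//; left; split; [exact: set_mem|move=> /mem_set; exact/negP].
  + by rewrite mem_set//; right; split; [exact: set_mem|move=> /mem_set; exact/negP].
rewrite ge0_integralZl//; last first.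
  by apply/measurable_EFinP; apply: measurable_indic; exact: msym.
rewrite integral_indic//; last exact: msym.
rewrite setIT; apply: le_trans (lee_wpmul2l _ hE) _; first by rewrite lee_fin.
by rewrite -EFinM lee_fin mulrA ler_pdivrMr// mulrC ler_wpM2l ?(ltW e0)// lerDl.
Qed.

Lemma integrable_step_approximable (f : point -> R) : measurable_fun setT f ->
  M.-integrable setT (EFin \o f) -> step_approximable f.
Proof.
move=> mf intf; split=> // e e0; have e20 : 0 < e / 2 by rewrite divr_gt0.
have [h [ih _ ch]] := approximation_sfun_integrable measurableT intf.
have sh n : step_approximable (h n : point -> R).
  have fin : finite_set (range (h n)) by exact: fimfunP.
  have -> : (h n : point -> R) = (fun x => \sum_(y <- fset_set (range (h n))) y * \1_(h n @^-1` [set y]) x).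
    by apply/funext => x; rewrite (fimfunE (h n) x) fsbig_finite.
  elim: (fset_set (range (h n)) : seq R) => [|y s IH].
    have -> : (fun x => \sum_(y <- [::]) y * \1_(h n @^-1` [set y]) x) = (fun x : point => 0 * \1_setT x).
      by apply/funext => x; rewrite big_nil mul0r.
    exact: step_approximable_indic.
  have -> : (fun x => \sum_(z <- y :: s) z * \1_(h n @^-1` [set z]) x) =
      (fun x => y * \1_(h n @^-1` [set y]) x + \sum_(z <- s) z * \1_(h n @^-1` [set z]) x).
    by apply/funext => x; rewrite big_cons.
  apply: step_approximableD => //; apply: step_approximable_indic.
  by rewrite -[X in measurable X]setTI; exact: measurable_funP.
have [n hn] : exists n, (\int[M]_x (`|f x - h n x|)%:E <= (e / 2)%:E)%E.
  have /fine_cvgP[fi c'] := ch.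
  have [n0 _ h0] := cvgr_le _ c' _ e20; have [n1 _ h1] := fi.
  exists (maxn n0 n1); have k0 := h0 (maxn n0 n1) (leq_maxl _ _).
  have k1 := h1 (maxn n0 n1) (leq_maxr _ _).
  by move: k0; rewrite /= -lee_fin fineK.
have [mh /(_ _ e20)[m0 hm]] := sh n.
exists m0 => m /hm[g hg]; exists g.
have -> : e%:E = ((e / 2)%:E + (e / 2)%:E)%E by rewrite -EFinD -splitr.
have mfh : measurable_fun setT (fun x => (`|f x - h n x|)%:E).
  by apply/measurable_EFinP; apply: measurableT_comp => //; exact: measurable_funB.
apply: le_trans (leeD hn hg); rewrite -ge0_integralD//; last exact: mdist.
apply: ge0_le_integral => //.
- exact: mdist.
- by apply: emeasurable_funD => //; exact: mdist.
- by move=> x _; rewrite -EFinD lee_fin; exact: ler_distD.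
Qed.

End dyadic_dense.

Section density_measure.
Context {R : realType} {d} {T : measurableType d} (m : {measure set T -> \bar R}).
Variable h : T -> \bar R.

Definition density_measure of measurable_fun setT h & (forall x, (0 <= h x)%E) :
  set T -> \bar R := fun A => (\int[m]_(x in A) h x)%E.

Hypotheses (mh : measurable_fun setT h) (h0 : forall x, (0 <= h x)%E).
Local Notation dens := (density_measure mh h0).

Let dens0 : dens set0 = 0%E. Proof. by rewrite /density_measure integral_set0. Qed.
Let dens_ge0 A : (0 <= dens A)%E. Proof. by apply: integral_ge0. Qed.
Let dens_additive : semi_sigma_additive dens.
Proof. exact: (semi_sigma_additive_nng_induced mh h0). Qed.

HB.instance Definition _ := isMeasure.Build _ _ _ dens dens0 dens_ge0 dens_additive.

End density_measure.

Section dyadic_steps.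
Context {R : realType} {d : nat}.
Local Notation point := 'rV[R]_d.
Local Notation LEB := (lebesgue_rV d).
Variables (m : nat) (Z : seq 'rV[int]_d).
Hypothesis uZ : uniq Z.
Local Notation D := (fun v => [set x : point | dyad m x = v]).

Definition step (b : 'rV[int]_d -> R) (x : point) : R := \sum_(v <- Z) b v * \1_(D v) x.

Lemma stepE b x : step b x = if dyad m x \in Z then b (dyad m x) else 0.
Proof.
rewrite /step; case: ifPn => xZ.
  rewrite (bigD1_seq (dyad m x))//= indicE mem_set// mulr1 big1 ?addr0// => v vx.
  by rewrite indicE memNset ?mulr0//= => e; rewrite e eqxx in vx.
rewrite big_seq big1// => v vZ; rewrite indicE memNset ?mulr0//= => e.
by rewrite e vZ in xZ.
Qed.

Lemma measurable_step b : measurable_fun setT (step b).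
Proof.
apply: measurable_sum => v; apply: measurable_funM => //.
by apply: measurable_indic; exact: measurable_dyad.
Qed.

Lemma step_ge0 b x : (forall v, 0 <= b v) -> 0 <= step b x.
Proof. by move=> b0; rewrite stepE; case: ifP. Qed.

Lemma integral_step b A : (forall v, 0 <= b v) -> measurable A ->
  (\int[LEB]_(x in A) (step b x)%:E = \sum_(v <- Z) (b v)%:E * LEB (A `&` D v))%E.
Proof.
move=> b0 mA; have mD v : measurable (D v) by exact: measurable_dyad.
have mi v : measurable_fun A (fun x : point => (\1_(D v) x)%:E : \bar R).
  by apply/measurable_EFinP; apply: measurable_funTS; apply: measurable_indic.
under eq_integral do rewrite /step -sumEFin.
rewrite ge0_integral_sum//.
- apply: eq_bigr => v _; under eq_integral do rewrite EFinM.
  rewrite ge0_integralZl ?lee_fin//.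
  by rewrite integral_indic// setIC.
- by move=> v; under eq_fun do rewrite EFinM; apply: emeasurable_funM.
- by move=> v x _; rewrite lee_fin mulr_ge0.
Qed.

End dyadic_steps.

Lemma shifted_ord_range (K : nat) (a : 'I_(K + K)) : - K%:Z <= a%:Z - K%:Z < K%:Z.
Proof. by case: a => a /= h; lia. Qed.

(** The faces of the box are at multiples of [2 ^- m], so at every level it is exactly a finite
    union of dyadic cubes. *)
Lemma box_indices {R : realType} (d m k : nat) : exists s : seq 'rV[int]_d, uniq s /\
  forall x : 'rV[R]_d, dyad m x \in s <-> box (const_mx (- k%:R)) (const_mx k%:R) x.
Proof.
pose K := (k * 2 ^ m)%N.
pose mk (j : {ffun 'I_d -> 'I_(K + K)}) : 'rV[int]_d := \row_i ((j i)%:Z - K%:Z).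
exists (undup [seq mk j | j <- enum {ffun 'I_d -> 'I_(K + K)}]); split; first exact: undup_uniq.
have p2 : 0 < 2 ^+ m :> R by rewrite exprn_gt0.
move=> x; have /dyadP dx : dyad m x = dyad m x by [].
have KE : K%:R = 2 ^+ m * k%:R :> R by rewrite /K natrM natrX mulrC.
have key i : (- K%:Z <= dyad m x ord0 i < K%:Z) = (- k%:R <= x ord0 i < k%:R).
  rewrite mxE floor_ge_int floor_lt_int mulrNz -pmulrn KE -mulrN.
  by rewrite ler_pM2l// ltr_pM2l.
rewrite mem_undup; split=> [/mapP[j _ e] i|h].
  by rewrite !mxE -key e mxE; exact: shifted_ord_range.
have hi i : - K%:Z <= dyad m x ord0 i < K%:Z by rewrite key; have := h i; rewrite !mxE.
pose w i : int := dyad m x ord0 i + K%:Z.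
have w0 i : 0 <= w i < K%:Z + K%:Z by rewrite /w; have := hi i; lia.
have lt i : (absz (w i) < K + K)%N by have := w0 i; lia.
apply/mapP; exists [ffun i => Ordinal (lt i)]; first by rewrite mem_enum.
apply/rowP => i; rewrite [RHS]mxE ffunE /=; have /andP[/gez0_abs -> _] := w0 i.
by rewrite /w addrK.
Qed.

Section density_approximation.
Context {R : realType} {d : nat}.
Local Notation point := 'rV[R]_d.
Local Notation LEB := (lebesgue_rV d).
Variables (mu : probability point R) (f : point -> R) (nu : {measure set point -> \bar R}).
Variable S : set point.
Hypotheses (mf : measurable_fun setT f) (f0 : forall x, 0 <= f x).
Hypotheses (mS : measurable S) (LS : LEB S = 0%E) (nS : nu (~` S) = 0%E).
Hypothesis muE : forall A, measurable A -> mu A = (\int[LEB]_(x in A) (f x)%:E + nu A)%E.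

Let mfE : measurable_fun setT (fun x => (f x)%:E). Proof. exact/measurable_EFinP. Qed.
Let f0E x : (0 <= (f x)%:E)%E. Proof. by rewrite lee_fin. Qed.

Lemma density_le A : measurable A -> (\int[LEB]_(x in A) (f x)%:E <= mu A)%E.
Proof. by move=> mA; rewrite muE// leeDl. Qed.

Lemma singular_le A : measurable A -> (nu A <= mu A)%E.
Proof. by move=> mA; rewrite muE// leeDr// integral_ge0. Qed.

Lemma density_integrable : LEB.-integrable setT (EFin \o f).
Proof.
apply/integrableP; split=> //=.
under eq_integral do rewrite /= ger0_norm//.
by apply: le_lt_trans (density_le measurableT) _; rewrite probability_setT ltry.
Qed.

(** The error measure is [|f - step| dx + nu], which makes both comparisons with [mu] immediate on
    every set. It is small off the cubes of [E]: inside the large box the step function is close to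
    [f], outside the box [mu] is small, and nearly all of the [nu]-mass, which sits on [S], lies in
    [E]. The volume of [E] is small because [S] is a null set. *)
Lemma density_approximation (e : R) : 0 < e -> exists (m : nat) (Z E : seq 'rV[int]_d)
    (b : 'rV[int]_d -> R) (th : {measure set point -> \bar R}),
  [/\ uniq Z, uniq E, (forall v, 0 <= b v), (exists B, forall v, b v <= B) &
    (forall v, v \in Z -> v \notin E)] /\
  [/\ (size E)%:R * (2 ^- m) ^+ d <= e,
      (th [set x | dyad m x \notin E] <= e%:E)%E,
      (forall A, measurable A ->
        (mu A <= \sum_(v <- Z) (b v)%:E * LEB (A `&` [set x | dyad m x = v]) + th A)%E),
      (forall A, measurable A ->
        (\sum_(v <- Z) (b v)%:E * LEB (A `&` [set x | dyad m x = v]) <= mu A + th A)%E) &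
      (\int[LEB]_x (`|f x - step m Z b x|)%:E <= e%:E)%E].
Proof.
(* Each single error will be at most [e'], and at most four of them are added. *)
move=> e0; pose e' := e / 5; have e'0 : 0 < e' by rewrite divr_gt0.
pose B k : set point := box (const_mx (- k%:R)) (const_mx k%:R).
have mB k : measurable (B k) by exact: measurable_box.
have muoo : (mu setT < +oo)%E by rewrite [X in (X < _)%E](@probability_setT _ _ _ mu) ltry.
have [||||k hk] := @decreasing_null R d mu muoo (fun k => ~` B k) e'.
- by move=> k; exact: measurableC.
- move=> n k nk x; apply: contra_not => h i; have := h i; rewrite !mxE.
  have : n%:R <= k%:R :> R by rewrite ler_nat.
  by move=> ? /andP[? ?]; apply/andP; split; lra.
- apply/seteqP; split=> // x h; have [k hk] := rV_bounded x.
  by apply: (h k I) => i; rewrite !mxE.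
- by [].
have {hk}hB := hk k (leqnn k).
pose M1 : {measure set point -> \bar R} := mrestr LEB (mB k).
have LB : (LEB (B k) < +oo)%E by rewrite [X in (X < _)%E]lebesgue_rV_boxE ltry.
have M1oo : (M1 setT < +oo)%E by rewrite [X in (X < _)%E](_ : _ = LEB (setT `&` B k))// setTI.
have i1 : M1.-integrable setT (EFin \o f).
  apply/integrableP; split=> //=; apply: le_lt_trans (_ : _ <= \int[LEB]_x `|(f x)%:E|)%E _.
    apply: ge0_le_measure_integral => //.
    by move=> A mA; apply: (le_measure LEB (mem_set (measurableI _ _ mA (mB k))) (mem_set mA)); exact: subIsetl.
    by apply/measurable_EFinP; exact: measurableT_comp.
  by have /integrableP[] := density_integrable.
have [_ /(_ _ e'0)[m1 h1]] := integrable_step_approximable M1oo mf i1.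
(* Approximating [S] for the sum of Lebesgue measure and [mu] controls two things at once: the
   volume of the chosen cubes, as [S] is null, and the [mu]-mass of [S] that they miss. *)
pose M2 : {measure set point -> \bar R} := mrestr (measure_add LEB mu) (mB k).
have M2E A : M2 A = (LEB (A `&` B k) + mu (A `&` B k))%E.
  exact: (measure_addE LEB mu (A `&` B k)).
have M2oo : (M2 setT < +oo)%E.
  by rewrite M2E setTI lte_add_pinfty//; apply: le_lt_trans muoo; apply: (le_measure mu (mem_set (mB k)) (mem_set measurableT)).
have [_ /(_ _ e'0)[m2 h2]] := measurable_dyadic_approximable M2oo mS.
pose m := maxn m1 m2.
have [g0 hg0] := h1 m (leq_maxl _ _); have [E0 hE0] := h2 m (leq_maxr _ _).
have [s [us hs]] := @box_indices R d m k.
pose E := [seq v <- s | `[< E0 v >]]; pose Z := [seq v <- s | ~~ `[< E0 v >]].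
(* The absolute value makes the step function non-negative and, as [f] is non-negative, does not
   increase its distance to [f]. *)
pose b v := if v \in s then `|g0 v| else 0.
have b0 v : 0 <= b v by rewrite /b; case: ifP.
have bB : exists B, forall v, b v <= B.
  exists (\sum_(w <- s) `|g0 w|) => v; rewrite /b; case: ifPn => [vs|_]; last exact: sumr_ge0.
  by rewrite (bigD1_seq v)//= lerDl sumr_ge0.
have uZ : uniq Z by exact: filter_uniq.
have uE : uniq E by exact: filter_uniq.
have ZE v : v \in Z -> v \notin E by rewrite !mem_filter => /andP[/negPf -> _].
pose DE := [set x : point | dyad m x \in E].
have mdy (P : pred 'rV[int]_d) : measurable [set x : point | P (dyad m x)].
  exact: (measurable_dyad_set m [set v | P v]).
have mDE : measurable DE by exact: (mdy (fun v => v \in E)).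
have DEP x : DE x <-> B k x /\ E0 (dyad m x).
  rewrite /DE /= mem_filter; split=> [/andP[/asboolP h /hs]|[/hs h1' h2']]; first by [].
  by rewrite h1' andbT; apply/asboolP.
have ZP x : (dyad m x \in Z) <-> B k x /\ ~ DE x.
  rewrite mem_filter DEP; split=> [/andP[/asboolPn h /hs Bx]|[Bx h]]; first by split=> // -[].
  by apply/andP; split; [apply/asboolPn => h'; exact: h|exact/hs].
pose W := [set x : point | E0 (dyad m x)].
have mW : measurable W by exact: measurable_dyad_set.
have msd : measurable (symdiff S W) by apply: measurableU; exact: measurableD.
have mDES : measurable (DE `\` S) by exact: measurableD.
have mSDE : measurable (S `\` DE) by exact: measurableD.
have msdB : measurable (symdiff S W `&` B k) by exact: measurableI.
have DESsub : DE `\` S `<=` symdiff S W `&` B k.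
  by move=> x [/DEP[Bx Wx] nSx]; split=> //; right.
have sd_e : (LEB (symdiff S W `&` B k) + mu (symdiff S W `&` B k) <= e'%:E)%E by rewrite -M2E.
have Lsd : (LEB (DE `\` S) <= e'%:E)%E.
  apply: le_trans (le_measure LEB (mem_set mDES) (mem_set msdB) DESsub) _.
  by apply: le_trans sd_e; rewrite leeDl.
have musd A : measurable A -> A `<=` symdiff S W `&` B k -> (mu A <= e'%:E)%E.
  move=> mA sA; apply: le_trans (le_measure mu (mem_set mA) (mem_set msdB) sA) _.
  by apply: le_trans sd_e; rewrite leeDr.
pose df x := (`|f x - step m Z b x|)%:E : \bar R.
have mdf : measurable_fun setT df.
  apply/measurable_EFinP; apply: measurableT_comp => //; apply: measurable_funB => //.
  exact: measurable_step.
have df0 x : (0 <= df x)%E by rewrite lee_fin.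
pose dens : {measure set point -> \bar R} := density_measure LEB mdf df0.
pose th : {measure set point -> \bar R} := measure_add dens nu.
have thE A : th A = (\int[LEB]_(x in A) df x + nu A)%E by exact: (measure_addE dens nu A).
have outZ A : (forall x, A x -> dyad m x \notin Z) -> measurable A -> (dens A <= mu A)%E.
  move=> hA mA; apply: le_trans (density_le mA); rewrite le_eqVlt; apply/orP; left; apply/eqP.
  apply: eq_integral => x /set_mem /hA xZ.
  by rewrite /df stepE// (negPf xZ) subr0 ger0_norm.
have densS : dens S = 0%E.
  by apply: null_set_integral => //; exact: measurable_funTS.
have dDE : (dens DE <= e'%:E)%E.
  have sub : DE `<=` (DE `\` S) `|` S.
    by move=> x Dx; have [Sx|nSx] := pselect (S x); [right|left].
  apply: le_trans (le_measure dens (mem_set mDE) (mem_set (measurableU _ _ mDES mS)) sub) _.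
  apply: le_trans (measureU2 dens mDES mS) _.
  rewrite [X in (_ + X)%E]densS adde0; apply: le_trans (outZ _ _ mDES) _; last exact: musd.
  by move=> x [Dx _]; apply/negP => /ZP[].
have dB : (dens (~` B k) <= e'%:E)%E.
  apply: le_trans (outZ _ _ (measurableC (mB k))) hB.
  by move=> x nB; apply/negP => /ZP[].
have mBD : measurable (B k `\` DE) by exact: measurableD.
have mdg : measurable_fun setT (fun x => (`|f x - g0 (dyad m x)|)%:E).
  apply/measurable_EFinP; apply: measurableT_comp => //; apply: measurable_funB => //.
  exact: measurable_dyad_fun.
have dI : (dens (B k `\` DE) <= e'%:E)%E.
  apply: le_trans hg0.
  apply: (@le_trans _ _ (\int[LEB]_(x in B k) (`|f x - g0 (dyad m x)|)%:E)%E); last first.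
    have -> : (\int[LEB]_(x in B k) (`|f x - g0 (dyad m x)|)%:E = \int[M1]_(x in B k) (`|f x - g0 (dyad m x)|)%:E)%E.
      apply: eq_measure_integral => A mA AB.
      by rewrite [RHS](_ : _ = LEB (A `&` B k)) // (setIidl AB).
    by apply: ge0_subset_integral => //; exact: mB.
  apply: (@le_trans _ _ (\int[LEB]_(x in B k `\` DE) (`|f x - g0 (dyad m x)|)%:E)%E).
    apply: ge0_le_integral => //; [exact: measurable_funTS|exact: measurable_funTS|].
    move=> x [Bx nD]; rewrite /df lee_fin stepE// ifT; last exact/ZP.
    rewrite /b ifT; last exact/hs.
    by rewrite -[X in `|X - _|](ger0_norm (f0 x)); exact: ler_dist_dist.
  by apply: (ge0_subset_integral LEB mBD (mB k)) => //; try exact: measurable_funTS; move=> x [].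
exists m, Z, E, b, th; split=> //; split.
- have [_ eL] := measure_partition LEB uE (fun v => measurable_dyad m v) mDE
    (fun v vE x (xv : dyad m x = v) => (eq_ind_r (fun w => w \in E) vE xv : DE x))
    (fun v w x (xv : dyad m x = v) (xw : dyad m x = w) => etrans (esym xv) xw).
  have sumL : (\sum_(v <- E) LEB [set x : point | dyad m x = v] = ((size E)%:R * (2 ^- m) ^+ d)%:E)%E.
    under eq_bigr do rewrite dyad_cell lebesgue_rV_cell ?invr_ge0 ?exprn_ge0//.
    by rewrite sumEFin big_const_seq count_predT iter_addr_0 mulr_natl.
  rewrite -lee_fin -sumL; apply: (@le_trans _ _ (LEB DE)); first by rewrite [leRHS]eL leeDl.
  have sub : DE `<=` (DE `\` S) `|` S.
    by move=> x Dx; have [Sx|nSx] := pselect (S x); [right|left].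
  apply: le_trans (le_measure LEB (mem_set mDE) (mem_set (measurableU _ _ mDES mS)) sub) _.
  apply: le_trans (measureU2 LEB mDES mS) _.
  rewrite [X in (_ + X)%E]LS adde0; apply: le_trans Lsd _; rewrite lee_fin /e'; lra.
- have mnE : measurable [set x : point | dyad m x \notin E] by exact: (mdy (fun v => v \notin E)).
  have -> : e%:E = ((e' + e') + (e' + e' + e'))%:E by congr EFin; rewrite /e'; lra.
  rewrite [leLHS](thE) EFinD; apply: leeD.
    have sub : [set x : point | dyad m x \notin E] `<=` (B k `\` DE) `|` ~` B k.
      by move=> x /negP nE; have [Bx|nB] := pselect (B k x); [left|right].
    apply: le_trans (le_measure dens (mem_set mnE) (mem_set (measurableU _ _ mBD (measurableC (mB k)))) sub) _.
    apply: le_trans (measureU2 dens mBD (measurableC (mB k))) _.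
    by rewrite EFinD; apply: leeD.
  have sub : [set x : point | dyad m x \notin E] `<=` (S `\` DE) `|` ~` S.
    by move=> x /negP nE; have [Sx|nSx] := pselect (S x); [left|right].
  apply: le_trans (le_measure nu (mem_set mnE) (mem_set (measurableU _ _ mSDE (measurableC mS))) sub) _.
  apply: le_trans (measureU2 nu mSDE (measurableC mS)) _.
  rewrite [X in (_ + X)%E]nS adde0; apply: le_trans (singular_le mSDE) _.
  have mSB : measurable ((S `\` DE) `&` B k) by exact: measurableI.
  have sub2 : S `\` DE `<=` ((S `\` DE) `&` B k) `|` ~` B k.
    by move=> x hx; have [Bx|nB] := pselect (B k x); [left|right].
  apply: le_trans (le_measure mu (mem_set mSDE) (mem_set (measurableU _ _ mSB (measurableC (mB k)))) sub2) _.
  apply: le_trans (measureU2 mu mSB (measurableC (mB k))) _.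
  apply: (@le_trans _ _ (e'%:E + e'%:E)%E).
    apply: leeD => //; apply: musd => // x [[Sx nD] Bx]; split=> //; left; split=> // Wx.
    by apply: nD; apply/DEP.
  by rewrite -EFinD lee_fin; lra.
- move=> A mA; rewrite muE// thE addeA leeD2r// -integral_step//.
  rewrite -ge0_integralD//; last 3 first.
  + by move=> x _; rewrite lee_fin; exact: step_ge0.
  + by apply/measurable_EFinP; apply: measurable_funTS; exact: measurable_step.
  + exact: measurable_funTS.
  apply: ge0_le_integral => //; first exact: measurable_funTS.
    apply: emeasurable_funD; last exact: measurable_funTS.
    by apply/measurable_EFinP; apply: measurable_funTS; exact: measurable_step.
  move=> x _; rewrite -EFinD lee_fin; have := ler_norm (f x - step m Z b x); lra.
- move=> A mA; rewrite muE// thE addeACA -integral_step//.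
  apply: le_trans (_ : _ <= \int[LEB]_(x in A) (f x)%:E + \int[LEB]_(x in A) df x)%E _; last first.
    by rewrite leeDl// adde_ge0.
  rewrite -ge0_integralD//; last 2 first.
  + exact: measurable_funTS.
  + exact: measurable_funTS.
  apply: ge0_le_integral => //.
  + by move=> x _; rewrite lee_fin; exact: step_ge0.
  + by apply/measurable_EFinP; apply: measurable_funTS; exact: measurable_step.
  + by apply: emeasurable_funD; exact: measurable_funTS.
  + move=> x _; rewrite -EFinD lee_fin; have := ler_norm (step m Z b x - f x); rewrite distrC; lra.
- have sub : setT `<=` (B k `\` DE) `|` (DE `|` ~` B k).
    move=> x _; have [Bx|nB] := pselect (B k x); last by right; right.
    by have [Dx|nD] := pselect (DE x); [right; left|left].
  have mU := measurableU _ _ mDE (measurableC (mB k)).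
  apply: (@le_trans _ _ (dens setT)); first by [].
  apply: le_trans (le_measure dens (mem_set measurableT) (mem_set (measurableU _ _ mBD mU)) sub) _.
  apply: le_trans (measureU2 dens mBD mU) _.
  apply: (@le_trans _ _ (e'%:E + (e'%:E + e'%:E))%E).
    apply: leeD => //; apply: le_trans (measureU2 dens mDE (measurableC (mB k))) _; exact: leeD.
  by rewrite -!EFinD lee_fin /e'; lra.
Qed.

End density_approximation.

(** * The limit of the normalised mean *)

Lemma sum_count_le {T : Type} (I : eqType) (s : seq I) (c : I -> pred T) (l : seq T) : uniq s ->
  (forall i j x, c i x -> c j x -> i = j) -> (\sum_(i <- s) count (c i) l <= size l)%N.
Proof.
move=> us cd; elim: l => [|x l IH]; first by rewrite big1.
rewrite /= big_split /= -add1n leq_add//.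
have [/hasP[i si cix]|/hasPn h] := boolP (has (c^~ x) s).
  rewrite (bigD1_seq i)//= cix big1// => j ji.
  by case: (boolP (c j x)) => // cjx; rewrite (cd _ _ _ cjx cix) eqxx in ji.
by rewrite big_seq big1// => i /h /negPf ->.
Qed.

Lemma cvg_sum_seq {R : realType} {T : Type} (F : set_system T) {FF : Filter F} (I : Type) (s : seq I)
    (a : I -> T -> R) (l : I -> R) :
  (forall i, a i x @[x --> F] --> l i) -> \sum_(i <- s) a i x @[x --> F] --> \sum_(i <- s) l i.
Proof.
move=> al; elim: s => [|i s IH].
  by rewrite big_nil; under eq_fun do rewrite big_nil; exact: cvg_cst.
by rewrite big_cons; under eq_fun do rewrite big_cons; exact: cvgD.
Qed.

Lemma cvg_expr {R : realType} {T : Type} (F : set_system T) {FF : Filter F} (a : T -> R) (l : R) n :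
  a x @[x --> F] --> l -> a x ^+ n @[x --> F] --> l ^+ n.
Proof.
move=> al; elim: n => [|n IH].
  by rewrite expr0; under eq_fun do rewrite expr0; exact: cvg_cst.
by rewrite exprS; under eq_fun do rewrite exprS; exact: cvgM.
Qed.

Lemma cvg_truncn_scaled {R : realType} (r : nat -> R) (h : R) : 0 <= h -> (forall n, 0 < r n) ->
  r n @[n --> \oo] --> 0 -> (Num.truncn (h / r n))%:R * r n @[n --> \oo] --> h.
Proof.
move=> h0 r0 cr.
have c0 : h - r n @[n --> \oo] --> h.
  by have c : h - r n @[n --> \oo] --> h - 0; [apply: cvgB => //; exact: cvg_cst|move: c; rewrite subr0].
apply: (squeeze_cvgr _ c0 (cvg_cst h)); near=> n.
have hr : 0 <= h / r n by rewrite divr_ge0// ltW.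
have /andP[k1 k2] := truncn_itv hr.
rewrite -ler_pdivlMr// k1 andbT.
have : h < (Num.truncn (h / r n)).+1%:R * r n by rewrite -ltr_pdivrMr.
by rewrite -natr1 mulrDl mul1r; lra.
Unshelve. all: by end_near. Qed.

Section intensity_integral.
Context {R : realType} {d : nat}.
Local Notation point := 'rV[R]_d.
Local Notation LEB := (lebesgue_rV d).
Variables (Phi : R -> R) (C t : R).
Hypotheses (C0 : 0 <= C) (t_gt0 : 0 < t) (Phi0 : Phi 0 = 0).
Hypothesis Phi_lip : forall x y, 0 <= x -> 0 <= y -> `|Phi x - Phi y| <= C * `|x - y|.

(** The Lipschitz bound on [Phi] is known for non-negative arguments only, so [Phi] is composed with
    [Num.max 0] to get a function continuous on the whole line. *)
Lemma measurable_lipschitz_comp (g : point -> R) : measurable_fun setT g -> (forall x, 0 <= g x) ->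
  measurable_fun setT (fun x => Phi (t * g x) / t).
Proof.
move=> mg g0; pose P y := Phi (Num.max 0 y).
have cP : continuous P.
  move=> x; apply/cvgrPdist_le => e e0; have C1 : 0 < C + 1 by rewrite ltr_wpDl.
  have e1 : 0 < e / (C + 1) by rewrite divr_gt0.
  have hn : \forall y \near x, `|x - y| <= e / (C + 1).
    by have /cvgrPdist_le/(_ _ e1) := @cvg_id _ (nbhs x).
  apply: filterS hn => y hy; apply: le_trans (Phi_lip _ _) _; rewrite ?le_max ?lexx//.
  apply: (@le_trans _ _ ((C + 1) * `|x - y|)); last by rewrite mulrC -ler_pdivlMr.
  apply: ler_pM => //; first by rewrite lerDl.
  by case: (ltP 0 x) => ?; case: (ltP 0 y) => ?; rewrite ler_norml; apply/andP; split;
    have := ler_norm (x - y); have := ler_norm (y - x); rewrite (distrC y x); lra.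
have -> : (fun x => Phi (t * g x) / t) = (fun x => P (t * g x) / t).
  by apply/funext => x; rewrite /P max_r// mulr_ge0// ltW.
apply: measurable_funM => //.
by apply: (measurableT_comp (continuous_measurable_fun cP)); exact: measurable_funM.
Qed.

Let bnd (g : point -> R) x : (forall x, 0 <= g x) -> `|Phi (t * g x) / t| <= C * g x.
Proof.
move=> g0; have tg : 0 <= t * g x by rewrite mulr_ge0// ltW.
have := Phi_lip tg (lexx 0); rewrite Phi0 !subr0 (ger0_norm tg) => h.
rewrite normrM normfV (gtr0_norm t_gt0) ler_pdivrMr//; apply: le_trans h _.
by rewrite le_eqVlt; apply/orP; left; apply/eqP; ring.
Qed.

Lemma integrable_intensity (g : point -> R) : measurable_fun setT g -> (forall x, 0 <= g x) ->
  LEB.-integrable setT (EFin \o g) -> LEB.-integrable setT (EFin \o (fun x => Phi (t * g x) / t)).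
Proof.
move=> mg g0 ig; have iCg : LEB.-integrable setT (fun x => C%:E * (g x)%:E)%E by exact: integrableZl.
apply: (le_integrable measurableT _ _ iCg).
  by apply/measurable_EFinP; exact: measurable_lipschitz_comp.
by move=> x _; rewrite -EFinM /= lee_fin [leRHS]ger0_norm ?mulr_ge0//; exact: bnd.
Qed.

Lemma intensity_integral_dist (f g : point -> R) (e : R) :
  measurable_fun setT f -> (forall x, 0 <= f x) -> LEB.-integrable setT (EFin \o f) ->
  measurable_fun setT g -> (forall x, 0 <= g x) ->
  (\int[LEB]_x (`|f x - g x|)%:E <= e%:E)%E ->
  `|(\int[LEB]_x (Phi (t * f x) / t))%R - (\int[LEB]_x (Phi (t * g x) / t))%R| <= C * e.
Proof.
move=> mf f0 jf mg g0 he.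
have mfg : measurable_fun setT (fun x => f x - g x) by exact: measurable_funB.
have jfg : LEB.-integrable setT (EFin \o (fun x => f x - g x)).
  apply/integrableP; split; first exact/measurable_EFinP.
  by apply: le_lt_trans he _; exact: ltry.
have jg : LEB.-integrable setT (EFin \o g).
  have -> : EFin \o g = ((EFin \o f) \- (EFin \o (fun x => (f x - g x)%R)))%E.
    by apply/funext => x /=; rewrite -EFinB; congr EFin; ring.
  exact: integrableB.
have j1 := integrable_intensity mf f0 jf; have j2 := integrable_intensity mg g0 jg.
rewrite -RintegralB//.
have j3 : LEB.-integrable setT (EFin \o (fun x => Phi (t * f x) / t - Phi (t * g x) / t)).
  have -> : EFin \o (fun x => Phi (t * f x) / t - Phi (t * g x) / t) =
    ((EFin \o (fun x => (Phi (t * f x) / t)%R)) \- (EFin \o (fun x => (Phi (t * g x) / t)%R)))%E.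
    by apply/funext => x /=; rewrite EFinB.
  exact: integrableB.
apply: le_trans (le_normr_Rintegral measurableT j3) _.
have m3 : measurable_fun setT (fun x => Phi (t * f x) / t - Phi (t * g x) / t).
  by apply: measurable_funB; exact: measurable_lipschitz_comp.
have key : (\int[LEB]_x (`|Phi (t * f x) / t - Phi (t * g x) / t|)%:E <= (C * e)%:E)%E.
  apply: (@le_trans _ _ (\int[LEB]_x (C%:E * (`|f x - g x|)%:E))%E).
    apply: ge0_le_integral => //.
    - by apply/measurable_EFinP; exact: measurableT_comp.
    - by apply: emeasurable_funM => //; apply/measurable_EFinP; exact: measurableT_comp.
    move=> x _; rewrite -EFinM lee_fin -mulrBl normrM normfV (gtr0_norm t_gt0) ler_pdivrMr//.
    have tf : 0 <= t * f x by rewrite mulr_ge0// ltW.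
    have tg : 0 <= t * g x by rewrite mulr_ge0// ltW.
    apply: le_trans (Phi_lip tf tg) _; rewrite -mulrBr normrM (gtr0_norm t_gt0).
    by rewrite le_eqVlt; apply/orP; left; apply/eqP; ring.
  rewrite ge0_integralZl//; last by apply/measurable_EFinP; exact: measurableT_comp.
  by rewrite EFinM; apply: lee_wpmul2l; rewrite ?lee_fin.
rewrite -lee_fin /Rintegral fineK// ge0_fin_numE; last by apply: integral_ge0 => x _; rewrite lee_fin.
by apply: le_lt_trans key _; exact: ltry.
Qed.

Lemma intensity_integral_step m (Z : seq 'rV[int]_d) (b : 'rV[int]_d -> R) : uniq Z ->
  (forall v, 0 <= b v) -> (forall x, 0 <= x -> 0 <= Phi x) ->
  (\int[LEB]_x (Phi (t * step m Z b x) / t))%R =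
  \sum_(v <- Z) Phi (t * b v) / t * (2 ^- m) ^+ d.
Proof.
move=> uZ b0 P0; pose a v := Phi (t * b v) / t.
have a0 v : 0 <= a v by rewrite divr_ge0 ?P0 ?mulr_ge0// ltW.
have -> : (fun x : point => Phi (t * step m Z b x) / t) = (fun x => step m Z a x).
  apply/funext => x; rewrite !stepE//; case: ifP => // _.
  by rewrite mulr0 Phi0 mul0r.
rewrite /Rintegral integral_step//.
under eq_bigr do rewrite setTI dyad_cell lebesgue_rV_cell ?invr_ge0 ?exprn_ge0// -EFinM.
by rewrite sumEFin.
Qed.

End intensity_integral.

(** The arithmetic of [mean_near]. The coefficient of [e] has room to spare; what matters is that it
    does not depend on [e]. *)
Lemma two_sided_bound {R : realType} (I T1 Ts u l mn C c2 e tt XA XE XL : R) :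
  0 <= C -> 0 <= c2 -> 0 < e -> tt <= e -> `|I - T1| <= C * e -> `|T1 - Ts| <= e ->
  XA <= e -> XE <= e -> XL <= e -> mn <= u -> u <= (Ts + XA + C * (4 * tt) + e + XE) + e ->
  l <= mn -> Ts - (3 * C + c2) * tt - XL - e <= l -> `|I - mn| <= (9 + 6 * C + c2) * e.
Proof.
move=> C0 c20 e0 te + + hA hE hL h1 h2 h3 h4.
have Ct : C * tt <= C * e by rewrite ler_wpM2l.
have ct : c2 * tt <= c2 * e by rewrite ler_wpM2l.
have Ce : 0 <= C * e by rewrite mulr_ge0// ltW.
have ce : 0 <= c2 * e by rewrite mulr_ge0// ltW.
by rewrite !ler_norml => /andP[d1 d2] /andP[d3 d4]; apply/andP; split; lra.
Qed.

Section mean_limit.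
Context {R : realType} {d : nat}.
Hypothesis d_gt0 : (0 < d)%N.
Local Notation point := 'rV[R]_d.
Local Notation LEB := (lebesgue_rV d).
Variable zeta : {fset point} -> R.
Hypotheses (zeta_ge0 : forall Y, 0 <= zeta Y) (zeta_set0 : zeta fset0 = 0).
Hypotheses (zetaP1 : tuple_measurable zeta) (zetaP2 : translation_invariant zeta).
Hypothesis zetaP5 : vanishing_concentration zeta.
Variables (c1 c2 : R).
Hypotheses (c1_ge0 : 0 <= c1) (c2_ge0 : 0 <= c2).
Hypothesis sub : forall Y Z : {fset point}, [disjoint Y & Z]%fset ->
    zeta (Y `|` Z)%fset <= zeta Y + zeta Z + c1.
Hypothesis sup : forall Y Z : {fset point}, [disjoint Y & Z]%fset ->
    zeta Y + zeta Z - c2 * #|` boundary_points Z Y|%:R <= zeta (Y `|` Z)%fset.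
Local Notation C := (zeta_lip zeta c1 c2).
Local Notation phi := (limit_mean zeta).
Local Notation Phi := (limit_intensity zeta).

Let C0 : 0 <= C. Proof. exact: zeta_lip_ge0. Qed.
Let aZ r : admissible (zeta_seq zeta r).
Proof. exact: (admissible_zeta_seq zeta_ge0 zetaP1 zetaP2 c1_ge0 c2_ge0 sub sup). Qed.

(** Cells of side at most [r * delta] tile the cubes of [E] exactly, so the bound from P5 applies in
    each. The constant [M + c1] is paid once per cell, which is affordable because [E] has small
    volume. *)
Lemma concentrated_cells_bound (m : nat) (E : seq 'rV[int]_d) (K : nat) (eta delta M r : R) (l : seq point) :
  uniq E -> (0 < K)%N -> 0 <= eta -> 0 < r -> 2 ^- m / K%:R <= r * delta ->
  (forall (a : point) (l : seq point), (forall x, x \in l -> forall i, a ord0 i <= x ord0 i <= a ord0 i + r * delta) ->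
    zeta_seq zeta r l <= eta * (size l)%:R + M) ->
  zeta_seq zeta r [seq x <- l | dyad m x \in E] <=
    eta * (size l)%:R + (size E)%:R * K%:R ^+ d * (M + c1).
Proof.
move=> uE K0 eta0 r0 lr conc; set l' := [seq x <- l | _].
pose h := 2 ^- m / K%:R : R.
have K0' : 0 < K%:R :> R by rewrite ltr0n.
have h0 : 0 < h by rewrite divr_gt0// invr_gt0 exprn_gt0.
have Kh : K%:R * h <= 2 ^- m by rewrite /h mulrC divfK// gt_eqF.
pose c (i : 'rV[int]_d * {ffun 'I_d -> 'I_K}) (x : point) := `[< grid_cell m h i x >].
have cD i j x : c i x -> c j x -> i = j.
  by move=> /asboolP h1 /asboolP h2; exact: (grid_cell_inj h0 Kh h1 h2).
have uI := grid_index_uniq K uE.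
apply: le_trans (zeta_seq_family_le zeta_ge0 zeta_set0 zetaP2 c1_ge0 c2_ge0 sub sup r0 cD l' uI) _.
have -> : count (fun x => ~~ has (c^~ x) (grid_index K E)) l' = 0%N.
  apply/eqP; rewrite -leqn0 leqNgt -has_count; apply/hasPn => x.
  rewrite mem_filter => /andP[xE _]; rewrite negbK.
  have [j hj] := @grid_cell_cover R d m K x K0.
  by apply/hasP; exists (dyad m x, j); [rewrite mem_grid_index | apply/asboolP].
rewrite mulr0 addr0.
have sc : (\sum_(i <- grid_index K E) count (c i) l' <= size l)%N.
  by apply: leq_trans (sum_count_le l' uI cD) _; rewrite size_filter count_size.
apply: (@le_trans _ _ (\sum_(i <- grid_index K E) (eta * (count (c i) l')%:R + (M + c1)))).
  apply: ler_sum => i _; rewrite addrA lerD2r.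
  rewrite -size_filter; apply: (conc (grid_corner m h i)) => x.
  rewrite mem_filter => /andP[/asboolP/cellP hx _] q.
  by have := hx q; move: lr; rewrite -/h => lr /andP[? ?]; apply/andP; split; lra.
rewrite big_split /= -mulr_sumr -natr_sum lerD//; first by rewrite ler_wpM2l// ler_nat.
rewrite (sum_grid_index K E (fun=> M + c1)) big_const_seq count_predT iter_addr_0.
by rewrite mulrn_expn -[leLHS]mulr_natl mulrA.
Qed.

Lemma cvg_scale0 (r : nat -> R) (t : R) : (forall n, 0 < r n) ->
  n%:R * r n ^+ d @[n --> \oo] --> t -> r n @[n --> \oo] --> 0.
Proof.
move=> r0 ct; have c0 := @cvg_intensity0 R (fun n => r n ^+ d) t ct.
apply/cvgrPdist_le => e e0; have ed : 0 < (e : R) ^+ d by exact: exprn_gt0.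
have hn := @cvgr_le R nat \oo _ (fun n => r n ^+ d) 0 c0 (e ^+ d) ed.
near=> n; have h : r n ^+ d <= (e : R) ^+ d by near: n; exact: hn.
by rewrite sub0r normrN (gtr0_norm (r0 n)) -(@ler_pXn2r _ d)// ?nnegrE ?ltW.
Unshelve. all: by end_near. Qed.

(** One [s] serves three purposes: the Poisson means per unit volume are near their limits, the
    constant c1 per cell is spread over a large volume, and the boundary layers occupy a small
    proportion of each cell. *)
Lemma exists_scale (I : Type) (Z : seq I) (lam w : I -> R) (A B e : R) :
  (forall v, 0 <= lam v) -> 0 <= A -> 0 <= B -> 0 < e ->
  exists s, [/\ 2 < s, `|\sum_(v <- Z) w v * Phi (lam v) - \sum_(v <- Z) w v * (phi (lam v) s / s ^+ d)| <= e,
    A / s ^+ d <= e & B * (1 - ((s - 2) / s) ^+ d) <= e].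
Proof.
move=> lam0 A0 B0 e0.
have c : \sum_(v <- Z) w v * (phi (lam v) s / s ^+ d) @[s --> +oo] --> \sum_(v <- Z) w v * Phi (lam v).
  apply: cvg_sum_seq => v; apply: cvgMr.
  exact: (cvg_limit_intensity d_gt0 zeta_ge0 zeta_set0 zetaP1 zetaP2 c1_ge0 c2_ge0 sub sup (lam0 v)).
near (pinfty_nbhs R) => s; exists s.
have s3 : 3 <= s by near: s; apply: nbhs_pinfty_ge; exact: num_real.
have hA : A / e <= s by near: s; apply: nbhs_pinfty_ge; exact: num_real.
have hB : B * (d%:R * 2) / e <= s by near: s; apply: nbhs_pinfty_ge; exact: num_real.
have s0 : 0 < s by lra.
split; first by lra.
- by near: s; move/cvgrPdist_le: c => /(_ _ e0).
- apply: (@le_trans _ _ (A / s)); last by rewrite ler_pdivrMr// [leRHS]mulrC -ler_pdivrMr.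
  rewrite ler_wpM2l// lef_pV2 ?posrE ?exprn_gt0//.
  by rewrite -[leLHS]expr1 ler_weXn2l//; lra.
have q01 : 0 <= (s - 2) / s <= 1.
  by rewrite divr_ge0 ?(ltW s0)//= ?ler_pdivrMr//; lra.
apply: (@le_trans _ _ (B * (d%:R * (2 / s)))).
  rewrite ler_wpM2l//; apply: le_trans (one_sub_expr_le d q01) _.
  rewrite ler_wpM2l// le_eqVlt; apply/orP; left; apply/eqP; field; rewrite gt_eqF//.
rewrite (_ : B * _ = B * (d%:R * 2) / s); last by ring.
by rewrite ler_pdivrMr// [leRHS]mulrC -ler_pdivrMr.
Unshelve. all: by end_near. Qed.

Section sequence.
Variables (mu : probability point R) (f : point -> R).
Hypothesis fP : is_ac_density mu f.
Variables (r : nat -> R) (t : R).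
Hypotheses (r0 : forall n, 0 < r n) (t0 : 0 < t) (rt : n%:R * r n ^+ d @[n --> \oo] --> t).

(** The choices are made in the order [e], then [delta] and [M] from P5, then the dyadic
    approximation, then [s]; only then does [n] grow, and each term of the cell bounds divided by
    [n] has a limit with all the rest fixed. *)
Lemma mean_near (e : R) : 0 < e -> \forall n \near \oo,
  `|(\int[LEB]_x (Phi (t * f x) / t))%R - n%:R^-1 * mean_sample 1 mu n (zeta_seq zeta (r n))| <=
  (9 + 6 * C + c2) * e.
Proof.
move=> e0; have [mf f0 [nu [[S [mS LS nS]] muE]]] := fP.
have p01 : 0 <= (1 : R) <= 1 by rewrite ler01 lexx.
have [delta [M [delta0 M0 conc]]] :=
  zeta_seq_concentrated zeta_ge0 zeta_set0 zetaP2 c1_ge0 c2_ge0 sub sup zetaP5 e0.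
(* G is the limiting cost per unit volume of [E]: about [(h / (delta * r n)) ^ d] concentrated cells
   per cube of side [h], each costing [M + c1], divided by [n], where [n * r n ^+ d] tends to [t].
   The accuracy [e1] is chosen to make [e1 * G] at most [e]. *)
pose G := (M + c1) / (delta ^+ d * t).
have G0 : 0 <= G by rewrite divr_ge0 ?addr_ge0// mulr_ge0 ?exprn_ge0 ?ltW.
have G1 : 0 < G + 1 by rewrite ltr_wpDl.
pose e1 := Num.min e (e / (G + 1)).
have e10 : 0 < e1 by rewrite lt_min e0 divr_gt0.
have e1e : e1 <= e by rewrite ge_min lexx.
have e1G : e1 * G <= e.
  have : e1 * (G + 1) <= e by rewrite -ler_pdivlMr// ge_min lexx orbT.
  rewrite mulrDr mulr1; lra.
have [m [Z [E [b [th [[uZ uE b0 [Bm bB] ZE] [hE hth hu hl hfg]]]]]]] :=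
  density_approximation mf f0 mS LS nS muE e10.
pose h := 2 ^- m : R; have h0 : 0 < h by rewrite invr_gt0 exprn_gt0.
have Phi0 : Phi 0 = 0.
  apply/eqP; rewrite eq_le.
  rewrite (limit_intensity_ge0 d_gt0 zeta_ge0 zeta_set0 zetaP1 zetaP2 c1_ge0 c2_ge0 sub sup (lexx 0)) andbT.
  have := limit_intensity_le d_gt0 zeta_ge0 zeta_set0 zetaP1 zetaP2 c1_ge0 c2_ge0 sub sup (lexx 0).
  by rewrite mulr0.
have Plip x y : 0 <= x -> 0 <= y -> `|Phi x - Phi y| <= C * `|x - y|.
  exact: (limit_intensity_lipschitz d_gt0 zeta_ge0 zeta_set0 zetaP1 zetaP2 c1_ge0 c2_ge0 sub sup).
have P0 x : 0 <= x -> 0 <= Phi x.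
  exact: (limit_intensity_ge0 d_gt0 zeta_ge0 zeta_set0 zetaP1 zetaP2 c1_ge0 c2_ge0 sub sup).
pose T1 := \sum_(v <- Z) h ^+ d / t * Phi (t * b v).
have dT : `|(\int[LEB]_x (Phi (t * f x) / t))%R - T1| <= C * e.
  have -> : T1 = (\int[LEB]_x (Phi (t * step m Z b x) / t))%R.
    rewrite (intensity_integral_step t0 Phi0 m uZ b0 P0); apply: eq_bigr => v _.
    by rewrite /h; ring.
  have sg (x : point) : 0 <= step m Z b x by exact: step_ge0.
  have dd := intensity_integral_dist C0 t0 Phi0 Plip mf f0 (density_integrable mf f0 muE)
    (measurable_step m Z b) sg hfg.
  have Cee : C * e1 <= C * e by rewrite ler_wpM2l.
  exact: le_trans dd Cee.
have tb v : 0 <= t * b v by rewrite mulr_ge0// ltW.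
pose A := (size Z)%:R * h ^+ d * c1 / t.
pose B := c2 * \sum_(v <- Z) b v * h ^+ d.
have A0 : 0 <= A by rewrite /A divr_ge0 ?mulr_ge0 ?exprn_ge0 ?(ltW h0) ?(ltW t0).
have B0 : 0 <= B by rewrite mulr_ge0// sumr_ge0// => v _; rewrite mulr_ge0// exprn_ge0// ltW.
have [s [s2 hs1 hs2 hs3]] := exists_scale Z (fun=> h ^+ d / t) tb A0 B0 e0.
rewrite -/T1 in hs1.
have s0 : 0 < s by apply: lt_trans s2; rewrite ltr0n.
pose nG (x : point) := dyad m x \notin E.
have mnG : measurable [set x | nG x] by exact: (measurable_dyad_set m [set v | v \notin E]).
pose tt := fine (th [set x | nG x]).
have ttE : th [set x | nG x] = tt%:E.
  by rewrite /tt fineK// ge0_fin_numE//; apply: le_lt_trans hth _; exact: ltry.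
have tte : tt <= e by apply: le_trans e1e; rewrite -lee_fin -ttE.
have tt0 : 0 <= tt by rewrite -lee_fin -ttE.
have ZnG (x : point) : dyad m x \in Z -> nG x by move=> /ZE.
have hu' (A' : set point) : measurable A' -> A' `<=` [set x | nG x] ->
    (1%:E * mu A' <= \sum_(v <- Z) (b v)%:E * LEB (A' `&` [set x | dyad m x = v]) + th A')%E.
  by move=> mA' _; rewrite mul1e; exact: hu.
have hl' (A' : set point) : measurable A' -> A' `<=` [set x | nG x] ->
    (\sum_(v <- Z) (b v)%:E * LEB (A' `&` [set x | dyad m x = v]) <= 1%:E * mu A' + th A')%E.
  by move=> mA' _; rewrite mul1e; exact: hl.
have cr := cvg_scale0 r0 rt.
(* [K n] is rounded down so that cells of the prescribed side [r n * s] stay inside the dyadic cube;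
   [K' n] is rounded up so that the cells of an exact tiling have side at most [r n * delta]. *)
pose K n := Num.truncn (h / s / r n); pose K' n := (Num.truncn (h / delta / r n)).+1.
have hs0 : 0 <= h / s by rewrite divr_ge0 ?ltW.
have hd0 : 0 <= h / delta by rewrite divr_ge0 ?ltW.
have cKr : (K n)%:R * r n @[n --> \oo] --> h / s by exact: cvg_truncn_scaled.
have cKr' : (K' n)%:R * r n @[n --> \oo] --> h / delta.
  have c : (Num.truncn (h / delta / r n))%:R * r n + r n @[n --> \oo] --> h / delta + 0.
    by apply: cvgD => //; exact: cvg_truncn_scaled.
  rewrite addr0 in c; apply: cvg_trans c; apply: near_eq_cvg; near=> n.
  by rewrite /K' -natr1 mulrDl mul1r.
have kapE (k : nat -> nat) (y : R) : (k n)%:R * r n @[n --> \oo] --> y ->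
    (k n)%:R ^+ d / n%:R @[n --> \oo] --> y ^+ d / t.
  move=> ck; have c : ((k n)%:R * r n) ^+ d / (n%:R * r n ^+ d) @[n --> \oo] --> y ^+ d / t.
    by apply: cvgM; [exact: cvg_expr | apply: cvgV => //; rewrite gt_eqF].
  apply: cvg_trans c; apply: near_eq_cvg; near=> n.
  have rn : r n ^+ d != 0 by rewrite expf_neq0// gt_eqF.
  by rewrite exprMn invfM [LHS](_ : _ = (k n)%:R ^+ d / n%:R * (r n ^+ d / r n ^+ d)); [rewrite divff// mulr1|ring].
have ckap := kapE K _ cKr; have ckap' := kapE K' _ cKr'.
pose q n v := b v * (r n * s) ^+ d.
have cbin v : bin_mean zeta n (q n v) s @[n --> \oo] --> phi (t * b v) s.
  apply: (cvg_bin_mean zeta_ge0 zeta_set0 zetaP1 zetaP2 c1_ge0 c2_ge0 sub sup).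
    by move=> n; rewrite mulr_ge0// exprn_ge0// mulr_ge0 ?ltW.
  have c : (n%:R * r n ^+ d) * (b v * s ^+ d) @[n --> \oo] --> t * (b v * s ^+ d) by exact: cvgMl.
  rewrite mulrA in c; apply: cvg_trans c; apply: near_eq_cvg; near=> n.
  by rewrite /q exprMn; ring.
(* [U] and [L] are the upper and lower cell bounds divided by [n], the former with the concentrated
   cells included. Their limits differ from [T1] only by terms already made small. *)
pose U n := \sum_(v <- Z) (K n)%:R ^+ d / n%:R * (bin_mean zeta n (q n v) s + c1) +
   C * (\sum_(v <- Z) b v * (h ^+ d - ((K n)%:R * r n * s) ^+ d) + 4 * tt) + c1 * n%:R^-1 + e +
   (size E)%:R * ((K' n)%:R ^+ d / n%:R) * (M + c1).
pose L n := \sum_(v <- Z) (K n)%:R ^+ d / n%:R * bin_mean zeta n (q n v) s - (3 * C + c2) * tt -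
   c2 * \sum_(v <- Z) ((K n)%:R * r n) ^+ d * (b v * (s ^+ d - (s - 2) ^+ d)).
have cinv : (n%:R^-1 : R) @[n --> \oo] --> 0.
  have c := @cvg_intensity0 R (fun n => 1 / n%:R) 1 (@cvg_const_rate R 1).
  by apply: cvg_trans c; apply: near_eq_cvg; near=> n; rewrite mul1r.
have cU : U n @[n --> \oo] --> \sum_(v <- Z) (h / s) ^+ d / t * (phi (t * b v) s + c1) +
   C * (\sum_(v <- Z) b v * (h ^+ d - (h / s * s) ^+ d) + 4 * tt) + c1 * 0 + e +
   (size E)%:R * ((h / delta) ^+ d / t) * (M + c1).
  apply: cvgD; [apply: cvgD; [apply: cvgD; [apply: cvgD|]|]|].
  - by apply: cvg_sum_seq => v; apply: cvgM => //; apply: cvgD => //; exact: cvg_cst.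
  - apply: cvgMr; apply: cvgD; last exact: cvg_cst.
    apply: cvg_sum_seq => v; apply: cvgMr; apply: cvgB; first exact: cvg_cst.
    by apply: cvg_expr; exact: cvgMl.
  - exact: cvgMr.
  - exact: cvg_cst.
  - by apply: cvgMl; exact: cvgMr.
have cL : L n @[n --> \oo] --> \sum_(v <- Z) (h / s) ^+ d / t * phi (t * b v) s - (3 * C + c2) * tt -
   c2 * \sum_(v <- Z) (h / s) ^+ d * (b v * (s ^+ d - (s - 2) ^+ d)).
  apply: cvgB; [apply: cvgB|].
  - by apply: cvg_sum_seq => v; exact: cvgM.
  - exact: cvg_cst.
  - by apply: cvgMr; apply: cvg_sum_seq => v; apply: cvgMl; exact: cvg_expr.
have sd0 : s ^+ d != 0 by rewrite expf_neq0// gt_eqF.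
have hsd : (h / s) ^+ d = h ^+ d / s ^+ d by rewrite expr_div_n.
pose Ts := \sum_(v <- Z) h ^+ d / t * (phi (t * b v) s / s ^+ d).
rewrite -/Ts in hs1.
have Tsl : \sum_(v <- Z) (h / s) ^+ d / t * phi (t * b v) s = Ts.
  by apply: eq_bigr => v _; rewrite hsd; ring.
have Tsu : \sum_(v <- Z) (h / s) ^+ d / t * (phi (t * b v) s + c1) = Ts + A / s ^+ d.
  rewrite -Tsl; under eq_bigr do rewrite mulrDr.
  rewrite big_split /=; congr (_ + _).
  by rewrite big_const_seq count_predT iter_addr_0 hsd -mulr_natl /A; ring.
have UE : \sum_(v <- Z) b v * (h ^+ d - (h / s * s) ^+ d) = 0.
  by rewrite divfK ?gt_eqF// big1// => v _; rewrite subrr mulr0.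
have EE : (size E)%:R * ((h / delta) ^+ d / t) * (M + c1) <= e.
  have -> : (size E)%:R * ((h / delta) ^+ d / t) * (M + c1) = (size E)%:R * h ^+ d * G.
    by rewrite /G expr_div_n [(delta ^+ d * t)^-1]invfM; ring.
  by apply: le_trans e1G; rewrite ler_wpM2r.
have LE : c2 * \sum_(v <- Z) (h / s) ^+ d * (b v * (s ^+ d - (s - 2) ^+ d)) <= e.
  have -> : c2 * \sum_(v <- Z) (h / s) ^+ d * (b v * (s ^+ d - (s - 2) ^+ d)) = B * (1 - ((s - 2) / s) ^+ d).
    rewrite /B -mulrA mulr_suml; congr (_ * _); apply: eq_bigr => v _.
    rewrite hsd expr_div_n; move: sd0; move: (s ^+ d) ((s - 2) ^+ d) (h ^+ d) => x w y x0.
    by field.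
  by [].
rewrite Tsu UE add0r mulr0 addr0 in cU; rewrite Tsl in cL.
have CB : 0 <= (Bm + 1) * s ^+ d.
  by rewrite mulr_ge0 ?exprn_ge0 ?(ltW s0)//; have := le_trans (b0 0) (bB 0); lra.
(* As [b] is bounded, the keeping probabilities tend to 0 uniformly in [v] and so are at most 1 from
   some [n] on. *)
have cq : (Bm + 1) * (r n * s) ^+ d @[n --> \oo] --> (Bm + 1) * (0 * s) ^+ d.
  by apply: cvgMr; apply: cvg_expr; exact: cvgMl.
rewrite mul0r expr0n gtn_eqF// mulr0 in cq.
near=> n.
have n0 : (0 < n)%N by near: n; exact: nbhs_infty_gt.
have nR : 0 < n%:R :> R by rewrite ltr0n.
have q1 v : b v * (r n * s) ^+ d <= 1.
  apply: (@le_trans _ _ ((Bm + 1) * (r n * s) ^+ d)).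
    rewrite ler_wpM2r ?exprn_ge0 ?mulr_ge0 ?ltW//.
    by apply: le_lt_trans (bB v) _; rewrite ltrDl.
  by near: n; apply: (cvgr_le _ cq); exact: ltr01.
have Krs : (K n)%:R * (r n * s) <= 2 ^- m.
  have hr : 0 <= h / s / r n by rewrite divr_ge0// ltW.
  have /andP[k1 _] := truncn_itv hr.
  by rewrite [r n * s]mulrC mulrA -!ler_pdivlMr// in k1 *; move: k1; rewrite !ler_pdivlMr// mulrAC.
have Krd : 2 ^- m / (K' n)%:R <= r n * delta.
  have hr : 0 <= h / delta / r n by rewrite divr_ge0// ltW.
  have /andP[_ k2] := truncn_itv hr; rewrite -/(K' n) in k2.
  rewrite ler_pdivrMr ?ltr0n// mulrC mulrA; apply: ltW.
  by move: k2; rewrite !ltr_pdivrMr.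
have up1 := mean_upper zeta_ge0 zeta_set0 zetaP1 zetaP2 c1_ge0 c2_ge0 sub sup
  p01 uZ b0 mnG ZnG (r0 n) s2 Krs q1 ttE hu' hl' n.
have lo1 := mean_lower zeta_ge0 zetaP1 zetaP2 c1_ge0 c2_ge0 sub sup
  p01 uZ b0 mnG ZnG (r0 n) s2 Krs q1 ttE hu' hl' n.
pose mn := mean_sample 1 mu n (zeta_seq zeta (r n)).
pose QQ := e * n%:R + (size E)%:R * (K' n)%:R ^+ d * (M + c1).
have afG : admissible (fun l => zeta_seq zeta (r n) (seq.filter nG l)) by exact: admissible_filter.
have up2 : mn <= mean_sample 1 mu n (fun l => zeta_seq zeta (r n) (seq.filter nG l)) + (c1 + QQ).
  apply: (@le_trans _ _ (mean_sample 1 mu n (fun l => zeta_seq zeta (r n) (seq.filter nG l) + (c1 + QQ)))).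
    apply: le_mean_sample => //; first by apply: admissibleD => //; exact: admissible_cst.
    move=> l ln; apply: le_trans (zeta_seq_split_le sub (r0 n) nG l) _.
    rewrite -addrA lerD2l lerD2l.
    have -> : seq.filter (predC nG) l = [seq x <- l | dyad m x \in E].
      by apply: eq_filter => x; rewrite /= /nG negbK.
    apply: le_trans (concentrated_cells_bound l uE (ltn0Sn _) (ltW e0) (r0 n) Krd (fun a l => conc (r n) a l (r0 n))) _.
    by rewrite /QQ lerD2r ler_wpM2l ?(ltW e0)// ler_nat.
  by rewrite mean_sampleD//; [rewrite mean_sample_cst | exact: admissible_cst].
have nn0 : n%:R != 0 :> R by rewrite gt_eqF.
have eA : \sum_(v <- Z) (K n)%:R ^+ d * (bin_mean zeta n (q n v) s + c1) =
    n%:R * \sum_(v <- Z) (K n)%:R ^+ d / n%:R * (bin_mean zeta n (q n v) s + c1).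
  by rewrite mulr_sumr; apply: eq_bigr => v _; rewrite mulrA [n%:R * _]mulrC divfK.
have eB : \sum_(v <- Z) b v * ((2 ^- m) ^+ d - ((K n)%:R * (r n * s)) ^+ d) =
    \sum_(v <- Z) b v * (h ^+ d - ((K n)%:R * r n * s) ^+ d).
  by apply: eq_bigr => v _; rewrite /h mulrA.
have upn : n%:R^-1 * mn <= U n.
  rewrite ler_pdivrMl//; apply: le_trans up2 _; apply: le_trans (lerD up1 (lexx _)) _.
  rewrite [X in X + _ * _ * _ + _]eA eB /U /QQ.
  move: (\sum_(v <- Z) _) (\sum_(v <- Z) _) => SB SC.
  by rewrite le_eqVlt; apply/orP; left; apply/eqP; field.
have eC : \sum_(v <- Z) (K n)%:R ^+ d * bin_mean zeta n (q n v) s =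
    n%:R * \sum_(v <- Z) (K n)%:R ^+ d / n%:R * bin_mean zeta n (q n v) s.
  by rewrite mulr_sumr; apply: eq_bigr => v _; rewrite mulrA [n%:R * _]mulrC divfK.
have eD : \sum_(v <- Z) (K n)%:R ^+ d * (b v * ((r n * s) ^+ d - (r n * (s - 2)) ^+ d)) =
    \sum_(v <- Z) ((K n)%:R * r n) ^+ d * (b v * (s ^+ d - (s - 2) ^+ d)).
  by apply: eq_bigr => v _; rewrite !exprMn; ring.
have lon : L n <= n%:R^-1 * mn.
  rewrite ler_pdivlMl//; apply: le_trans lo1.
  rewrite [X in _ <= X - _ - _]eC [X in _ <= _ - _ * X]eD /L.
  move: (\sum_(v <- Z) _) (\sum_(v <- Z) _) => SB SC.
  by rewrite le_eqVlt; apply/orP; left; apply/eqP; ring.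
have hU : U n <= (Ts + A / s ^+ d + C * (4 * tt) + e + (size E)%:R * ((h / delta) ^+ d / t) * (M + c1)) + e.
  by near: n; apply: (cvgr_le _ cU); rewrite ltrDl.
have hL : Ts - (3 * C + c2) * tt - c2 * \sum_(v <- Z) (h / s) ^+ d * (b v * (s ^+ d - (s - 2) ^+ d)) - e <= L n.
  by near: n; apply: (cvgr_ge _ cL); rewrite ltrBlDr ltrDl.
exact: (two_sided_bound C0 c2_ge0 e0 tte dT hs1 hs2 EE LE upn hU lon hL).
Unshelve. all: by end_near. Qed.

Lemma cvg_mean_sample : n%:R^-1 * mean_sample 1 mu n (zeta_seq zeta (r n)) @[n --> \oo] -->
  (\int[LEB]_x (Phi (t * f x) / t))%R.
Proof.
apply/cvgrPdist_le => e e0.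
have k0 : 0 < 9 + 6 * C + c2 by have := C0; have := c2_ge0; lra.
near=> n; have -> : e = (9 + 6 * C + c2) * (e / (9 + 6 * C + c2)) by rewrite mulrC divfK// gt_eqF.
by near: n; apply: mean_near; rewrite divr_gt0.
Unshelve. all: by end_near. Qed.

End sequence.
End mean_limit.

(** * Exponentially small sequences and moments of Poisson variables *)

Definition exp_small {R : realType} (u : nat -> \bar R) : Prop :=
  exists A a n0, [/\ 0 <= A, 0 < a < 1 & forall n, (n0 <= n)%N -> (u n <= (A * a ^+ n)%:E)%E].

Section exp_small.
Context {R : realType}.
Implicit Types u v : nat -> \bar R.

Lemma exp_small_le u v n0 : (forall n, (n0 <= n)%N -> u n <= v n)%E -> exp_small v -> exp_small u.
Proof.
move=> uv [A [a [n1 [A0 a01 h]]]]; exists A, a, (maxn n0 n1); split=> // n.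
rewrite geq_max => /andP[h0 h1]; exact: le_trans (uv _ h0) (h _ h1).
Qed.

Lemma exp_smallD u v : exp_small u -> exp_small v -> exp_small (fun n => u n + v n)%E.
Proof.
move=> [A [a [n1 [A0 /andP[a0 a1] h]]]] [B [b [n2 [B0 /andP[b0 b1] k]]]].
exists (A + B), (Num.max a b), (maxn n1 n2); split; first exact: addr_ge0.
  by rewrite lt_max a0 gt_max a1 b1.
move=> n; rewrite geq_max => /andP[h0 h1]; rewrite mulrDl EFinD.
have m0 : 0 <= Num.max a b by rewrite le_max ltW.
apply: leeD.
  apply: le_trans (h _ h0) _; rewrite lee_fin ler_wpM2l// lerXn2r ?nnegrE ?(ltW a0)//.
  by rewrite le_max lexx.
apply: le_trans (k _ h1) _; rewrite lee_fin ler_wpM2l// lerXn2r ?nnegrE ?(ltW b0)//.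
by rewrite le_max lexx orbT.
Qed.

(** Raising the constant by [a ^- n0] makes the geometric bound at least 1 for [n < n0], where only
    [u n <= 1] is known, so the exceptional indices are dominated as well. *)
Lemma exp_small_summable u : (forall n, (0 < n)%N -> 0 <= u n <= 1)%E -> exp_small u ->
  (\sum_(1 <= n <oo) u n < +oo)%E.
Proof.
move=> u01 [A [a [n0 [A0 /andP[a0 a1] h]]]].
pose B := A + a ^- n0.
have B0 : 0 <= B by rewrite addr_ge0// invr_ge0 exprn_ge0// ltW.
have ub n : (0 < n)%N -> (u n <= (geometric B a n)%:E)%E.
  move=> np.
  have [n0n|nn0] := leqP n0 n.
    apply: le_trans (h _ n0n) _; rewrite lee_fin /geometric /=.
    by rewrite ler_wpM2r ?exprn_ge0 ?(ltW a0)// lerDl invr_ge0 exprn_ge0// ltW.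
  have /andP[_ u1] := u01 n np; apply: le_trans u1 _; rewrite lee_fin /geometric /= mulrDl.
  have an : 1 <= a ^- n0 * a ^+ n.
    rewrite mulrC ler_pdivlMr ?exprn_gt0// mul1r.
    by apply: ler_wiXn2l; rewrite ?(ltW a0) ?(ltW a1) ?(ltnW nn0).
  by apply: le_trans an _; rewrite lerDr mulr_ge0// exprn_ge0// ltW.
have g0 k : (0 <= (geometric B a k)%:E)%E by rewrite lee_fin mulr_ge0// exprn_ge0// ltW.
have cg : cvgn (series (geometric B a)) by apply: is_cvg_geometric_series; rewrite ger0_norm// ltW.
have w : (\sum_(0 <= k <oo) (geometric B a k)%:E = (limn (series (geometric B a)))%:E)%E.
  rewrite -EFin_lim//; congr (limn _); apply/funext => n /=; by rewrite /series /= sumEFin.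
apply: (@le_lt_trans _ _ (\sum_(1 <= k <oo) (geometric B a k)%:E)%E).
  (* Nothing is known of [u 0]; as the sum starts at 1, it may be replaced by 0. *)
  pose v n := if n is 0 then 0%E else u n.
  rewrite (_ : \big[+%E/0%E]_(1 <= n <oo) u n = \big[+%E/0%E]_(1 <= n <oo) v n)%E; last first.
    by apply: congr_lim; apply/funext => n; apply: eq_big_nat => i /andP[i0 _]; case: i i0.
  apply: lee_nneseries => [[|i] // _ _|[|i] _]; first by have /andP[] := u01 i.+1 isT.
    exact: g0.
  exact: ub.
have := @nneseries_split R (fun k => (geometric B a k)%:E) 0 1 (fun k _ => g0 k).
rewrite w add0n => e; apply: (@le_lt_trans _ _ (limn (series (geometric B a)))%:E); last exact: ltry.
by rewrite e leeDr// sume_ge0.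
Qed.

Lemma exp_small_cvg0 (u : nat -> R) : (forall n, 0 <= u n) -> exp_small (EFin \o u) ->
  u n @[n --> \oo] --> 0.
Proof.
move=> u0 [A [a [n0 [A0 /andP[a0 a1] h]]]].
have cg : geometric A a n @[n --> \oo] --> 0 by apply: cvg_geometric; rewrite ger0_norm// ltW.
apply: (squeeze_cvgr _ (cvg_cst 0) cg); near=> n.
rewrite u0 /=; have := h n; rewrite /= lee_fin; apply.
by near: n; exact: nbhs_infty_ge.
Unshelve. all: by end_near. Qed.

End exp_small.

Section poisson_moments.
Context {R : realType} {dO} {Omega : measurableType dO} (P : probability Omega R).
Variables (N : Omega -> nat) (t : R).
Hypotheses (t_gt0 : 0 < t) (NP : has_poisson_law P N t).

Lemma measurable_poisson_natr : measurable_fun setT (fun w => (N w)%:R : R).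
Proof.
have [mN _] := NP.
have mR : measurable_fun setT (fun k : nat => k%:R : R) by [].
exact: (measurableT_comp mR mN).
Qed.

Lemma poisson_expR (sg : R) :
  (\int[P]_w (expR (sg * (N w)%:R))%:E = (expR (t * (expR sg - 1)))%:E)%E.
Proof.
have [mN pN] := NP; have mNR := measurable_poisson_natr.
have mk k : measurable (N @^-1` [set k]).
  by rewrite -[X in measurable X]setTI; exact: mN.
have U : \bigcup_k (N @^-1` [set k]) = setT.
  by apply/seteqP; split=> // w _; exists (N w).
have mf : measurable_fun setT (fun w => (expR (sg * (N w)%:R))%:E).
  apply/measurable_EFinP; apply: measurableT_comp => //; exact: measurable_funM.
rewrite -U ge0_integral_bigcup//; last 2 first.
- by rewrite U.
- by move=> i j _ _ [w [/= <- <-]].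
have e k : (\int[P]_(w in N @^-1` [set k]) (expR (sg * (N w)%:R))%:E =
    (expR (- t))%:E * (exp_coeff (t * expR sg) k)%:E)%E.
  transitivity (\int[P]_(w in N @^-1` [set k]) (expR (sg * k%:R))%:E)%E.
    by apply: eq_integral => w /set_mem /= ->.
  rewrite integral_cst// [X in (_ * X)%E]pN -!EFinM; congr EFin.
  by rewrite /exp_coeff /= exprMn [sg * _]mulrC expRM_natl; ring.
rewrite (eq_eseriesr (fun k _ => e k)) nneseriesZl; last first.
  by move=> k _; rewrite lee_fin divr_ge0// exprn_ge0// mulr_ge0 ?expR_ge0// ltW.
have -> : (\sum_(0 <= k <oo) (exp_coeff (t * expR sg) k)%:E = (expR (t * expR sg))%:E)%E.
  rewrite /expR -EFin_lim; last exact: is_cvg_series_exp_coeff.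
  by congr (limn _); apply/funext => n /=; rewrite /series /= sumEFin.
by rewrite -EFinM -expRD; congr (expR _)%:E; ring.
Qed.

Lemma poisson_centered_expR (sg : R) : `|sg| <= 2^-1 ->
  (\int[P]_w (expR (sg * ((N w)%:R - t)))%:E <= (expR (2 * sg ^+ 2 * t))%:E)%E.
Proof.
move=> sg1; have mNR := measurable_poisson_natr.
have mf : measurable_fun setT (fun w => (expR (sg * (N w)%:R))%:E).
  apply/measurable_EFinP; apply: measurableT_comp => //; exact: measurable_funM.
have e w : (expR (sg * ((N w)%:R - t)))%:E = ((expR (- (sg * t)))%:E * (expR (sg * (N w)%:R))%:E)%E.
  by rewrite -EFinM -expRD; congr (expR _)%:E; ring.
under eq_integral do rewrite e.
rewrite ge0_integralZl ?lee_fin ?expR_ge0//.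
rewrite poisson_expR -EFinM -expRD lee_fin ler_expR.
have h := expR_le_quadratic sg1.
have h2 : t * (expR sg - 1) <= t * (sg + 2 * sg ^+ 2) by rewrite ler_wpM2l ?(ltW t_gt0)//; lra.
lra.
Qed.

Lemma poisson_tail (s x : R) : 0 < s <= 2^-1 ->
  (P [set w | (x < `|(N w)%:R - t|)%R] <= (2 * expR (2 * s ^+ 2 * t - s * x))%:E)%E.
Proof.
move=> /andP[s0 s1]; have mNR := measurable_poisson_natr.
have mY : measurable_fun setT (fun w => (N w)%:R - t) by exact: measurable_funB.
have mS sg : measurable [set w | s * x < sg * ((N w)%:R - t)].
  rewrite -[X in measurable X]setTI; apply: measurable_fun_ltr => //.
  exact: measurable_funM.
have tail sg : `|sg| = s ->
    (P [set w | (s * x < sg * ((N w)%:R - t))%R] <= (expR (2 * s ^+ 2 * t - s * x))%:E)%E.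
  move=> sgs; have mG : measurable_fun setT (fun w => expR (sg * ((N w)%:R - t))).
    by apply: measurableT_comp => //; exact: measurable_funM.
  have sg1 : `|sg| <= 2^-1 by rewrite sgs.
  have s2 : sg ^+ 2 = s ^+ 2 by rewrite -sgs real_normK// num_real.
  apply: (@le_trans _ _ (\int[P]_w ((expR (- (s * x)))%:E * (expR (sg * ((N w)%:R - t)))%:E))%E).
    rewrite -(setIT [set w | _]) -integral_indic//; apply: ge0_le_integral => //.
    - exact/measurable_EFinP.
    - by apply/measurable_EFinP; exact: measurable_funM.
    - move=> w _; rewrite -EFinM -expRD lee_fin indicE; case: (boolP (_ \in _)) => [/set_mem /= h|_]; last by rewrite expR_ge0.
      by rewrite -[leLHS]expR0 ler_expR; lra.
  rewrite ge0_integralZl ?lee_fin ?expR_ge0//; last exact/measurable_EFinP.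
  apply: (@le_trans _ _ ((expR (- (s * x)))%:E * (expR (2 * sg ^+ 2 * t))%:E)%E).
    by apply: lee_wpmul2l; [rewrite lee_fin expR_ge0 | exact: poisson_centered_expR].
  by rewrite -EFinM -expRD s2 addrC.
have sub : [set w | x < `|(N w)%:R - t|] `<=`
    [set w | s * x < s * ((N w)%:R - t)] `|` [set w | s * x < - s * ((N w)%:R - t)].
  move=> w /=; rewrite ltr_normr => /orP[h|h]; [left|right].
    by rewrite ltr_pM2l.
  by rewrite mulNr -mulrN ltr_pM2l.
have mN : measurable [set w | x < `|(N w)%:R - t|].
  rewrite -[X in measurable X]setTI; apply: measurable_fun_ltr => //.
  exact: measurableT_comp.
apply: le_trans (le_measure P (mem_set mN) (mem_set (measurableU _ _ (mS s) (mS (- s)))) sub) _.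
apply: (le_trans (measureU2 P (mS s) (mS (- s)))) => //.
rewrite mulrDl !mul1r EFinD leeD// tail ?normrN ?gtr0_norm//.
Qed.

(** With [s = 1 / sqrt t] one has [y ^ 2 = t * (s * y) ^ 2 <= 4 * t * (expR (s * y) + expR (- s *
    y))], and for the centred variable each exponential has mean at most [expR 2]. The assumption
    [4 <= t] gives the required [s <= 1/2]. *)
Lemma poisson_square : 4 <= t ->
  (\int[P]_w ((((N w)%:R - t) ^+ 2)%R)%:E <= (8 * expR 2 * t)%:E)%E.
Proof.
move=> t4; have mNR := measurable_poisson_natr.
have mY : measurable_fun setT (fun w => (N w)%:R - t) by exact: measurable_funB.
pose s := (Num.sqrt t)^-1.
have st : s ^+ 2 = t^-1 by rewrite /s exprVn sqr_sqrtr// ltW.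
have s0 : 0 < s by rewrite invr_gt0 sqrtr_gt0.
have s1 : s <= 2^-1.
  rewrite lef_pV2 ?posrE ?sqrtr_gt0//.
  rewrite -(@ler_pXn2r _ 2)// ?nnegrE ?sqrtr_ge0// sqr_sqrtr ?(ltW t_gt0)//.
  by rewrite (_ : 2 ^+ 2 = 4 :> R)//; ring.
have mG sg : measurable_fun setT (fun w => expR (sg * ((N w)%:R - t))).
  by apply: measurableT_comp => //; exact: measurable_funM.
apply: (@le_trans _ _ (\int[P]_w ((4 * t)%:E * ((expR (s * ((N w)%:R - t)))%:E + (expR (- s * ((N w)%:R - t)))%:E)))%E).
  apply: ge0_le_integral => //.
  - by move=> w _; rewrite lee_fin sqr_ge0.
  - by apply/measurable_EFinP; exact: measurable_funX.
  - apply: emeasurable_funM => //; apply: emeasurable_funD; exact/measurable_EFinP.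
  move=> w _; rewrite -EFinD -EFinM lee_fin; set y := (N w)%:R - t.
  have ts : t * s ^+ 2 = 1 by rewrite st divff// gt_eqF.
  have -> : y ^+ 2 = t * (s * y) ^+ 2 by rewrite exprMn mulrA ts mul1r.
  rewrite mulNr -mulrA [leRHS]mulrCA ler_wpM2l ?(ltW t_gt0)//.
  set z := s * y; have p1 := expR_gt0 (z / 2); have p2 := expR_gt0 (- z / 2).
  have q1 := expR_ge1Dx (z / 2); have q2 := expR_ge1Dx (- z / 2).
  have r1 : expR z = expR (z / 2) ^+ 2 by rewrite -expRM_natl; congr expR; field.
  have r2 : expR (- z) = expR (- z / 2) ^+ 2 by rewrite -expRM_natl; congr expR; field.
  have e4 : z ^+ 2 = 4 * (z / 2) ^+ 2 by field.
  have e4' : z ^+ 2 = 4 * (- z / 2) ^+ 2 by field.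
  have := sqr_ge0 (expR (z / 2)); have := sqr_ge0 (expR (- z / 2)).
  rewrite r1 r2; have [z0|z0] := lerP 0 z.
    have : (z / 2) ^+ 2 <= expR (z / 2) ^+ 2 by rewrite [leLHS]expr2 [leRHS]expr2; apply: ler_pM; lra.
    lra.
  have : (- z / 2) ^+ 2 <= expR (- z / 2) ^+ 2 by rewrite [leLHS]expr2 [leRHS]expr2; apply: ler_pM; lra.
  lra.
rewrite ge0_integralZl//; last 3 first.
- apply: emeasurable_funD; exact/measurable_EFinP.
- by move=> w _; rewrite adde_ge0// lee_fin expR_ge0.
- by rewrite lee_fin mulr_ge0// ltW.
rewrite ge0_integralD//; try (exact/measurable_EFinP); try (by move=> w _; rewrite lee_fin expR_ge0).
have h1 := @poisson_centered_expR s; have h2 := @poisson_centered_expR (- s).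
rewrite normrN sqrrN (ger0_norm (ltW s0)) st in h1 h2.
have e2 : 2 * t^-1 * t = 2 by rewrite -mulrA mulVf ?mulr1// gt_eqF.
rewrite e2 in h1 h2.
apply: (@le_trans _ _ ((4 * t)%:E * ((expR 2)%:E + (expR 2)%:E))%E).
  apply: lee_wpmul2l; first by rewrite lee_fin mulr_ge0// ltW.
  by apply: leeD; [exact: h1|exact: h2].
by rewrite -EFinD -EFinM lee_fin le_eqVlt; apply/orP; left; apply/eqP; ring.
Qed.

End poisson_moments.

Lemma insertion_lipschitz_cat {R : realType} {d} {T : measurableType d} (C : R) (F : seq T -> R) l1 l2 :
  insertion_lipschitz C F -> `|F (l1 ++ l2) - F l1| <= C * (size l2)%:R.
Proof.
move=> lF; elim: l2 => [|x l2 IH]; first by rewrite cats0 subrr normr0 mulr0.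
rewrite /= -natr1 mulrDr mulr1 -(subrKA (F (l1 ++ l2))) addrC.
by apply: le_trans (ler_normD _ _) _; rewrite addrC [leRHS]addrC lerD//.
Qed.

(** * Complete and L2 convergence *)

Section convergence.
Context {R : realType} {d} {T : measurableType d}.
Context {dO} {Omega : measurableType dO}.
Variables (P : probability Omega R) (mu : probability T R) (X : nat -> Omega -> T).
Hypothesis X_iid : iid_from P X mu.
Variables (C c : R) (F : nat -> seq T -> R).
Hypotheses (C0 : 0 <= C) (aF : forall n, admissible (F n)).
Hypotheses (lF : forall n, insertion_lipschitz C (F n)).
Hypotheses (F0 : forall n l, 0 <= F n l) (Fnil : forall n, F n [::] = 0).
Hypothesis mean_cvg : n%:R^-1 * mean_sample 1 mu n (F n) @[n --> \oo] --> c.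

(** The scale [n] and the number of points [k] are separate, so that the Poisson sample is obtained
    at scale [n] with [k] random. *)
Definition scaled_value (n k : nat) (w : Omega) : R :=
  n%:R^-1 * F n [seq X i w | i <- iota 0 k].
Local Notation xi := (fun n => scaled_value n n).

Let mxik n k : measurable_fun setT (scaled_value n k).
Proof. by apply: measurable_funM => //; apply: (measurable_fun_iid X_iid); case: (aF n). Qed.

Lemma measurable_tail (Y : Omega -> R) (e : R) : measurable_fun setT Y ->
  measurable [set w | e < `|Y w - c|].
Proof.
move=> mY; rewrite -[X in measurable X]setTI; apply: measurable_fun_ltr => //.
by apply: measurableT_comp => //; exact: measurable_funB.
Qed.

Lemma scaled_value_tail e : 0 < e -> exp_small (fun n => P [set w | (e < `|xi n w - c|)%R]).
Proof.
move=> e0; have e20 : 0 < e / 2 by rewrite divr_gt0.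
have [a [/andP[a0 a1] h]] := iid_concentration X_iid C0 e20.
have [n0 _ hn0] : \forall n \near \oo, `|c - n%:R^-1 * mean_sample 1 mu n (F n)| <= e / 2.
  by move/cvgrPdist_le: mean_cvg => /(_ _ e20).
exists 2, (Num.max a 2^-1), n0.+1; split=> //.
  by rewrite lt_max gt_max a1 invr_gt0 ltr0n orbT /= invf_lt1 ?ltr1n ?ltr0n.
move=> n nn0; have np : 0 < n%:R :> R by rewrite ltr0n (leq_trans _ nn0).
apply: (@le_trans _ _ (P [set w | n%:R * (e / 2) < `|F n [seq X i w | i <- iota 0 n] - mean_sample 1 mu n (F n)|])).
  have m1 : measurable [set w | e < `|xi n w - c|] by exact: (measurable_tail e (mxik n n)).
  have m2 : measurable [set w | n%:R * (e / 2) < `|F n [seq X i w | i <- iota 0 n] - mean_sample 1 mu n (F n)|].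
    rewrite -[X in measurable X]setTI; apply: measurable_fun_ltr => //.
    apply: measurableT_comp => //; apply: measurable_funB => //.
    by apply: (measurable_fun_iid X_iid); case: (aF n).
  apply: (le_measure P (mem_set m1) (mem_set m2)).
  - move=> w /=; rewrite /scaled_value => he.
    have hm : `|c - n%:R^-1 * mean_sample 1 mu n (F n)| <= e / 2 by exact/hn0/ltnW.
    have h3 : e / 2 < `|n%:R^-1 * (F n [seq X i w | i <- iota 0 n] - mean_sample 1 mu n (F n))|.
      rewrite mulrBr; set a1' := n%:R^-1 * F n _ in he *; set b1 := n%:R^-1 * mean_sample _ _ _ _ in hm *.
      have := ler_normD (a1' - b1) (b1 - c); rewrite addrA subrK (distrC b1 c); lra.
    move: h3; rewrite normrM normfV normr_nat => h3.
    by rewrite mulrC -ltr_pdivlMr// [ltRHS]mulrC.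
apply: (le_trans (h n _ (aF n) (lF n))); rewrite lee_fin ler_wpM2l// lerXn2r ?nnegrE//.
  by rewrite le_max a0.
by rewrite le_max lexx.
Qed.

Lemma scaled_value_complete : converges_completely P xi c.
Proof.
move=> e e0; apply: exp_small_summable; last exact: scaled_value_tail.
by move=> n _; rewrite measure_ge0/=; apply: probability_le1; exact: (measurable_tail _ (mxik _ _)).
Qed.

Let xi_bound n w : 0 <= xi n w <= C.
Proof.
rewrite /scaled_value; apply/andP; split; first by rewrite mulr_ge0// invr_ge0.
have [->|n0] := eqVneq n 0%N; first by rewrite invr0 mul0r.
have n0' : 0 < n%:R :> R by rewrite ltr0n lt0n.
rewrite mulrC ler_pdivrMr//.
have := insertion_lipschitz_size [seq X i w | i <- iota 0 n] (lF n).
by rewrite Fnil subr0 size_map size_iota; apply: le_trans; exact: ler_norm.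
Qed.

(** The values stay between 0 and C, so the mean square is at most [h ^ 2] plus a constant times the
    probability of a deviation above [h], which tends to 0. *)
Lemma scaled_value_square e : 0 < e -> \forall n \near \oo,
  (\int[P]_w (((xi n w - c) ^+ 2)%R)%:E <= e%:E)%E.
Proof.
move=> e0; pose M := C + `|c| + 1.
have M0 : 0 < M by rewrite ltr_wpDl// addr_ge0.
pose h := Num.sqrt (e / 2); have h0 : 0 < h by rewrite sqrtr_gt0 divr_gt0.
have h2 : h ^+ 2 = e / 2 by rewrite sqr_sqrtr// ltW// divr_gt0.
pose B n := [set w | h < `|xi n w - c|].
have mB n : measurable (B n) by exact: (measurable_tail _ (mxik _ _)).
have PB : fine (P (B n)) @[n --> \oo] --> 0.
  apply: exp_small_cvg0 => [n|]; first exact: fine_ge0.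
  apply: (exp_small_le (n0 := 0%N)) (scaled_value_tail h0) => n _ /=; by rewrite fineK// fin_num_measure.
have eM : 0 < e / 2 / M ^+ 2 by rewrite !divr_gt0// exprn_gt0.
near=> n; have hB : fine (P (B n)) <= e / 2 / M ^+ 2.
  by near: n; exact: (cvgr_le _ PB _ eM).
have mxi : measurable_fun setT (xi n) by exact: mxik.
apply: (@le_trans _ _ (\int[P]_w ((e / 2)%:E + (M ^+ 2)%:E * (\1_(B n) w)%:E))%E).
  apply: ge0_le_integral => //.
  - by move=> w _; rewrite lee_fin sqr_ge0.
  - by apply/measurable_EFinP; apply: measurable_funX; exact: measurable_funB.
  - apply/measurable_EFinP; apply: measurable_funD => //; exact: measurable_funM.
  move=> w _; rewrite -EFinM -EFinD lee_fin indicE; case: (boolP (w \in B n)) => hw.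
    have bd : `|xi n w - c| <= M.
      have /andP[x0 x1] := xi_bound n w.
      by apply: le_trans (ler_normB _ _) _; rewrite ger0_norm// /M; lra.
    rewrite mulr1 -[leLHS]real_normK ?num_real//.
    have : `|xi n w - c| ^+ 2 <= M ^+ 2 by rewrite lerXn2r// ?nnegrE// ltW.
    have : 0 <= e / 2 by rewrite ltW// divr_gt0.
    lra.
  rewrite mulr0 addr0 -h2 -[leLHS]real_normK ?num_real// lerXn2r ?nnegrE ?(ltW h0)//.
  by rewrite leNgt; apply/negP => hh; move/negP: hw; apply; exact/mem_set.
rewrite ge0_integralD//; last 3 first.
- by move=> w _; rewrite lee_fin ltW// divr_gt0.
- by move=> w _; rewrite mule_ge0// lee_fin ?exprn_ge0 ?(ltW M0)//.
- by apply/measurable_EFinP; apply: measurable_funM => //; exact: measurable_indic.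
rewrite integral_cst// ge0_integralZl//; last 2 first.
- by apply/measurable_EFinP; exact: measurable_indic.
- by rewrite lee_fin exprn_ge0// ltW.
rewrite integral_indic// setIT [X in (_ * X + _)%E](@probability_setT _ _ _ P) mule1.
have PE : ((M ^+ 2)%:E * P (B n) = (M ^+ 2 * fine (P (B n)))%:E)%E.
  by rewrite [RHS]EFinM fineK// fin_num_measure.
rewrite [X in (_ + X)%E]PE -EFinD lee_fin.
have : M ^+ 2 * fine (P (B n)) <= e / 2 by rewrite mulrC -ler_pdivlMr// exprn_gt0.
lra.
Unshelve. all: by end_near. Qed.

Lemma square_converges_L2 (Y : nat -> Omega -> R) :
  (forall e, 0 < e -> \forall n \near \oo, (\int[P]_w (((Y n w - c) ^+ 2)%R)%:E <= e%:E)%E) ->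
  converges_L2 P Y c.
Proof.
move=> h; rewrite /converges_L2 unlock.
apply/fine_cvgP; split.
  near=> n; rewrite ge0_fin_numE; last by apply: integral_ge0 => w _; rewrite lee_fin sqr_ge0.
  apply: (@le_lt_trans _ _ 1%:E); last exact: ltry.
  by near: n; exact: h.
apply/cvgrPdist_le => e e0; near=> n; rewrite sub0r normrN /=.
have I0 : (0 <= \int[P]_w (((Y n w - c) ^+ 2)%R)%:E)%E.
  by apply: integral_ge0 => w _; rewrite lee_fin sqr_ge0.
have Ie : (\int[P]_w (((Y n w - c) ^+ 2)%R)%:E <= e%:E)%E by near: n; exact: h.
rewrite ger0_norm ?fine_ge0// -lee_fin fineK// ge0_fin_numE//.
exact: le_lt_trans Ie (ltry _).
Unshelve. all: by end_near. Qed.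

Section poissonized.
Variable N : R -> Omega -> nat.
Hypothesis NP : forall t : R, 0 < t -> has_poisson_law P (N t) t.
Local Notation xi' := (fun n w => scaled_value n (N n%:R w) w).

(** Both samples are initial segments of the same sequence, so one arises from the other by
    [|k - n|] insertions at the end. *)
Lemma scaled_value_dist n k w : (0 < n)%N ->
  `|scaled_value n k w - xi n w| <= C / n%:R * `|k%:R - n%:R|.
Proof.
move=> n0; have n0' : 0 < n%:R :> R by rewrite ltr0n.
have key a b : (a <= b)%N ->
    `|F n [seq X i w | i <- iota 0 b] - F n [seq X i w | i <- iota 0 a]| <= C * (b%:R - a%:R).
  move=> ab; rewrite -{1}(subnKC ab) iotaD map_cat.
  have := insertion_lipschitz_cat [seq X i w | i <- iota 0 a] [seq X i w | i <- iota (0 + a) (b - a)] (lF n).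
  by rewrite size_map size_iota natrB.
rewrite /scaled_value -mulrBr normrM gtr0_norm ?invr_gt0// [C / _]mulrC -mulrA ler_pM2l ?invr_gt0//.
have [nk|/ltnW kn] := leqP n k.
  by rewrite [X in _ <= _ * X]ger0_norm ?subr_ge0 ?ler_nat//; exact: key.
by rewrite distrC [X in _ <= _ * X]distrC [X in _ <= _ * X]ger0_norm ?subr_ge0 ?ler_nat//; exact: key.
Qed.

Lemma measurable_scaled_poisson n : (0 < n)%N -> measurable_fun setT (xi' n).
Proof.
move=> n0; have n0' : 0 < n%:R :> R by rewrite ltr0n.
have [mN _] := NP n0'.
have U : setT = \bigcup_k (N n%:R @^-1` [set k]).
  by apply/seteqP; split=> // w _; exists (N n%:R w).
rewrite U; apply/measurable_fun_bigcup => k.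
  by rewrite -[X in measurable X]setTI; exact: mN.
apply: (eq_measurable_fun (scaled_value n k)); last exact: measurable_funTS.
by move=> w /set_mem /= ->.
Qed.

Lemma scaled_poisson_tail e : 0 < e -> exp_small (fun n => P [set w | (e < `|xi' n w - c|)%R]).
Proof.
move=> e0; have e20 : 0 < e / 2 by rewrite divr_gt0.
have C10 : 0 < C + 1 by rewrite ltr_wpDl.
(* If the Poisson number is within [n * y] of [n], the value moves by at most [C * y <= e / 2]. With
   [4 * s <= y], the quadratic term in [poisson_tail] is at most half of the linear one. *)
pose y := e / 2 / (C + 1); have y0 : 0 < y by rewrite divr_gt0.
pose s := Num.min 2^-1 (y / 4).
have s0 : 0 < s by rewrite lt_min invr_gt0 ltr0n divr_gt0.
have s1 : s <= 2^-1 by rewrite ge_min lexx.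
have sy : s * 4 <= y by rewrite -ler_pdivlMr// ge_min lexx orbT.
pose V n := P [set w | n%:R * y < `|(N n%:R w)%:R - n%:R|].
have hV : exp_small V.
  exists 2, (expR (- (s * y / 2))), 1%N; split=> //.
    by rewrite expR_gt0 expR_lt1 oppr_lt0 divr_gt0// mulr_gt0.
  move=> n n0; have n0' : 0 < n%:R :> R by rewrite ltr0n.
  apply: le_trans (poisson_tail n0' (NP n0') (s := s) (n%:R * y) _) _; first by rewrite s0.
  rewrite lee_fin ler_wpM2l// -expRM_natl ler_expR -mulr_natl.
  have : n%:R * (s * (s * 4)) <= n%:R * (s * y) by rewrite ler_pM2l// ler_pM2l.
  lra.
apply: (exp_small_le (n0 := 1%N)) (exp_smallD (scaled_value_tail e20) hV) => n n0.
have n0' : 0 < n%:R :> R by rewrite ltr0n.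
have mNR := measurable_poisson_natr (NP n0').
have m1 : measurable [set w | e / 2 < `|xi n w - c|] by exact: (measurable_tail _ (mxik _ _)).
have m2 : measurable [set w | n%:R * y < `|(N n%:R w)%:R - n%:R|].
  rewrite -[X in measurable X]setTI; apply: measurable_fun_ltr => //.
  by apply: measurableT_comp => //; exact: measurable_funB.
have m3 : measurable [set w | e < `|xi' n w - c|].
  by apply: (measurable_tail _ (measurable_scaled_poisson _)).
apply: le_trans (measureU2 P m1 m2).
apply: (le_measure P (mem_set m3) (mem_set (measurableU _ _ m1 m2))) => w /= he.
have [h1|h1] := ltP (e / 2) `|xi n w - c|; [by left|right].
rewrite ltNge; apply/negP => h2; move: he; apply/negP; rewrite -leNgt.
have h3 := scaled_value_dist (N n%:R w) w n0.
have h4 : C / n%:R * `|(N n%:R w)%:R - n%:R| <= e / 2.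
  apply: (@le_trans _ _ (C / n%:R * (n%:R * y))).
    by rewrite ler_wpM2l// divr_ge0.
  rewrite (_ : _ * _ = C * y); last by field; rewrite gt_eqF.
  apply: (@le_trans _ _ ((C + 1) * y)); first by rewrite ler_wpM2r ?(ltW y0)// lerDl.
  by rewrite /y mulrC divfK// gt_eqF.
have -> : xi' n w - c = (xi' n w - xi n w) + (xi n w - c) by ring.
apply: le_trans (ler_normD _ _) _; lra.
Qed.

Lemma scaled_poisson_complete : converges_completely P xi' c.
Proof.
move=> e e0; have m n : (0 < n)%N -> measurable [set w | e < `|xi' n w - c|].
  by move=> n0; apply: (measurable_tail _ (measurable_scaled_poisson _)).
apply: exp_small_summable; last exact: scaled_poisson_tail.
move=> n n1; rewrite measure_ge0/=; apply: probability_le1; exact: m.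
Qed.

(** The square is at most [2 * (xi n - c) ^ 2 + 2 * (xi' n - xi n) ^ 2], and the mean of the last
    term is of order [1 / n], by [scaled_value_dist] and [poisson_square]. *)
Lemma scaled_poisson_L2 : converges_L2 P xi' c.
Proof.
apply: square_converges_L2 => e e0.
have e4 : 0 < e / 4 by rewrite divr_gt0.
have near1 := scaled_value_square e4.
near=> n.
have hn : (\int[P]_w (((xi n w - c) ^+ 2)%R)%:E <= (e / 4)%:E)%E by near: n.
have n4 : 4 <= n%:R :> R by near: n; exact: nbhs_infty_ger.
have nb : 16 * C ^+ 2 * expR 2 / (e / 2) <= n%:R by near: n; exact: nbhs_infty_ger.
have n0' : 0 < n%:R :> R by apply: lt_le_trans n4.
have n0 : (0 < n)%N by rewrite -(ltr0n R).
have mNR := measurable_poisson_natr (NP n0').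
have mxi : measurable_fun setT (xi n) by exact: mxik.
have mx' := measurable_scaled_poisson n0.
apply: (@le_trans _ _ (\int[P]_w (2%:E * (((xi n w - c) ^+ 2)%R)%:E +
    (2 * (C / n%:R) ^+ 2)%:E * ((((N n%:R w)%:R - n%:R) ^+ 2)%R)%:E))%E).
  apply: ge0_le_integral => //.
  - by move=> w _; rewrite lee_fin sqr_ge0.
  - by apply/measurable_EFinP; apply: measurable_funX; exact: measurable_funB.
  - apply: emeasurable_funD; apply: emeasurable_funM => //;
      by apply/measurable_EFinP; apply: measurable_funX; exact: measurable_funB.
  move=> w _; rewrite -!EFinM -EFinD lee_fin.
  have h3 := scaled_value_dist (N n%:R w) w n0.
  have h4 : (xi' n w - xi n w) ^+ 2 <= (C / n%:R) ^+ 2 * ((N n%:R w)%:R - n%:R) ^+ 2.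
    rewrite -[leLHS]real_normK ?num_real// -[X in _ <= _ * X]real_normK ?num_real// -exprMn.
    by rewrite lerXn2r// nnegrE// mulr_ge0// divr_ge0.
  have h5 : (xi' n w - c) ^+ 2 <= 2 * (xi n w - c) ^+ 2 + 2 * (xi' n w - xi n w) ^+ 2.
    set a := xi' n w; set b := xi n w.
    have : 0 <= (a - b - (b - c)) ^+ 2 by exact: sqr_ge0.
    by rewrite !expr2; lra.
  by apply: le_trans h5 _; rewrite -mulrA lerD2l ler_pM2l.
rewrite ge0_integralD//; last 4 first.
- by move=> w _; rewrite -EFinM lee_fin mulr_ge0// ?sqr_ge0.
- by apply: emeasurable_funM => //; apply/measurable_EFinP; apply: measurable_funX; exact: measurable_funB.
- by move=> w _; rewrite -EFinM lee_fin; apply: mulr_ge0; [apply: mulr_ge0|]; rewrite ?sqr_ge0.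
- by apply: emeasurable_funM => //; apply/measurable_EFinP; apply: measurable_funX; exact: measurable_funB.
have mX2 (Y : Omega -> R) : measurable_fun setT Y -> measurable_fun setT (fun w => ((Y w ^+ 2)%R)%:E : \bar R).
  by move=> mY; apply/measurable_EFinP; exact: measurable_funX.
have ZlE (Y : Omega -> R) (k : R) : measurable_fun setT Y -> 0 <= k ->
    (\int[P]_w (k%:E * ((Y w ^+ 2)%R)%:E) = k%:E * \int[P]_w ((Y w ^+ 2)%R)%:E)%E.
  move=> mY k0; apply: ge0_integralZl => //; try exact: (mX2 _ mY).
  by move=> w _; rewrite lee_fin sqr_ge0.
rewrite (ZlE (fun w => xi n w - c)) ?(ZlE (fun w => (N n%:R w)%:R - n%:R))//; last 3 first.
- exact: measurable_funB.
- by rewrite mulr_ge0// sqr_ge0.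
- exact: measurable_funB.
have hp := poisson_square n0' (NP n0') n4.
have c0 : 0 <= 2 * (C / n%:R) ^+ 2 :> R by rewrite mulr_ge0// ?sqr_ge0.
apply: (@le_trans _ _ (2%:E * (e / 4)%:E + (2 * (C / n%:R) ^+ 2)%:E * (8 * expR 2 * n%:R)%:E)%E).
  by apply: leeD; apply: lee_wpmul2l; rewrite ?lee_fin.
rewrite -!EFinM -EFinD lee_fin.
have -> : 2 * (C / n%:R) ^+ 2 * (8 * expR 2 * n%:R) = 16 * C ^+ 2 * expR 2 / n%:R.
  by field; rewrite gt_eqF.
have : 16 * C ^+ 2 * expR 2 / n%:R <= e / 2.
  by rewrite ler_pdivrMr// [leRHS]mulrC -ler_pdivrMr// ?divr_gt0.
lra.
Unshelve. all: by end_near. Qed.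

End poissonized.
End convergence.

Theorem theorem2p1 (R : realType) (d : nat) (d_gt0 : (0 < d)%N)
    (mu : probability 'rV[R]_d R) (mu_diffuse : diffuse mu)
    (f_mu : 'rV[R]_d -> R) (f_muP : is_ac_density mu f_mu)
    (dO : measure_display) (Omega : measurableType dO)
    (P : probability Omega R)
    (X : nat -> Omega -> 'rV[R]_d) (X_iid : iid_from P X mu)
    (N : R -> Omega -> nat)
    (N_poisson : forall t : R, 0 < t -> has_poisson_law P (N t) t)
    (N_indep : forall t : R, 0 < t ->
      independent_systems P (sigma_of (N t)) (sigma_of_seq X))
    (dH : measure_display) (OmegaH : measurableType dH)
    (PH : probability OmegaH R) (H : R -> OmegaH -> set 'rV[R]_d)
    (H_poisson : forall lambda : R, 0 < lambda ->
      is_homogeneous_poisson PH lambda (H lambda))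
    (r : nat -> R) (r_gt0 : forall n, (1 <= n)%N -> 0 < r n)
    (zeta : {fset 'rV[R]_d} -> R)
    (zeta_ge0 : forall Y, 0 <= zeta Y) (zeta_set0 : zeta fset0 = 0)
    (zetaP1 : tuple_measurable zeta) (zetaP2 : translation_invariant zeta)
    (zetaP3 : almost_subadditive zeta) (zetaP4 : almost_superadditive zeta)
    (zetaP5 : vanishing_concentration zeta) :
  exists rho : R -> R,
    (forall lambda : R, 0 < lambda ->
      ('E_PH[fun w => zeta (fset_set (H lambda w `&` cube s))]
         * ((lambda * s ^+ d)^-1)%:E)%E @[s --> +oo] --> (rho lambda)%:E) /\
    (forall t : R, 0 < t ->
      n%:R * r n ^+ d @[n --> \oo] --> t ->
      let c := (\int[lebesgue_rV d]_x (rho (t * f_mu x) * f_mu x))%R in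
      let xi n w := n%:R^-1 * rescaled zeta (r n) (sample X n w) in
      let xi' n w := n%:R^-1 * rescaled zeta (r n) (sample X (N n%:R w) w) in
      (converges_completely P xi c /\ converges_L2 P xi c) /\
      (converges_completely P xi' c /\ converges_L2 P xi' c)).
Proof.
have [c1 c1_ge0 sub] := zetaP3; have [c2 c2_ge0 sup] := zetaP4.
pose C := zeta_lip zeta c1 c2; have C0 : 0 <= C by exact: zeta_lip_ge0.
pose Phi := limit_intensity zeta.
have Phi_le y : 0 <= y -> Phi y <= C * y.
  exact: (limit_intensity_le d_gt0 zeta_ge0 zeta_set0 zetaP1 zetaP2 c1_ge0 c2_ge0 sub sup).
have Phi_ge0 y : 0 <= y -> 0 <= Phi y.
  exact: (limit_intensity_ge0 d_gt0 zeta_ge0 zeta_set0 zetaP1 zetaP2 c1_ge0 c2_ge0 sub sup).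
(* [Phi lam] is a mean per unit volume; division by [lam] turns it into a mean per point. *)
exists (fun lam => Phi lam / lam); split.
  move=> lam lam0.
  have c := cvg_limit_intensity d_gt0 zeta_ge0 zeta_set0 zetaP1 zetaP2 c1_ge0 c2_ge0 sub sup (ltW lam0).
  have c' : limit_mean zeta lam s / s ^+ d * lam^-1 @[s --> +oo] --> Phi lam * lam^-1 by exact: cvgMl.
  have cE : (limit_mean zeta lam s / s ^+ d * lam^-1)%:E @[s --> +oo] --> (Phi lam * lam^-1)%:E.
    by apply/fine_cvgP; split; [exact: nearW | exact: c'].
  apply: cvg_trans cE.
  apply: near_eq_cvg; near=> s.
  have s0 : 0 < s by near: s; exact: nbhs_pinfty_gt.
  have pm : ('E_PH[fun w => zeta (fset_set (H lam w `&` cube s))] = (limit_mean zeta lam s)%:E)%E.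
    apply: (poisson_mean zeta_ge0 zeta_set0 zetaP1 zetaP2 c1_ge0 c2_ge0 sub sup) => //.
    exact: H_poisson.
  rewrite pm; by rewrite /= -EFinM invfM; congr EFin; ring.
move=> t t0 rt c xi xi'.
(* Nothing is assumed of [r 0]. A positive value is put in its place, which changes neither
   [n * r n ^+ d] nor the normalised mean, both being 0 at [n = 0]. *)
pose r' n := if n is 0 then 1 else r n.
have r'0 n : 0 < r' n by case: n => [|n] //=; exact: r_gt0.
have r't : n%:R * r' n ^+ d @[n --> \oo] --> t.
  have e : (fun n => n%:R * r' n ^+ d) = (fun n => n%:R * r n ^+ d).
    by apply/funext => -[|n]; rewrite ?mulr0n ?mul0r.
  by rewrite e.
have cE : c = \int[lebesgue_rV d]_x (Phi (t * f_mu x) / t).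
  rewrite /c; congr Rintegral; apply/funext => x; have [mf f0 _] := f_muP.
  (* Where the density vanishes, both integrands are 0, the second because [Phi 0 = 0]; elsewhere
     the factor [f_mu x] cancels. *)
  have [fx0|fx] := eqVneq (f_mu x) 0; last by field; rewrite fx gt_eqF.
  rewrite fx0 !mulr0; have -> : Phi 0 = 0; last by rewrite mul0r.
  by apply/eqP; rewrite eq_le Phi_ge0// andbT; have := Phi_le 0 (lexx 0); rewrite mulr0.
have mc : n%:R^-1 * mean_sample 1 mu n (zeta_seq zeta (r n)) @[n --> \oo] --> c.
  have e : (fun n => n%:R^-1 * mean_sample 1 mu n (zeta_seq zeta (r n))) =
      (fun n => n%:R^-1 * mean_sample 1 mu n (zeta_seq zeta (r' n))).
    by apply/funext => -[|n]; rewrite ?mulr0n ?invr0 ?mul0r.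
  rewrite cE e; exact: (cvg_mean_sample d_gt0 zeta_ge0 zeta_set0 zetaP1 zetaP2 zetaP5
    c1_ge0 c2_ge0 sub sup f_muP r'0 t0 r't).
have aF n := admissible_zeta_seq zeta_ge0 zetaP1 zetaP2 c1_ge0 c2_ge0 sub sup (r n).
have lF n := insertion_lipschitz_zeta_seq zeta_ge0 zetaP2 c1_ge0 c2_ge0 sub sup (r n).
have F0 n l : 0 <= zeta_seq zeta (r n) l by exact: zeta_ge0.
have Fnil n : zeta_seq zeta (r n) [::] = 0 by exact: zeta_seq_nil.
have xiE : xi = (fun n => scaled_value X (fun n => zeta_seq zeta (r n)) n n).
  by apply/funext => n; apply/funext => w; rewrite /xi zeta_seq_rescaled.
have xi'E : xi' = (fun n w => scaled_value X (fun n => zeta_seq zeta (r n)) n (N n%:R w) w).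
  by apply/funext => n; apply/funext => w; rewrite /xi' zeta_seq_rescaled.
rewrite xiE xi'E; split; split.
- exact: (scaled_value_complete X_iid C0 aF lF mc).
- apply: square_converges_L2 => e e0.
  exact: (scaled_value_square X_iid C0 aF lF F0 Fnil mc e0).
- exact: (scaled_poisson_complete X_iid C0 aF lF mc N_poisson).
- exact: (scaled_poisson_L2 X_iid C0 aF lF F0 Fnil mc N_poisson).
Unshelve. all: by end_near. Qed.
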